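(* Let $X=(X_1,\dots,X_d)\sim ID(\gamma,0,\nu)$ be an infinitely divisible random vector in $\mathbb{R}^d$ without Gaussian component, with independent components, whose one-dimensional Lévy measures are $\tilde\nu_1,\dots,\tilde\nu_d$, and such that $\mathbb{E}e^{t\|X\|}<+\infty$ for some $t>0$. Let $f:\mathbb{R}^d\to\mathbb{R}$ be Lipschitz with constant $a$, i.e. $|f(x)-f(y)|\le a\|x-y\|$ for all $x,y\in\mathbb{R}^d$, and let $b_k\in\mathbb{R}$, $k=1,\dots,d$, be such that $|f(x+ue_k)-f(x)|\le b_k|u|$ for all $u\in\mathbb{R}$, $x\in\mathbb{R}^d$. Let $M=\sup\{t>0:\ \forall\, k=1,\dots,d,\ \mathbb{E}e^{tb_k|X_k|}<+\infty\}$. Let $\varepsilon>0$ and, for $0\le t<M$, let $$h(t)=2a\sqrt{\sum_{k=1}^d\left(\int_{\mathbb{R}}|u|(e^{tb_k|u|}-1)\tilde\nu_k(du)\right)^2}+\frac{a}{\varepsilon}\sum_{k=1}^d\int_{\mathbb{R}}|u|^2(e^{tb_k|u|}-1)\tilde\nu_k(du).$$ Then, for all $0<x<h(M^-)$, $$\mathbb{P}\left(f(X)\ge f(0)+a\,\mathbb{E}\left([\|X\|-\varepsilon]_+\right)+a\varepsilon+x\right)\le \exp\left(-\int_0^x h^{-1}(s)\,ds\right).$$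
   Context: $\langle\cdot,\cdot\rangle$ and $\|\cdot\|$ are the Euclidean inner product and norm on $\mathbb{R}^d$; $e_1,\dots,e_d$ is the canonical basis; $[y]_+=\max(y,0)$. $X\sim ID(\gamma,0,\nu)$ means that $X$ has characteristic function $\mathbb{E}e^{i\langle t,X\rangle}=\exp\{i\langle t,\gamma\rangle+\int_{\mathbb{R}^d}(e^{i\langle t,u\rangle}-1-i\langle t,u\rangle\mathbf{1}_{\|u\|\le 1})\nu(du)\}$, $t\in\mathbb{R}^d$, where $\gamma\in\mathbb{R}^d$ and $\nu\not\equiv 0$ (the Lévy measure) is a positive Borel measure on $\mathbb{R}^d$ with no atom at the origin and $\int(1\wedge\|u\|^2)\nu(du)<+\infty$. The components of $X$ are independent iff $\nu$ is supported on the coordinate axes, i.e. $\nu(dx_1,\dots,dx_d)=\sum_{k=1}^d\delta_0(dx_1)\cdots\delta_0(dx_{k-1})\tilde\nu_k(dx_k)\delta_0(dx_{k+1})\cdots\delta_0(dx_d)$, where $\tilde\nu_k$ (with no atom at $0$) is the Lévy measure of $X_k$. $h(M^-)=\lim_{t\uparrow M}h(t)\in[0,+\infty]$ and $h^{-1}$ denotes the inverse function of the increasing function $h$, defined on $[0,h(M^-))$. *)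

(* Defs.v *)
From HB Require Import structures.
From mathcomp Require Import all_boot all_order all_algebra.
From mathcomp Require Import complex.
From mathcomp Require Import all_classical all_reals all_analysis.

Set Implicit Arguments.
Unset Strict Implicit.
Unset Printing Implicit Defensive.

Import Order.TTheory GRing.Theory Num.Theory.
Import numFieldTopology.Exports numFieldNormedType.Exports.

Local Open Scope classical_set_scope.
Local Open Scope ring_scope.

(* The Borel sigma-algebra of R^n; the topology is the one induced by the
   library's sup norm, i.e. the usual one. *)
HB.instance Definition _ (R : realType) (n : nat) :=
  Measurable.copy 'rV[R]_n (g_sigma_algebraType (@open 'rV[R]_n)).

Section euclidean.
Context {R : realType} {d : nat}.
Implicit Types x y : 'rV[R]_d.

Definition edot x y : R := \sum_(k < d) x 0 k * y 0 k.

(* The library norm `|x| on row vectors is the sup norm. *)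
Definition enorm x : R := Num.sqrt (edot x x).

End euclidean.

Section complex_valued.
Context {R : realType}.
Local Open Scope complex_scope.

Definition cexp (z : R[i]) : R[i] :=
  (expR (complex.Re z))%:C * (cos (complex.Im z) +i* sin (complex.Im z)).

Definition cintegral {dV} {V : measurableType dV}
    (mu : {measure set V -> \bar R}) (F : V -> R[i]) : R[i] :=
  (\int[mu]_v complex.Re (F v)) +i* (\int[mu]_v complex.Im (F v)).

End complex_valued.

(* The Euclidean space is given by a type V, its inner product dot and its
   origin, so that the same definitions serve random vectors (V = 'rV[R]_d) and
   real random variables (V = R). *)
Section infinitely_divisible.
Context {R : realType} {dV : measure_display} {V : measurableType dV}.
Context (dot : V -> V -> R) (origin : V).
Local Open Scope complex_scope.

Let norm (u : V) : R := Num.sqrt (dot u u).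

Definition levy_measure_on (nu : {measure set V -> \bar R}) : Prop :=
  nu [set origin] = 0%E /\
  (\int[nu]_u (Num.min 1 (norm u ^+ 2))%:E < +oo)%E.

Definition levy_exponent (gamma : V) (nu : {measure set V -> \bar R})
    (t : V) : R[i] :=
  'i%C * (dot t gamma)%:C +
  cintegral nu (fun u => cexp ('i%C * (dot t u)%:C) - 1
                         - 'i%C * (dot t u * (norm u <= 1)%R%:R)%:C).

Definition char_fun {dT} {T : measurableType dT} (P : probability T R)
    (X : T -> V) (t : V) : R[i] :=
  cintegral P (fun w => cexp ('i%C * (dot t (X w))%:C)).

Definition ID_on {dT} {T : measurableType dT} (P : probability T R)
    (X : T -> V) (gamma : V) (nu : {measure set V -> \bar R}) : Prop :=
  levy_measure_on nu /\
  forall t, char_fun P X t = cexp (levy_exponent gamma nu t).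

End infinitely_divisible.

Section random_vectors.
Context {R : realType} {dT : measure_display} {T : measurableType dT}.
Context (P : probability T R) {d : nat}.

(* X ~ ID(gamma, 0, nu) in R^d, without the requirement that nu be nonzero. *)
Definition ID_vector (X : T -> 'rV[R]_d) (gamma : 'rV[R]_d)
    (nu : {measure set 'rV[R]_d -> \bar R}) : Prop :=
  ID_on edot 0 P X gamma nu.

(* The zero measure is allowed: some components may be deterministic. *)
Definition levy_measure_of (Y : T -> R)
    (nu : {measure set R -> \bar R}) : Prop :=
  exists gamma : R, ID_on (V := R) *%R 0 P Y gamma nu.

Definition mutually_independent (Y : 'I_d -> T -> R) : Prop :=
  forall A : 'I_d -> set R, (forall k, measurable (A k)) ->
  P (\bigcap_k (Y k @^-1` A k)) = (\prod_(k < d) P (Y k @^-1` A k))%E.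

End random_vectors.

Section tail_bound.
Context {R : realType}.

Definition exp_moment_sup {dT} {T : measurableType dT} (P : probability T R)
    {d : nat} (X : T -> 'rV[R]_d) (b : 'I_d -> R) : \bar R :=
  ereal_sup [set t%:E | t in [set t : R | 0 < t /\
    forall k, ('E_P[fun w => expR (t * b k * `|X w 0%R k|)] < +oo)%E]].

(* Rintegral is a real number (0 when the integral is infinite); this only
   matters for t >= M, since all these integrals are finite for t < M. *)
Definition hfun {d : nat} (a eps : R) (b : 'I_d -> R)
    (nu : 'I_d -> {measure set R -> \bar R}) (t : R) : R :=
  2 * a * Num.sqrt (\sum_(k < d)
    (\int[nu k]_u (`|u| * (expR (t * b k * `|u|) - 1))) ^+ 2) +
  a / eps * \sum_(k < d)
    \int[nu k]_u (`|u| ^+ 2 * (expR (t * b k * `|u|) - 1)).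

(* h(M^-), for M possibly infinite. *)
Definition left_limit (h : R -> R) (M : \bar R) : \bar R :=
  lim ((h (fine t))%:E @[t --> within [set t | (t < M)%E] (nbhs M)]).

(* The inverse of the restriction of h to [0, M). *)
Definition inverse_on (h : R -> R) (M : \bar R) : R -> R :=
  'pinv_(fun=> 0) [set t | 0 <= t /\ (t%:E < M)%E] h.

End tail_bound.

(* Main.v *)
(* Clamp f to a bounded function and put g = a [|x| - eps]_+ and F = e^{t f}.
   The core is the covariance inequality E[g F] <= (E g + h(t)) E F.  To prove
   it, X is approximated in law by random walks whose steps are rare jumps along
   the coordinate axes, started so as to have the mean of X.  If A is the Markov operator of one step,
   A^m (g F) - A^m g A^m F telescopes into one-step covariances; a jump u along
   e_k changes F by at most (e^{t b_k |u|} - 1) F and g by at most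
   2 a |u| |x_k| / |x| + a u^2 / eps, and Cauchy-Schwarz over k yields the two
   terms of h.

   As f <= f(0) + a eps + g, this says that log E e^{t f} has slope at most
   mu + h(t), where mu is the centering of the theorem.  Summing over a grid
   t = i dl and applying Markov's inequality bounds the tail by
   exp(- sum_i dl (x - h(i dl))), and the sum converges to the integral of
   h^{-1} over [0, x] as dl tends to 0.

   Two analytic inputs are needed.  Convergence in law is obtained from that of
   trigonometric functions by approximating a Lipschitz function by Bernstein
   polynomials in sines of the coordinates, with uniform second moments
   controlling the tails.  That h is finite on [0, M) follows from a one big
   jump lower bound: walks that make a single large jump u along e_k and otherwise
   stay in a ball give the law of X_k at least a constant times the mass nu_k(du)
   near u, so e^{th |u|} is integrable for nu_k away from 0 if E e^{th |X_k|} is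
   finite. *)

Require Import Defs.
From HB Require Import structures.
From mathcomp Require Import all_boot all_order all_algebra.
From mathcomp Require Import complex ring lra.
From mathcomp Require Import all_classical all_reals all_analysis.
From mathcomp Require Import measurable_realfun.

Set Implicit Arguments.
Unset Strict Implicit.
Unset Printing Implicit Defensive.

Import Order.TTheory GRing.Theory Num.Theory.
Import numFieldTopology.Exports numFieldNormedType.Exports.

Local Open Scope classical_set_scope.
Local Open Scope ring_scope.

(** * Random walks *)

(** The walks replace a covariance formula along the semigroup of X: the estimates are made on
    finite sums, and limits are taken only of bounded Lipschitz functions. Two parameters are
    needed, n for the jump sizes and m for the number N of steps. Sums of |v| over the jumps v need
    not stay bounded in n, since small jumps need not be summable; they enter only divided by N, so
    m tends to infinity first, n being fixed. The bound by h, on the contrary, is uniform in n: each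
    jump size is the endpoint of its cell nearest to 0, hence sums of functions increasing in |u|
    are at most the integrals, with no error term. The drift compensates the jumps, so that only
    sin(su) - su, quadratic at 0, has to converge. The threshold eps in g is what makes a difference
    of norms tractable: |x'| - |x| is the quotient of |x'|^2 - |x|^2 by |x'| + |x|, and it matters
    only where this denominator exceeds eps. *)

Section random_walk.
Context {K : numFieldType} {V : zmodType} {J : finType}.
Implicit Types (p : J -> K) (v : J -> V) (phi psi : V -> K).

(** The weights need neither be real nor sum to 1: complex weights serve the characters, and
    sub-probabilities describe a walk restricted to some of its jumps. *)
Definition step p v psi : V -> K := fun x => \sum_j p j * psi (x + v j).

Definition walk p v m psi : V -> K := iter m (step p v) psi.
Arguments walk : simpl never.

Lemma walkS p v m psi : walk p v m.+1 psi = walk p v m (step p v psi).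
Proof. by rewrite /walk -iterSr. Qed.

Lemma walkSl p v m psi x :
  walk p v m.+1 psi x = \sum_j p j * walk p v m psi (x + v j).
Proof. by []. Qed.

Lemma eq_step p v phi psi : phi =1 psi -> step p v phi =1 step p v psi.
Proof. by move=> e x; apply: eq_bigr => j _; rewrite e. Qed.

Lemma eq_walk p v m phi psi : phi =1 psi -> walk p v m phi =1 walk p v m psi.
Proof. by move=> e; elim: m => //= m IH; apply: eq_step. Qed.

Lemma walkD p v m phi psi x :
  walk p v m (fun y => phi y + psi y) x = walk p v m phi x + walk p v m psi x.
Proof.
elim: m x => // m IH x; rewrite !walkSl -big_split; apply: eq_bigr => j _.
by rewrite IH mulrDr.
Qed.

Lemma walkZ p v m c psi x :
  walk p v m (fun y => c * psi y) x = c * walk p v m psi x.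
Proof.
elim: m x => // m IH x; rewrite !walkSl mulr_sumr; apply: eq_bigr => j _.
by rewrite IH mulrCA.
Qed.

Lemma walk_sum p v m (I : finType) (F : I -> V -> K) x :
  walk p v m (fun y => \sum_i F i y) x = \sum_i walk p v m (F i) x.
Proof.
elim: m x => // m IH x; rewrite !walkSl.
under eq_bigr do rewrite IH mulr_sumr.
by rewrite exchange_big.
Qed.

Lemma walk_shift p v m psi x y :
  walk p v m (fun z => psi (z + y)) x = walk p v m psi (x + y).
Proof.
elim: m x => // m IH x; rewrite !walkSl; apply: eq_bigr => j _.
by rewrite IH addrAC.
Qed.

Section monotone.
Context {p : J -> K} {v : J -> V}.
Hypothesis p_ge0 : forall j, 0 <= p j.

Lemma le_walk m phi psi x :
  (forall y, phi y <= psi y) -> walk p v m phi x <= walk p v m psi x.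
Proof.
move=> le; elim: m x => // m IH x; rewrite !walkSl.
by apply: ler_sum => j _; apply: ler_wpM2l.
Qed.

Lemma walk_ge0 m psi x : (forall y, 0 <= psi y) -> 0 <= walk p v m psi x.
Proof.
move=> psi0; elim: m x => // m IH x; rewrite walkSl.
by apply: sumr_ge0 => j _; apply: mulr_ge0.
Qed.

Hypothesis p_sum1 : \sum_j p j = 1.

Lemma walk_cst m c x : walk p v m (fun=> c) x = c.
Proof.
by elim: m x => // m IH x; rewrite walkSl; under eq_bigr do rewrite IH;
  rewrite -mulr_suml p_sum1 mul1r.
Qed.

Lemma walk_normB m phi psi x :
  `|walk p v m phi x - walk p v m psi x|
  <= walk p v m (fun y => `|phi y - psi y|) x.
Proof.
elim: m x => // m IH x; rewrite !walkSl -sumrB.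
apply: le_trans (ler_norm_sum _ _ _) _; apply: ler_sum => j _.
by rewrite -mulrBr normrM (ger0_norm (p_ge0 _)) ler_wpM2l.
Qed.

End monotone.

(** Squared mean plus variance of [l] after [m] independent steps. It yields the variance of the
    Bernstein walk and the second moments of the walks approximating [X]. *)
Lemma walk_sqr_affine p v (l : V -> K) s m x :
    {morph l : a b / a + b} -> \sum_j p j = 1 ->
  walk p v m (fun y => (l y + s) ^+ 2) x =
    (l x + s + m%:R * (\sum_j p j * l (v j))) ^+ 2 +
    m%:R * (\sum_j p j * l (v j) ^+ 2 - (\sum_j p j * l (v j)) ^+ 2).
Proof.
move=> lD p1; elim: m x => [|m IH] x; first by rewrite /walk /= !mul0r !addr0.
rewrite walkSl; set e := \sum_j p j * l (v j).
under eq_bigr => j _.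
  rewrite IH -/e lD (_ : p j * _ =
    ((l x + s + m%:R * e) ^+ 2 + m%:R * (\sum_j0 p j0 * l (v j0) ^+ 2 - e ^+ 2)) * p j
    + 2 * (l x + s + m%:R * e) * (p j * l (v j)) + p j * l (v j) ^+ 2); last by ring.
over.
rewrite !big_split /= -!mulr_sumr p1 -/e -natr1; ring.
Qed.

(** A character is an eigenfunction of the step operator; the eigenvalue is its mean over one
    jump. *)
Lemma walk_character p v (chi : V -> K) m x :
    (forall a b, chi (a + b) = chi a * chi b) ->
  walk p v m chi x = (\sum_j p j * chi (v j)) ^+ m * chi x.
Proof.
move=> chiD; elim: m x => [|m IH] x; first by rewrite expr0 mul1r.
rewrite walkSl; under eq_bigr do rewrite IH chiD.
rewrite exprS !mulr_suml; apply: eq_bigr => j _; ring.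
Qed.

(* Expanding the product of m steps and keeping the terms with at most one
   factor taken from p1. *)
Lemma walk_one_jump (p0 p1 : J -> K) v m psi x :
    (forall j, 0 <= p0 j) -> (forall j, 0 <= p1 j) -> (forall y, 0 <= psi y) ->
  m.+1%:R * (\sum_j p1 j * walk p0 v m psi (x + v j)) <=
  walk (fun j => p0 j + p1 j) v m.+1 psi x.
Proof.
move=> p00 p10 psi0.
have p0' j : 0 <= p0 j + p1 j by rewrite addr_ge0.
suff : walk p0 v m.+1 psi x + m.+1%:R * (\sum_j p1 j * walk p0 v m psi (x + v j))
       <= walk (fun j => p0 j + p1 j) v m.+1 psi x.
  by apply: le_trans; rewrite lerDr walk_ge0.
have ge_walk0 n z : walk p0 v n psi z <= walk (fun j => p0 j + p1 j) v n psi z.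
  elim: n z => // n IH z; rewrite !walkSl; apply: ler_sum => j _.
  apply: (@le_trans _ _ ((p0 j + p1 j) * walk p0 v n psi (z + v j))).
    by rewrite ler_wpM2r ?walk_ge0 // lerDl.
  by rewrite ler_wpM2l.
elim: m x => [|m IH] x.
  rewrite mul1r /walk /= /step -big_split /=.
  by apply: ler_sum => j _; rewrite mulrDl.
rewrite [leRHS]walkSl; under [leRHS]eq_bigr do rewrite mulrDl.
rewrite big_split /=.
apply: le_trans _ (lerD (ler_sum _ (fun j _ => ler_wpM2l (p00 j) (IH _)))
  (ler_sum _ (fun j _ => ler_wpM2l (p10 j) (ge_walk0 _ _)))).
under [X in _ <= X + _]eq_bigr do rewrite mulrDr.
rewrite big_split /= -!addrA lerD2l.
under [X in _ <= X + _]eq_bigr do rewrite mulrCA.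
rewrite -mulr_sumr.
have -> : \sum_i p0 i * (\sum_j p1 j * walk p0 v m psi (x + v i + v j)) =
          \sum_j p1 j * walk p0 v m.+1 psi (x + v j).
  under eq_bigr do rewrite mulr_sumr.
  rewrite exchange_big; apply: eq_bigr => j _; rewrite walkSl mulr_sumr.
  by apply: eq_bigr => i _; rewrite mulrCA addrAC.
by rewrite -[m.+2%:R]natr1 mulrDl mul1r.
Qed.

(** Union bound: the paths lost by forbidding the jumps of [p1] have total probability at most [m]
    times the mass of [p1], and [psi] is at most 1 on them. *)
Lemma walk_kill (p0 p1 : J -> K) v m psi x :
    (forall j, 0 <= p0 j) -> (forall j, 0 <= p1 j) ->
    \sum_j (p0 j + p1 j) = 1 -> (forall y, 0 <= psi y <= 1) ->
  walk (fun j => p0 j + p1 j) v m psi x - m%:R * (\sum_j p1 j)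
  <= walk p0 v m psi x.
Proof.
move=> p00 p10 s1 psi01; elim: m x => [|m IH] x; first by rewrite mul0r subr0.
rewrite !walkSl; under eq_bigr do rewrite mulrDl.
have p0' j : 0 <= p0 j + p1 j by rewrite addr_ge0.
have le1 z : walk (fun j => p0 j + p1 j) v m psi z <= 1.
  rewrite -[leRHS](walk_cst (v := v) s1 m 1 z).
  by apply: le_walk => // y; case/andP: (psi01 y).
have s0 : \sum_j p0 j <= 1.
  by rewrite -s1 big_split lerDl sumr_ge0.
rewrite big_split /= lerBlDr.
apply: (@le_trans _ _ (\sum_j p0 j * (walk p0 v m psi (x + v j) + m%:R * \sum_j p1 j)
  + \sum_j p1 j * 1)).
  apply: lerD; apply: ler_sum => j _; apply: ler_wpM2l => //.
  by rewrite -lerBlDr.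
under [X in X + _ <= _]eq_bigr do rewrite mulrDr.
rewrite big_split /= -addrA lerD2l -!mulr_suml mulr1 -natr1 mulrDl mul1r.
by rewrite lerD2r ler_piMl // mulr_ge0 ?sumr_ge0.
Qed.

End random_walk.

(** * Covariance of two functions along a walk *)

Section covariance.
Context {K : realFieldType} {V : zmodType} {J : finType}.
Variables (p : J -> K) (v : J -> V) (c : J -> K).
Hypothesis p_ge0 : forall j, 0 <= p j.
Hypothesis p_sum1 : \sum_j p j = 1.
Hypothesis c_ge0 : forall j, 0 <= c j.

(** The step operator commutes with translations and has nonnegative weights, so a bound on
    increments relative to [F] survives averaging. *)
Lemma step_diff_le (F : V -> K) : (forall x, 0 <= F x) ->
    (forall x j, `|F (x + v j) - F x| <= c j * F x) ->
  forall x j, `|step p v F (x + v j) - step p v F x| <= c j * step p v F x.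
Proof.
move=> F0 DF x j; rewrite /step -sumrB mulr_sumr.
apply: le_trans (ler_norm_sum _ _ _) _; apply: ler_sum => i _.
rewrite -mulrBr normrM ger0_norm // mulrCA ler_wpM2l //.
by rewrite (addrAC x); apply: DF.
Qed.

(** Increments of [A g] are averages, over a first jump, of increments of [g] at shifted points, and
    the weights sum to 1, so the uniform bound [k1] is kept. *)
Lemma step_diff_sum_le (g : V -> K) k1 :
    (forall x, \sum_j p j * (`|g (x + v j) - g x| * c j) <= k1) ->
  forall x, \sum_j p j * (`|step p v g (x + v j) - step p v g x| * c j) <= k1.
Proof.
move=> Dg x.
apply: (@le_trans _ _ (\sum_i p i * (\sum_j p j *
    (`|g (x + v i + v j) - g (x + v i)| * c j)))); last first.
  apply: le_trans (ler_sum _ (fun i _ => ler_wpM2l (p_ge0 i) (Dg _))) _.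
  by rewrite -mulr_suml p_sum1 mul1r.
under [leRHS]eq_bigr do rewrite mulr_sumr.
rewrite exchange_big; apply: ler_sum => j _.
under [leRHS]eq_bigr do rewrite mulrCA.
rewrite -mulr_sumr ler_wpM2l //.
under [leRHS]eq_bigr do rewrite mulrA.
rewrite -mulr_suml ler_wpM2r // /step -sumrB.
apply: le_trans (ler_norm_sum _ _ _) _; apply: ler_sum => i _.
by rewrite -mulrBr normrM ger0_norm // (addrAC x).
Qed.

(** In increments, [A(gF) - Ag AF] is the mean of [dg dF] minus the product of the means of [dg] and
    [dF]. Both are controlled by [F x], the value before the jump, because the bound on [dF] is
    relative to [F]. *)
Lemma step_cov_le (g F : V -> K) k1 k2 :
    (forall x, 0 <= F x) ->
    (forall x j, `|F (x + v j) - F x| <= c j * F x) ->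
    (forall x, \sum_j p j * (`|g (x + v j) - g x| * c j) <= k1) ->
    (forall x, (\sum_j p j * `|g (x + v j) - g x|) * (\sum_j p j * c j) <= k2) ->
  forall x, step p v (fun y => g y * F y) x <=
            step p v g x * step p v F x + (k1 + k2) * F x.
Proof.
move=> F0 DF Dg1 Dg2 x.
set eg := \sum_j p j * (g (x + v j) - g x).
set eF := \sum_j p j * (F (x + v j) - F x).
have sg : step p v g x = g x + eg.
  rewrite /eg; under [X in _ + X]eq_bigr do rewrite mulrBr.
  by rewrite sumrB -mulr_suml p_sum1 mul1r addrC subrK.
have sF : step p v F x = F x + eF.
  rewrite /eF; under [X in _ + X]eq_bigr do rewrite mulrBr.
  by rewrite sumrB -mulr_suml p_sum1 mul1r addrC subrK.
have sgF : step p v (fun y => g y * F y) x =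
    g x * F x + g x * eF + eg * F x +
    \sum_j p j * ((g (x + v j) - g x) * (F (x + v j) - F x)).
  rewrite -{1}[g x * F x]mul1r -p_sum1 !mulr_suml mulr_sumr -!big_split /step /=.
  by apply: eq_bigr => j _; ring.
rewrite sg sF sgF (_ : (g x + eg) * (F x + eF) = g x * F x + g x * eF + eg * F x + eg * eF);
  last by ring.
rewrite -!addrA !lerD2l mulrDl.
have h1 : \sum_j p j * ((g (x + v j) - g x) * (F (x + v j) - F x)) <= k1 * F x.
  apply: le_trans _ (ler_wpM2r (F0 x) (Dg1 x)); rewrite mulr_suml.
  apply: ler_sum => j _; rewrite -mulrA ler_wpM2l // -mulrA.
  apply: le_trans (ler_norm _) _; rewrite normrM ler_wpM2l //.
have h2 : - (eg * eF) <= k2 * F x.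
  apply: le_trans _ (ler_wpM2r (F0 x) (Dg2 x)); rewrite -mulrA.
  apply: le_trans (ler_norm _) _; rewrite normrN normrM.
  apply: ler_pM => //.
    apply: le_trans (ler_norm_sum _ _ _) _; apply: ler_sum => j _.
    by rewrite normrM ger0_norm.
  apply: le_trans (ler_norm_sum _ _ _) _; rewrite mulr_suml; apply: ler_sum => j _.
  by rewrite normrM ger0_norm // -mulrA ler_wpM2l.
lra.
Qed.

(* No coupling is needed: the discrete interpolation A^l (A^(m-l) g A^(m-l) F)
   telescopes, and the hypotheses on g and F are preserved by A. *)
Lemma walk_cov_le m (g F : V -> K) k1 b e :
    0 <= b -> 0 <= k1 -> \sum_j p j * c j <= e ->
    (forall x, 0 <= F x) ->
    (forall x j, `|F (x + v j) - F x| <= c j * F x) ->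
    (forall x, \sum_j p j * (`|g (x + v j) - g x| * c j) <= k1) ->
    (forall x, \sum_j p j * `|g (x + v j) - g x| <= b) ->
  forall x, walk p v m.+1 (fun y => g y * F y) x <=
    walk p v m.+1 g x * walk p v m.+1 F x
    + m.+1%:R * (k1 + b * e) * walk p v m F x.
Proof.
move=> b0 k10 pc; elim: m g F => [|m IH] g F F0 DF Dg1 Dg2 x.
  rewrite mul1r; apply: step_cov_le => // y; apply: ler_pM => //.
  - by apply: sumr_ge0 => j _; apply: mulr_ge0.
  - by apply: sumr_ge0 => j _; apply: mulr_ge0.
have cov y := step_cov_le (k2 := b * e) F0 DF Dg1 _ y.
rewrite walkS; apply: (@le_trans _ _ (walk p v m.+1
    (fun y => step p v g y * step p v F y + (k1 + b * e) * F y) x)).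
  apply: le_walk => // y; apply: cov => z; apply: ler_pM => //.
  - by apply: sumr_ge0 => j _; apply: mulr_ge0.
  - by apply: sumr_ge0 => j _; apply: mulr_ge0.
rewrite walkD walkZ.
have {}IH := IH (step p v g) (step p v F) _ (step_diff_le F0 DF)
  (step_diff_sum_le Dg1) _ x.
(* The induction hypothesis leaves [A^m (A F)] in its error, the same function as in the new error
   term, so the coefficients add up to [m.+2]. *)
apply: le_trans (lerD (IH _ _) (lexx _)) _.
- by move=> y; apply: sumr_ge0 => j _; apply: mulr_ge0.
- move=> y; apply: (@le_trans _ _ (\sum_i p i * (\sum_j p j *
    `|g (y + v i + v j) - g (y + v i)|))); last first.
    apply: le_trans (ler_sum _ (fun i _ => ler_wpM2l (p_ge0 i) (Dg2 _))) _.
    by rewrite -mulr_suml p_sum1 mul1r.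
  under [leRHS]eq_bigr do rewrite mulr_sumr.
  rewrite exchange_big; apply: ler_sum => j _.
  under [leRHS]eq_bigr do rewrite mulrCA.
  rewrite -mulr_sumr ler_wpM2l // /step -sumrB.
  apply: le_trans (ler_norm_sum _ _ _) _; apply: ler_sum => i _.
  by rewrite -mulrBr normrM ger0_norm // (addrAC y).
rewrite -!walkS -[m.+2%:R]natr1; lra.
Qed.

End covariance.

(** * Elementary inequalities *)

Section elementary.
Context {R : realType}.
Implicit Types x y : R.

Lemma MVT_bound (f df : R -> R) C : (forall x, is_derive x 1 f (df x)) ->
  forall x y, (forall z, x <= z <= y -> `|df z| <= C) -> x <= y ->
  `|f y - f x| <= C * `|y - x|.
Proof.
move=> Df x y dfC xy.
have [|c] := @MVT_segment R f df x y xy _ _.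

  apply: continuous_subspaceT => z.
  by apply: differentiable_continuous; apply/derivable1_diffP; case: (Df z).
rewrite in_itv /= => cxy ->; rewrite normrM ler_wpM2r //; exact: dfC.
Qed.

Lemma cos_lip x y : `|cos x - cos y| <= `|x - y|.
Proof.
wlog yx : x y / y <= x.
  by move=> H; case: (leP y x) => [/H//|/ltW/H]; rewrite distrC (distrC y).
rewrite -[leRHS]mul1r; apply: (MVT_bound (df := fun z => - sin z)) => // z _.
by rewrite normrN ler_norml sin_geN1 sin_le1.
Qed.

Lemma sin_lip x y : `|sin x - sin y| <= `|x - y|.
Proof.
wlog yx : x y / y <= x.
  by move=> H; case: (leP y x) => [/H//|/ltW/H]; rewrite distrC (distrC y).
rewrite -[leRHS]mul1r; apply: (MVT_bound (df := fun z => cos z)) => // z _.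
by rewrite ler_norml cos_geN1 cos_le1.
Qed.

Lemma normr_cosB1_le x : `|cos x - 1| <= `|x|.
Proof. by have := cos_lip x 0; rewrite cos0 subr0. Qed.

Lemma normr_sin_le x : `|sin x| <= `|x|.
Proof. by have := sin_lip x 0; rewrite sin0 !subr0. Qed.

Lemma onem_cos x : 1 - cos x = 2 * sin (x / 2) ^+ 2.
Proof.
rewrite {1}(_ : x = x / 2 + x / 2); last by rewrite -splitr.
by rewrite cosD -{1}(cos2Dsin2 (x / 2)); ring.
Qed.

Lemma onem_cos_le x : 1 - cos x <= x ^+ 2 / 2.
Proof.
rewrite onem_cos; have := normr_sin_le (x / 2).
rewrite -ler_sqr ?nnegrE // !real_normK ?num_real // expr_div_n.
by lra.
Qed.

(** The quadratic form, weaker than the cubic one near 0, is the one that second moments control at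
    infinity. *)
Lemma sinB_le x : `|sin x - x| <= x ^+ 2.
Proof.
have D (z : R) : is_derive z 1 (fun y => sin y - y) (cos z - 1).
  by apply: is_deriveB.
wlog x0 : x / 0 <= x.
  move=> H; case: (leP 0 x) => [/H//|x0].
  have := H (- x); rewrite sinN sqrrN (_ : - sin x - - x = - (sin x - x)).
    by rewrite normrN; apply; rewrite oppr_ge0 ltW.
  by ring.
have := @MVT_bound _ _ x D 0 x.
rewrite sin0 !subr0 (ger0_norm x0) -expr2; apply => // z /andP[z0 zx].
by rewrite (le_trans (normr_cosB1_le z)) // ger0_norm.
Qed.

(** [1 - cos x = 2 sin^2(x/2)], and [sin(x/2) >= x/2 - x^2/4 >= x/4] on [0, 1]. The constant 8
    reappears in the bound on the second moment of the Levy measure. *)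
Lemma onem_cos_ge x : `|x| <= 1 -> x ^+ 2 / 8 <= 1 - cos x.
Proof.
wlog x0 : x / 0 <= x.
  move=> H; case: (leP 0 x) => [/H//|x0].
  by have := H (- x); rewrite sqrrN cosN normrN; apply; rewrite oppr_ge0 ltW.
rewrite (ger0_norm x0) onem_cos => x1.
have := sinB_le (x / 2); rewrite ler_norml => /andP[+ _].
have -> : (x / 2) ^+ 2 = x ^+ 2 / 4 by rewrite expr_div_n; lra.
move=> h.
have h4 : x / 4 <= sin (x / 2) by nra.
have : (x / 4) ^+ 2 <= sin (x / 2) ^+ 2 by rewrite ler_sqr ?nnegrE; lra.
by rewrite expr_div_n; lra.
Qed.

Lemma expRB_le x y : expR x - expR y <= expR x * (x - y).
Proof.
rewrite -[leLHS]opprB lerNl -mulrN opprB.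
have := expR_ge1Dx (y - x); rewrite -(ler_pM2l (expR_gt0 x)) -expRD [x + _]addrC subrK.
by rewrite mulrDr; lra.
Qed.

Lemma normr_expRB1_le x : `|expR x - 1| <= expR `|x| - 1.
Proof.
case: (leP 0 x) => x0.
  by rewrite !ger0_norm // subr_ge0 -expR0 ler_expR.
rewrite (ltr0_norm x0) ler0_norm; last by rewrite subr_le0 -expR0 ler_expR ltW.
have := expR_ge1Dx x; have := expR_ge1Dx (- x); lra.
Qed.

Lemma expRB1x_le x : x <= 0 -> 0 <= expR x - 1 - x <= x ^+ 2.
Proof.
move=> x0; have e1 := expR_ge1Dx x; apply/andP; split; first by lra.
have := expR_ge1Dx (- x); rewrite -(ler_pM2l (expR_gt0 x)) -expRD subrr expR0.
have := expR_gt0 x => e0 h.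
have : 0 < expR x * (1 - x) by rewrite mulr_gt0 //; lra.
nra.
Qed.

End elementary.

(** * Weak convergence from trigonometric functions *)

Section lipschitz.
Context {R : realType} {d : nat}.
Implicit Types (x y : 'rV[R]_d) (phi psi : 'rV[R]_d -> R).

Definition l1norm x : R := \sum_k `|x 0 k|.
Definition sqnorm x : R := \sum_k x 0 k ^+ 2.

(** The l1 distance splits over coordinates, so that one coordinate can be changed at a time; it
    dominates the Euclidean distance by [enorm_le_l1norm]. *)
Definition l1_lipschitz (C : R) psi :=
  forall x y, `|psi x - psi y| <= C * l1norm (x - y).

Lemma l1norm_ge0 x : 0 <= l1norm x.
Proof. exact: sumr_ge0. Qed.

Lemma open_preimage_lipschitz C psi (B : set R) :
  l1_lipschitz C psi -> open B -> open (psi @^-1` B).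
Proof.
move=> psiL oB; rewrite openE => x /= psix.
have /nbhs_ballP[e /= e0 eB] : nbhs (psi x) B by exact: open_nbhs_nbhs.
have C0 : 0 < `|C| * d%:R + 1 by rewrite ltr_wpDl // mulr_ge0.
apply/nbhs_ballP; exists (e / (`|C| * d%:R + 1)); first by rewrite /= divr_gt0.
move=> y /= [] _ xy; apply: eB; rewrite /ball /=.
apply: le_lt_trans (psiL _ _) _.
apply: (@le_lt_trans _ _ (`|C| * (d%:R * (e / (`|C| * d%:R + 1))))).
  apply: (@le_trans _ _ (`|C| * l1norm (x - y))).
    by rewrite ler_wpM2r ?l1norm_ge0 ?ler_norm.
  rewrite ler_wpM2l // /l1norm.
  move: xy; set dl := e / _ => xy.
  have -> : d%:R * dl = \sum_(k < d) dl by rewrite sumr_const card_ord mulr_natl.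
  by apply: ler_sum => k _; rewrite !mxE; have := xy 0 k; rewrite /ball /= => /ltW.
by rewrite !mulrA ltr_pdivrMr // mulrC ltr_pM2l //; lra.
Qed.

Lemma measurable_lipschitz C psi : l1_lipschitz C psi ->
  measurable_fun setT psi.
Proof.
move=> psiL.
apply: (measurability _ (RGenOpens.measurableE R)).
move=> _ [_ [a [b ->] <-]]; rewrite setTI; apply: sub_sigma_algebra.
by apply: (open_preimage_lipschitz psiL); exact: interval_open.
Qed.

End lipschitz.

Section mean_functionals.
Context {R : realType} {d : nat}.
Local Notation V := 'rV[R]_d.
Implicit Types (x y : V) (phi psi : V -> R).

Definition bounded_mfun psi :=
  measurable_fun setT psi /\ exists K, forall x, `|psi x| <= K.

Lemma bounded_mfun_cst c : bounded_mfun (fun=> c).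
Proof. by split => //; exists `|c|. Qed.

Lemma bounded_mfunD phi psi : bounded_mfun phi -> bounded_mfun psi ->
  bounded_mfun (fun x => phi x + psi x).
Proof.
move=> [mf [K hK]] [mg [L hL]]; split; first exact: measurable_funD.
by exists (K + L) => x; apply: le_trans (ler_normD _ _) _; apply: lerD.
Qed.

Lemma bounded_mfunM phi psi : bounded_mfun phi -> bounded_mfun psi ->
  bounded_mfun (fun x => phi x * psi x).
Proof.
move=> [mf [K hK]] [mg [L hL]]; split; first exact: measurable_funM.
by exists (K * L) => x; rewrite normrM; apply: ler_pM.
Qed.

Lemma bounded_mfunZ c psi : bounded_mfun psi -> bounded_mfun (fun x => c * psi x).
Proof. by apply: bounded_mfunM; exact: bounded_mfun_cst. Qed.

Lemma bounded_mfunN psi : bounded_mfun psi -> bounded_mfun (fun x => - psi x).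
Proof.
move=> h; rewrite (_ : (fun _ => _) = (fun x => -1 * psi x)).
  exact: bounded_mfunZ.
by apply/funext => x; rewrite mulN1r.
Qed.

(** The common interface of the walk functionals and of the law of [X]. It is limited to bounded
    measurable functions since linearity and monotonicity of the integral rest on integrability. *)
Definition mean (E : (V -> R) -> R) : Prop :=
  [/\ forall phi psi, bounded_mfun phi -> bounded_mfun psi ->
         E (fun x => phi x + psi x) = E phi + E psi,
      forall c psi, bounded_mfun psi -> E (fun x => c * psi x) = c * E psi,
      forall phi psi, bounded_mfun phi -> bounded_mfun psi ->
         (forall x, phi x <= psi x) -> E phi <= E psi &
      E (fun=> 1) = 1].

Lemma meanB E phi psi : mean E -> bounded_mfun phi -> bounded_mfun psi ->
  E (fun x => phi x - psi x) = E phi - E psi.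
Proof.
move=> [ED EZ _ _] bphi bpsi.
rewrite (_ : (fun _ => _) = (fun x => phi x + -1 * psi x)).
  by rewrite ED ?EZ //; [rewrite mulN1r|exact: bounded_mfunZ].
by apply/funext => x; rewrite mulN1r.
Qed.

Lemma mean_cst E c : mean E -> E (fun=> c) = c.
Proof.
move=> [_ EZ _ E1]; rewrite (_ : (fun=> c) = (fun=> c * 1)).
  by rewrite EZ ?E1 ?mulr1 //; exact: bounded_mfun_cst.
by rewrite mulr1.
Qed.

Lemma mean_dist E phi psi e : mean E -> bounded_mfun phi -> bounded_mfun psi ->
  (forall x, `|phi x - psi x| <= e) -> `|E phi - E psi| <= e.
Proof.
move=> mE bphi bpsi le_e; rewrite -meanB //.
have [_ _ Ele _] := mE.
have bB : bounded_mfun (fun x => phi x - psi x).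
  by apply: bounded_mfunD => //; exact: bounded_mfunN.
rewrite ler_norml; apply/andP; split.
  rewrite -(mean_cst (- e) mE); apply: Ele => //; first exact: bounded_mfun_cst.
  by move=> x; have := le_e x; rewrite ler_norml => /andP[].
rewrite -(mean_cst e mE); apply: Ele => //; first exact: bounded_mfun_cst.
by move=> x; have := le_e x; rewrite ler_norml => /andP[].
Qed.

(** Expresses a second moment at most [C] without applying [E] to the unbounded function [sqnorm],
    about which [mean] says nothing. *)
Definition sq_bounded (C : R) (E : (V -> R) -> R) : Prop :=
  forall phi psi c, bounded_mfun phi -> bounded_mfun psi -> 0 <= c ->
  (forall x, `|phi x - psi x| <= c * sqnorm x) -> `|E phi - E psi| <= c * C.

End mean_functionals.

Lemma sum_bool (M : nmodType) (F : bool -> M) : \sum_b F b = F true + F false.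
Proof. by rewrite big_bool. Qed.

(** * Bernstein polynomials as walks of coin flips *)

Section bernstein.
Context {R : realType}.

Definition coin (y : R) (b : bool) : R := (if b then 1 + y else 1 - y) / 2.
Definition hop (L : R) (N : nat) (b : bool) : R :=
  if b then L / N%:R else - (L / N%:R).

(* The N-th Bernstein polynomial of u on [-L, L] at the point L y. *)
Definition bernstein (L : R) N (u : R -> R) (y : R) : R :=
  walk (coin y) (hop L N) N u 0.

Lemma coin_ge0 y b : `|y| <= 1 -> 0 <= coin y b.
Proof.
by rewrite ler_norml => /andP[? ?]; rewrite /coin divr_ge0 //; case: b; lra.
Qed.

Lemma coin_sum y : \sum_b coin y b = 1.
Proof. by rewrite sum_bool /coin /=; lra. Qed.

(** The walk ends at [L y] in mean, with variance [L^2 (1 - y^2) / N.+1]. As [u] is only Lipschitz,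
    [|z - L y|] is bounded by [(z - L y)^2 / e + e] to bring in that variance. *)
Lemma bernstein_dist (L : R) N (C : R) (u : R -> R) (y e : R) : `|y| <= 1 -> 0 <= C -> 0 < e ->
    (forall z z', `|u z - u z'| <= C * `|z - z'|) ->
  `|bernstein L N.+1 u y - u (L * y)| <= C * (L ^+ 2 / (N.+1%:R * e) + e).
Proof.
move=> y1 C0 e0 uL; rewrite /bernstein.
have p0 b := coin_ge0 b y1.
rewrite -{1}(walk_cst (v := hop L N.+1) (coin_sum y) N.+1 (u (L * y)) 0).
apply: le_trans; first exact: walk_normB.
apply: (@le_trans _ _ (walk (coin y) (hop L N.+1) N.+1
   (fun z => C * (e^-1 * (z - L * y) ^+ 2 + e)) 0)).
  apply: le_walk => // z; apply: le_trans (uL _ _) _; rewrite ler_wpM2l //.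
  have -> : (z - L * y) ^+ 2 = `|z - L * y| ^+ 2 by rewrite real_normK ?num_real.
  set w := `| _ |; have w0 : 0 <= w by exact: normr_ge0.
  rewrite mulrC -(ler_pM2r e0) mulrDl divfK ?gt_eqF //.
  by have := sqr_ge0 (w - e); nra.
rewrite walkZ ler_wpM2l // walkD walk_cst ?coin_sum // walkZ lerD2r.
rewrite (walk_sqr_affine _ _ (l := id)) ?coin_sum // !sum_bool /coin /hop.
set n : R := N.+1%:R; have n0 : n != 0 by rewrite /n.
rewrite [X in e^-1 * X](_ : _ = L ^+ 2 / n * (1 - y ^+ 2)); last by field.
rewrite invfM [leRHS]mulrA [leRHS]mulrC ler_pM2l ?invr_gt0 //.
rewrite ler_piMr ?divr_ge0 ?sqr_ge0 //.
by rewrite lerBlDr lerDl sqr_ge0.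
Qed.

End bernstein.

Section convergence.
Context {R : realType} {d : nat}.
Local Notation V := 'rV[R]_d.
Implicit Types (x y s : V) (phi psi : V -> R).
Context (Phi : nat -> nat -> (V -> R) -> R) (Ex : (V -> R) -> R) (C : R).

(** An iterated limit: the threshold for [m] depends on [n], so the walk may be refined until single
    steps are negligible for a fixed set of jump sizes. *)
Definition converges psi : Prop := forall e : R, 0 < e ->
  \forall n \near \oo, \forall m \near \oo, `|Phi n m psi - Ex psi| <= e.

Definition trig s (al : R) x := cos (edot s x + al).

Hypothesis Phi_mean : forall n m, mean (Phi n m).
Hypothesis Ex_mean : mean Ex.
Hypothesis Phi_sq : forall n m, sq_bounded C (Phi n m).
Hypothesis Ex_sq : sq_bounded C Ex.
Hypothesis C_ge0 : 0 <= C.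
Hypothesis trig_cvg : forall s al, converges (trig s al).

Lemma convergesD phi psi : bounded_mfun phi -> bounded_mfun psi ->
  converges phi -> converges psi -> converges (fun x => phi x + psi x).
Proof.
move=> bphi bpsi cphi cpsi e e0; have e20 : 0 < e / 2 by rewrite divr_gt0.
apply: filterS2 (cphi _ e20) (cpsi _ e20) => n; apply: filterS2 => m.
have [PD _ _ _] := Phi_mean n m; have [ED _ _ _] := Ex_mean.
rewrite PD // ED // => h1 h2.
rewrite opprD addrACA (splitr e); apply: le_trans (ler_normD _ _) _.
exact: lerD.
Qed.

Lemma convergesZ c psi : bounded_mfun psi ->
  converges psi -> converges (fun x => c * psi x).
Proof.
move=> bpsi cpsi e e0.
have e20 : 0 < e / (`|c| + 1) by rewrite divr_gt0 // ltr_wpDl.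
apply: filterS (cpsi _ e20) => n; apply: filterS => m.
have [_ PZ _ _] := Phi_mean n m; have [_ EZ _ _] := Ex_mean.
rewrite PZ // EZ // -mulrBr normrM ler_pdivlMr ?ltr_wpDl // mulrC.
by apply: le_trans; rewrite ler_wpM2r // lerDl.
Qed.

Lemma converges_approx psi : (forall e : R, 0 < e -> exists phi,
    [/\ converges phi, forall n m, `|Phi n m psi - Phi n m phi| <= e &
        `|Ex psi - Ex phi| <= e]) -> converges psi.
Proof.
move=> H e e0; have e30 : 0 < e / 3 by rewrite divr_gt0.
have [phi [cphi Pphi Ephi]] := H _ e30.
apply: filterS (cphi _ e30) => n; apply: filterS => m.
have := Pphi n m; move: Ephi; rewrite !ler_norml => /andP[? ?] /andP[? ?] /andP[? ?].
by apply/andP; split; lra.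
Qed.

(** Convergence of [psi] alone is not inherited by products. Asking for it after multiplication by
    any phase-shifted cosine gives a class closed under trigonometric factors, hence under
    polynomials in sines. *)
Definition trig_stable psi := bounded_mfun psi /\
  forall s al, converges (fun x => psi x * trig s al x).

Lemma measurable_coord k : measurable_fun setT (fun x : V => x 0 k).
Proof.
apply: (@measurable_lipschitz _ _ 1) => x y; rewrite mul1r /l1norm.
by rewrite (bigD1 k) //= !mxE lerDl sumr_ge0.
Qed.

Lemma bounded_trig s al : bounded_mfun (trig s al).
Proof.
split; last by exists 1 => x; rewrite ler_norml cos_geN1 cos_le1.
apply: (measurableT_comp (f := @cos R)).
  by apply: continuous_measurable_fun; exact: continuous_cos.
apply: measurable_funD => //; apply: measurable_sum => k.
by apply: measurable_funM => //; exact: measurable_coord.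
Qed.

Lemma bounded_mul_trig psi s al : bounded_mfun psi ->
  bounded_mfun (fun x => psi x * trig s al x).
Proof. by move=> bpsi; apply: bounded_mfunM => //; exact: bounded_trig. Qed.

Lemma edot0l x : edot 0 x = 0.
Proof. by rewrite /edot big1 // => k _; rewrite mxE mul0r. Qed.

Lemma trig00 x : trig 0 0 x = 1.
Proof. by rewrite /trig edot0l addr0 cos0. Qed.

Lemma trig_stable_converges psi : trig_stable psi -> converges psi.
Proof.
case=> _ /(_ 0 0); rewrite (_ : (fun _ => _) = psi) //.
by apply/funext => x; rewrite trig00 mulr1.
Qed.

Lemma trig_stable_cst c : trig_stable (fun=> c).
Proof.
split; first exact: bounded_mfun_cst.
by move=> s al; apply: convergesZ => //; exact: bounded_trig.
Qed.

Lemma trig_stableD phi psi : trig_stable phi -> trig_stable psi ->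
  trig_stable (fun x => phi x + psi x).
Proof.
move=> [bphi cphi] [bpsi cpsi]; split; first exact: bounded_mfunD.
move=> s al; rewrite (_ : (fun _ => _) =
  (fun x => phi x * trig s al x + psi x * trig s al x)).
  by apply: convergesD => //; exact: bounded_mul_trig.
by apply/funext => x; rewrite mulrDl.
Qed.

Lemma trig_stableZ c psi : trig_stable psi -> trig_stable (fun x => c * psi x).
Proof.
move=> [bpsi cpsi]; split; first exact: bounded_mfunZ.
move=> s al; rewrite (_ : (fun _ => _) = (fun x => c * (psi x * trig s al x))).
  by apply: convergesZ => //; exact: bounded_mul_trig.
by apply/funext => x; rewrite mulrA.
Qed.

Lemma edotDl s s' x : edot (s + s') x = edot s x + edot s' x.
Proof. by rewrite /edot -big_split; apply: eq_bigr => k _; rewrite mxE mulrDl. Qed.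

Lemma edotNl s x : edot (- s) x = - edot s x.
Proof. by rewrite /edot -sumrN; apply: eq_bigr => k _; rewrite mxE mulNr. Qed.

(** [2 cos u cos v = cos(u + v) + cos(u - v)]: two phases merge into one. *)
Lemma trig_stable_trig psi s al : trig_stable psi ->
  trig_stable (fun x => trig s al x * psi x).
Proof.
move=> [bpsi cpsi]; split; first by apply: bounded_mfunM => //; exact: bounded_trig.
move=> s' al'; rewrite (_ : (fun _ => _) =
  (fun x => 2^-1 * (psi x * trig (s + s') (al + al') x +
                    psi x * trig (s - s') (al - al') x))).
  apply: convergesZ; first by apply: bounded_mfunD; exact: bounded_mul_trig.
  by apply: convergesD => //; exact: bounded_mul_trig.
apply/funext => x; rewrite /trig !edotDl edotNl.
rewrite (_ : edot s x + edot s' x + (al + al') =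
             (edot s x + al) + (edot s' x + al')); last by ring.
rewrite (_ : edot s x - edot s' x + (al - al') =
             (edot s x + al) - (edot s' x + al')); last by ring.
by rewrite (cosD (edot s x + al)) (cosB (edot s x + al)); field.
Qed.

Lemma trig_stable_unif psi : bounded_mfun psi ->
    (forall e : R, 0 < e -> exists2 phi, trig_stable phi &
       forall x, `|psi x - phi x| <= e) ->
  trig_stable psi.
Proof.
move=> bpsi H; split => // s al; apply: converges_approx => e e0.
have [phi [bphi cphi] le_e] := H _ e0.
have le_e' x : `|psi x * trig s al x - phi x * trig s al x| <= e.
  rewrite -mulrBl normrM; apply: le_trans (le_e x); rewrite ler_piMr //.
  by rewrite ler_norml cos_geN1 cos_le1.
exists (fun x => phi x * trig s al x); split => //.
- by move=> n m; apply: mean_dist => //; exact: bounded_mul_trig.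
- by apply: mean_dist => //; exact: bounded_mul_trig.
Qed.

Lemma sin_trig (L : R) (k : 'I_d) x :
  sin (x 0 k / L) = trig (L^-1 *: delta_mx 0 k) (- (pi / 2)) x.
Proof.
rewrite /trig /edot (bigD1 k) //= !mxE !eqxx big1 => [|j jk]; last first.
  by rewrite !mxE (negbTE jk) andbF mulr0 mul0r.
by rewrite mulr1 addr0 mulrC cosB cos_pihalf sin_pihalf mulr0 add0r mulr1.
Qed.

(** Each of the [N] coin flips multiplies by [(1 + sin) / 2] or [(1 - sin) / 2], and a sine is a
    shifted cosine. *)
Lemma trig_stable_bernstein (L : R) (k : 'I_d) (N : nat) (u : R -> V -> R) :
    (forall z, trig_stable (u z)) ->
  trig_stable (fun x => bernstein L N (u ^~ x) (sin (x 0 k / L))).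
Proof.
move=> su; rewrite /bernstein.
suff H n z : trig_stable
    (fun x => walk (coin (sin (x 0 k / L))) (hop L N) n (u ^~ x) z) by exact: H.
elim: n z => [|n IH] z; first exact: su.
rewrite (_ : (fun _ => _) = (fun x =>
  (2^-1 * walk (coin (sin (x 0 k / L))) (hop L N) n (u ^~ x) (z + hop L N true) +
   2^-1 * walk (coin (sin (x 0 k / L))) (hop L N) n (u ^~ x) (z + hop L N false)) +
  (2^-1 * (trig (L^-1 *: delta_mx 0 k) (- (pi / 2)) x *
    walk (coin (sin (x 0 k / L))) (hop L N) n (u ^~ x) (z + hop L N true)) +
   (- 2^-1) * (trig (L^-1 *: delta_mx 0 k) (- (pi / 2)) x *
    walk (coin (sin (x 0 k / L))) (hop L N) n (u ^~ x) (z + hop L N false))))).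
  apply: trig_stableD; apply: trig_stableD; apply: trig_stableZ => //;
    exact: trig_stable_trig.
apply/funext => x; by rewrite walkSl sum_bool -sin_trig /coin; field.
Qed.

Lemma trig_stable_sin (L A : R) (k : 'I_d) (u : R -> V -> R) : 0 < L -> 0 <= A ->
    (forall z, trig_stable (u z)) ->
    (forall z z' x, `|u z x - u z' x| <= A * `|z - z'|) ->
    bounded_mfun (fun x => u (L * sin (x 0 k / L)) x) ->
  trig_stable (fun x => u (L * sin (x 0 k / L)) x).
Proof.
move=> L0 A0 su uL bu; apply: trig_stable_unif => // e e0.
have e'0 : 0 < e / (2 * (A + 1)) by rewrite divr_gt0 // mulr_gt0 // ltr_wpDl.
set e' := e / _ in e'0.
have e'E : 2 * (A + 1) * e' = e.
  by rewrite /e' mulrC divfK // gt_eqF // mulr_gt0 // ltr_wpDl.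
clearbody e'.
(* This makes [L^2 / (N.+1 e')] at most [e'], so the Bernstein error is at most [2 A e' <= e]. *)
pose N := Num.truncn (L ^+ 2 / (e' * e')).
exists (fun x => bernstein L N.+1 (u ^~ x) (sin (x 0 k / L))).
  exact: trig_stable_bernstein.
move=> x; rewrite distrC; apply: le_trans.
  apply: (@bernstein_dist R L N A (u ^~ x) _ e') => //.
  by rewrite ler_norml sin_geN1 sin_le1.
apply: (@le_trans _ _ (A * (e' + e'))).
  rewrite ler_wpM2l // lerD2r ler_pdivrMr ?mulr_gt0 // mulrCA.
  by rewrite -ler_pdivrMr ?mulr_gt0 // ltW // truncnS_gt.
lra.
Qed.

(** With [j = d] this is the map [x_k -> L sin(x_k / L)], a bounded substitute for the identity
    within [x_k^2 / L] of it. Smaller [j] freeze the remaining coordinates, for an induction on the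
    number of coordinates treated by Bernstein polynomials. *)
Definition sin_mix (j : nat) (L : R) y x : V :=
  \row_k (if (k < j)%N then L * sin (x 0 k / L) else y 0 k).

Lemma l1norm_sin_mix j L y x x' : 0 < L ->
  l1norm (sin_mix j L y x - sin_mix j L y x') <= l1norm (x - x').
Proof.
move=> L0; apply: ler_sum => k _; rewrite !mxE; case: ifP => _; last first.
  by rewrite subrr normr0.
rewrite -mulrBr normrM gtr0_norm //.
apply: le_trans (ler_wpM2l (ltW L0) (sin_lip _ _)) _.
by rewrite -mulrBl normrM normfV (gtr0_norm L0) mulrC divfK ?gt_eqF.
Qed.

Lemma trig_stable_sin_mix (A : R) (L : R) psi (j : nat) y : 0 < L -> 0 <= A ->
    (exists K : R, forall x, `|psi x| <= K) -> l1_lipschitz A psi -> (j <= d)%N ->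
  trig_stable (fun x => psi (sin_mix j L y x)).
Proof.
move=> L0 A0 bpsi psiL; elim: j y => [|j IH] y jd.
  rewrite (_ : (fun _ => _) = fun=> psi y); first exact: trig_stable_cst.
  apply/funext => x; congr psi; apply/rowP => k.
  by rewrite mxE ltn0.
have [K psiK] := bpsi.
have bmix i z : bounded_mfun (fun x => psi (sin_mix i L z x)).
  split; last by exists K.
  apply: (@measurable_lipschitz _ _ A) => x x'; apply: le_trans (psiL _ _) _.
  by rewrite ler_wpM2l // l1norm_sin_mix.
pose k0 := Ordinal jd.
pose yz z : V := \row_k (if k == k0 then z else y 0 k).
have mixE x : sin_mix j.+1 L y x = sin_mix j L (yz (L * sin (x 0 k0 / L))) x.
  apply/rowP => k; rewrite !mxE ltnS leq_eqVlt -val_eqE /=.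
  case: (eqVneq (k : nat) j) => [kj|_] /=; last by [].
  rewrite kj ltnn; congr (_ * sin (x 0 _ / _)).
  exact/val_inj.
rewrite (_ : (fun _ => _) = (fun x => psi (sin_mix j L (yz (L * sin (x 0 k0 / L))) x))); last first.
  by apply/funext => x; rewrite mixE.
apply: (trig_stable_sin (u := fun z x => psi (sin_mix j L (yz z) x)) L0 A0).
- by move=> z; apply: IH; exact: ltnW.
- move=> z z' x; apply: le_trans (psiL _ _) _; rewrite ler_wpM2l //.
  rewrite /l1norm (bigD1 k0) //= big1 => [|k kk0].
    by rewrite !mxE ltnn eqxx addr0.
  by rewrite !mxE (negbTE kk0) subrr normr0.
- rewrite (_ : (fun _ => _) = (fun x => psi (sin_mix j.+1 L y x))) //.
  by apply/funext => x; rewrite mixE.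
Qed.

Lemma converges_lipschitz (A : R) psi : 0 <= A ->
    (exists K : R, forall x, `|psi x| <= K) -> l1_lipschitz A psi ->
  converges psi.
Proof.
move=> A0 bpsi psiL; apply: converges_approx => e e0.
have bmpsi : bounded_mfun psi by split => //; exact: measurable_lipschitz psiL.
(* Chosen so that [A C / L <= e], where [A C / L] bounds the effect of the substitution under any
   mean with second moment at most [C]. *)
pose L := A * C / e + 1.
have L0 : 0 < L by rewrite ltr_wpDl // divr_ge0 ?mulr_ge0 // ltW.
have st := trig_stable_sin_mix 0 L0 A0 bpsi psiL (leqnn d).
have [bst _] := st.
have dist x : `|psi x - psi (sin_mix d L 0 x)| <= A / L * sqnorm x.
  apply: le_trans (psiL _ _) _; rewrite -mulrA ler_wpM2l //.
  rewrite mulr_sumr; apply: ler_sum => k _; rewrite !mxE ltn_ord.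
  rewrite -[X in X - _](divfK (_ : L != 0)) ?gt_eqF // mulrC -mulrBr normrM.
  rewrite (gtr0_norm L0) distrC; apply: le_trans (ler_wpM2l (ltW L0) (sinB_le _)) _.
  rewrite expr_div_n [X in _ <= X](_ : _ = L * (x 0 k ^+ 2 / L ^+ 2)) //.
  by field; rewrite gt_eqF.
have AL0 : 0 <= A / L by rewrite divr_ge0 // ltW.
have le_e : A / L * C <= e.
  rewrite mulrAC ler_pdivrMr // /L mulrDr mulr1 [e * _]mulrC divfK ?gt_eqF //.
  by rewrite lerDl ltW.
exists (fun x => psi (sin_mix d L 0 x)); split.
- exact: trig_stable_converges.
- by move=> n m; apply: le_trans le_e; exact: Phi_sq.
- by apply: le_trans le_e; exact: Ex_sq.
Qed.

End convergence.

(** * The Levy-Khintchine formula with second moments *)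

Section integration.
Context {dT : measure_display} {T : measurableType dT} {R : realType}.
Variable mu : {measure set T -> \bar R}.
Implicit Types f g : T -> R.

Lemma integrable_dominated f g : measurable_fun setT f ->
    (forall x, `|f x| <= g x) -> mu.-integrable setT (EFin \o g) ->
  mu.-integrable setT (EFin \o f).
Proof.
move=> mf fg; apply: le_integrable => //; first exact/measurable_EFinP.
move=> x _ /=; rewrite lee_fin.
by rewrite (le_trans (fg x)) // ler_norm.
Qed.

Lemma integrable_ge0 f : measurable_fun setT f -> (forall x, 0 <= f x) ->
  (\int[mu]_x (f x)%:E < +oo)%E -> mu.-integrable setT (EFin \o f).
Proof.
move=> mf f0 fi; apply/integrableP; split; first exact/measurable_EFinP.
by under eq_integral do rewrite /= ger0_norm //.
Qed.

Lemma integrable_sumR (I : finType) (F : I -> T -> R) :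
    (forall i, mu.-integrable setT (EFin \o F i)) ->
  mu.-integrable setT (EFin \o (fun x => \sum_i F i x)).
Proof.
move=> iF; rewrite (_ : _ \o _ = (fun x => \sum_(i <- index_enum I) (F i x)%:E)%E).
  by apply: integrable_sum => // i _; exact: iF.
by apply/funext => x /=; rewrite sumEFin.
Qed.

Lemma Rintegral_sum (I : finType) (F : I -> T -> R) :
    (forall i, mu.-integrable setT (EFin \o F i)) ->
  \int[mu]_x (\sum_i F i x) = \sum_i \int[mu]_x F i x.
Proof.
move=> iF; apply: EFin_inj; rewrite -sumEFin /Rintegral fineK; last first.
  by apply: integrable_fin_num => //; exact: integrable_sumR.
under eq_integral do rewrite -sumEFin.
rewrite integral_sum //.
by apply: eq_bigr => i _; rewrite fineK //; apply: integrable_fin_num => //; exact: iF.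
Qed.

Lemma dominated_Rintegral (f_ : nat -> T -> R) f g :
    (forall n, measurable_fun setT (f_ n)) -> measurable_fun setT f ->
    (forall x, f_ n x @[n --> \oo] --> f x) ->
    mu.-integrable setT (EFin \o g) -> (forall n x, `|f_ n x| <= g x) ->
  \int[mu]_x f_ n x @[n --> \oo] --> \int[mu]_x f x.
Proof.
move=> mf_ mf cf ig fg.
have [||||fi _ cI] := @dominated_convergence _ _ _ mu _ measurableT
  (fun n => EFin \o f_ n) (EFin \o f) (EFin \o g) _ _ _ ig.
- by move=> n; exact/measurable_EFinP.
- exact/measurable_EFinP.
- by apply: aeW => x _; apply: cvg_EFin; [exact: nearW|exact: cf].
- by apply: aeW => x n _ /=; rewrite lee_fin.
rewrite /Rintegral; apply: fine_cvg.
by rewrite fineK; [exact: cI|exact: integrable_fin_num].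
Qed.

Lemma fatou_le (f_ : nat -> T -> R) f (c : \bar R) :
    (forall n, measurable_fun setT (f_ n)) -> (forall n x, 0 <= f_ n x) ->
    (forall x, f_ n x @[n --> \oo] --> f x) ->
    (\forall n \near \oo, \int[mu]_x (f_ n x)%:E <= c)%E ->
  (\int[mu]_x (f x)%:E <= c)%E.
Proof.
move=> mf_ f0 cf le_c.
rewrite (_ : \int[mu]_x _ = \int[mu]_x limn_einf (fun n => (f_ n x)%:E))%E.
  apply: le_trans.
    apply: fatou => //.
    - by move=> n; apply/measurable_EFinP.
    - by move=> n x _; rewrite lee_fin.
  rewrite limn_einf_lim; apply: lime_le; first exact: is_cvg_einfs.
  near=> n; apply: le_trans (_ : _ <= \int[mu]_x (f_ n x)%:E)%E _; last by near: n.
  by apply: ereal_inf_lbound; exists n => /=.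
apply: eq_integral => x _; apply/esym.
have : (f_ n x)%:E @[n --> \oo] --> (f x)%:E.
  by apply: cvg_EFin; [exact: nearW|exact: cf].
by move=> /cvg_limn_einf_sup[].
Unshelve. all: by end_near. Qed.

End integration.

Section levy_khintchine.
Context {dT : measure_display} {T : measurableType dT} {R : realType}.
Variables (P : probability T R) (Y : T -> R) (nu : {measure set R -> \bar R}).

Definition cos_part (s : R) : R := \int[nu]_u (cos (s * u) - 1).
Definition sin_part (s : R) : R := \int[nu]_u (sin (s * u) - s * u).

Lemma measurable_cosM (s : R) : measurable_fun setT (fun u : R => cos (s * u)).
Proof.
apply: (measurableT_comp (f := @cos R)).
  by apply: continuous_measurable_fun; exact: continuous_cos.
exact: measurable_funM.
Qed.

Lemma measurable_sinM (s : R) : measurable_fun setT (fun u : R => sin (s * u)).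
Proof.
apply: (measurableT_comp (f := @sin R)).
  by apply: continuous_measurable_fun; exact: continuous_sin.
exact: measurable_funM.
Qed.

Lemma cexp_i (y : R) : cexp ('i%C * y%:C)%C = (cos y +i* sin y)%C.
Proof.
rewrite /cexp /= !(mul0r, mul1r, mulr0, subr0, oppr0, add0r, addr0) expR0.
by apply/eqP; rewrite eq_complex /= !(mul1r, mul0r, subr0, addr0) !eqxx.
Qed.

Lemma levy_khintchineE : levy_measure_of P Y nu -> exists gamma : R, forall s : R,
  \int[P]_w cos (s * Y w) = expR (cos_part s) *
    cos (s * gamma + \int[nu]_u (sin (s * u) - s * u * (`|u| <= 1)%R%:R)) /\
  \int[P]_w sin (s * Y w) = expR (cos_part s) *
    sin (s * gamma + \int[nu]_u (sin (s * u) - s * u * (`|u| <= 1)%R%:R)).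
Proof.
move=> [gamma [_ ID]]; exists gamma => s.
have := ID s; rewrite /char_fun /levy_exponent /cintegral.
under [X in (X +i* _)%C = _]eq_Rintegral do rewrite cexp_i /=.
under [X in (_ +i* X)%C = _]eq_Rintegral do rewrite cexp_i /=.
have FRe (v : R) : complex.Re (cexp ('i%C * (s * v)%:C) - 1 -
    'i%C * (s * v * (Num.sqrt (v * v) <= 1)%R%:R)%:C)%C = cos (s * v) - 1.
  by rewrite cexp_i /=; ring.
have FIm (v : R) : complex.Im (cexp ('i%C * (s * v)%:C) - 1 -
    'i%C * (s * v * (Num.sqrt (v * v) <= 1)%R%:R)%:C)%C =
    sin (s * v) - s * v * (`|v| <= 1)%R%:R.
  by rewrite cexp_i /= -expr2 sqrtr_sqr; ring.
under [X in _ = cexp (_ + (X +i* _)%C)]eq_Rintegral => v _ do rewrite FRe.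
under [X in _ = cexp (_ + (_ +i* X)%C)]eq_Rintegral => v _ do rewrite FIm.
rewrite -/(cos_part s); set A := cos_part s; set B := Rintegral nu _ _.
rewrite /cexp /= => -[].
by rewrite !(mul0r, mul1r, mulr0, subr0, oppr0, add0r, addr0) => -> ->.
Qed.

Lemma levy_min_integrable : levy_measure_on (V := R) *%R 0 nu ->
  nu.-integrable setT (EFin \o (fun u : R => Num.min 1 (u ^+ 2))).
Proof.
move=> [_ fin]; apply: integrable_ge0.
- exact: measurable_minr.
- by move=> u; rewrite le_min ler01 sqr_ge0.
- move: fin; under eq_integral => u _ do
    rewrite (_ : Num.sqrt (u * u) ^+ 2 = u ^+ 2) ?sqr_sqrtr -?expr2 ?sqr_ge0 //.
  by [].
Qed.

Lemma cosB1_le_min (s u : R) :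
  `|cos (s * u) - 1| <= (2 + s ^+ 2) * Num.min 1 (u ^+ 2).
Proof.
have c1 := cos_le1 (s * u); have c2 := cos_geN1 (s * u).
have := onem_cos_le (s * u); rewrite exprMn => h.
have u0 := sqr_ge0 u; have s0 := sqr_ge0 s.
rewrite ler0_norm ?subr_le0 // opprB minEle; case: ifP => _; nra.
Qed.

Lemma integrable_cosB1_min (s : R) : levy_measure_on (V := R) *%R 0 nu ->
  nu.-integrable setT (EFin \o (fun u : R => cos (s * u) - 1)).
Proof.
move=> /levy_min_integrable im.
apply: (@integrable_dominated _ _ _ _ _
  (fun u : R => (2 + s ^+ 2) * Num.min 1 (u ^+ 2))).
- by apply: measurable_funB => //; exact: measurable_cosM.
- exact: cosB1_le_min.
- by rewrite (_ : _ \o _ = (fun u => (2 + s ^+ 2)%:E * (Num.min 1 (u ^+ 2))%:E)%E) //;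
    exact: integrableZl.
Qed.

Hypothesis mY : measurable_fun setT Y.
Hypothesis Y2 : P.-integrable setT (EFin \o (fun w => Y w ^+ 2)).

Let V := \int[P]_w Y w ^+ 2.

Lemma mean_cos_ge (s : R) : 1 - s ^+ 2 * V / 2 <= \int[P]_w cos (s * Y w).
Proof.
have i1 : P.-integrable setT (EFin \o (fun=> 1 : R)).
  exact: finite_measure_integrable_cst.
have i2 : P.-integrable setT (EFin \o (fun w => s ^+ 2 / 2 * Y w ^+ 2)).
  by rewrite (_ : _ \o _ = (fun u => (s ^+ 2 / 2)%:E * (Y u ^+ 2)%:E)%E) //;
    exact: integrableZl.
have -> : 1 - s ^+ 2 * V / 2 = \int[P]_w (1 - s ^+ 2 / 2 * Y w ^+ 2).
  rewrite RintegralB // RintegralZl // Rintegral_cst // mul1r.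
  by rewrite [X in fine X](probability_setT P) /= mulrAC.
apply: le_Rintegral => //.
- by rewrite (_ : _ \o _ = (fun u => 1%:E - (s ^+ 2 / 2 * Y u ^+ 2)%:E)%E) //;
    exact: integrableB.
- apply: (@integrable_dominated _ _ _ _ _ (fun=> 1)) => //.
  + by apply: (measurableT_comp (measurable_cosM s)).
  + by move=> w; rewrite ler_norml cos_geN1 cos_le1.
- by move=> w _; have := onem_cos_le (s * Y w); rewrite exprMn; lra.
Qed.

Hypothesis nuY : levy_measure_of P Y nu.

(** With [z = s^2 V]: [1 - z/2 <= E cos(sY) <= exp(cos_part s)], while
    [exp(-z) <= 1/(1 + z) <= 1 - z/2] for [z] in [0, 1]. *)
Lemma cos_part_ge (s : R) : s ^+ 2 * V <= 1 -> - (s ^+ 2 * V) <= cos_part s.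
Proof.
move=> sV; have [gamma /(_ s)[cE _]] := levy_khintchineE nuY.
have := mean_cos_ge s; rewrite {}cE; set B := cos _; set z := s ^+ 2 * V.
have V0 : 0 <= V by apply: Rintegral_ge0 => w _; exact: sqr_ge0.
have z0 : 0 <= z by rewrite mulr_ge0 ?sqr_ge0.
have B1 : B <= 1 by exact: cos_le1.
have e0 := expR_gt0 (cos_part s).
move=> h; have {h} h : 1 - z / 2 <= expR (cos_part s) by nra.
have h2 : expR (- z) * (1 + z) <= 1.
  by rewrite -[leRHS](expRxMexpNx_1 z) mulrC ler_wpM2r ?expR_ge0 // expR_ge1Dx.
have h3 : expR (- z) <= 1 - z / 2.
  have z1 : 0 < 1 + z by lra.
  by rewrite -(ler_pM2r z1); apply: le_trans h2 _; rewrite -/z in sV; nra.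
by rewrite -ler_expR (le_trans h3).
Qed.

(** On [|u| <= n], [u^2] is at most [8 n^2 (1 - cos(u/n))], whose integral is
    [-8 n^2 cos_part(1/n) <= 8 V]; Fatou's lemma removes the cut at [n]. *)
Lemma levy_sq_integrable :
  nu.-integrable setT (EFin \o (fun u : R => u ^+ 2)).
Proof.
have [gamma [nuL _]] := nuY.
have V0 : 0 <= V by apply: Rintegral_ge0 => w _; exact: sqr_ge0.
apply: integrable_ge0 => [//||]; first by move=> u; exact: sqr_ge0.
apply: (@le_lt_trans _ _ (8 * V)%:E); last by rewrite ltry.
pose I n : set R := `[- n%:R, n%:R]%classic.
have IE n (u : R) : \1_(I n) u = (`|u| <= n%:R)%R%:R :> R.
  by rewrite indicE mem_setE in_itv /= ler_norml.
have mI n : measurable_fun setT (fun u : R => u ^+ 2 * \1_(I n) u).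
  by apply: measurable_funM => //; apply: measurable_indic; exact: measurable_itv.
apply: (@fatou_le _ _ _ nu (fun n u => u ^+ 2 * \1_(I n) u) (fun u => u ^+ 2)) => //.
- by move=> n u; rewrite IE mulr_ge0 ?sqr_ge0.
- move=> u; apply: cvg_near_cst; near=> n.
  rewrite IE (_ : `|u| <= n%:R) ?mulr1 //; near: n; exact: nbhs_infty_ger.
near=> n.
have n0 : 0 < n%:R :> R by rewrite ltr0n; near: n; exact: nbhs_infty_gt.
have n20 : 0 < n%:R ^+ 2 :> R by rewrite exprn_gt0.
(* The condition [s^2 V <= 1] of [cos_part_ge] at [s = 1/n], from [V <= n <= n^2]. *)
have nV : V <= n%:R ^+ 2.
  apply: (@le_trans _ _ n%:R); first by near: n; exact: nbhs_infty_ger.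
  by rewrite expr2 ler_peMr ?ltW // ltr1n; near: n; exact: nbhs_infty_gt.
have i1 := integrable_cosB1_min n%:R^-1 nuL.
pose c : R := - (8 * n%:R ^+ 2).
have i2 : nu.-integrable setT (EFin \o (fun u : R => c * (cos (n%:R^-1 * u) - 1))).
  by rewrite (_ : _ \o _ = (fun u => c%:E * (cos (n%:R^-1 * u) - 1)%:E)%E) //;
    exact: integrableZl.
apply: (@le_trans _ _ (\int[nu]_u (c * (cos (n%:R^-1 * u) - 1))%:E)%E).
  apply: ge0_le_integral => //.
  - by move=> u _; rewrite lee_fin IE mulr_ge0 ?sqr_ge0.
  - exact/measurable_EFinP.
  - by case/integrableP: i2.
  - move=> u _; rewrite lee_fin IE /c.
    have c1 := cos_le1 (n%:R^-1 * u).
    case: (leP `|u| n%:R) => un; last by rewrite mulr0; nra.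
    have := @onem_cos_ge R (n%:R^-1 * u).
    rewrite normrM gtr0_norm ?invr_gt0 // mulrC ler_pdivrMr // mul1r => /(_ un).
    rewrite exprMn => h.
    rewrite [leRHS](_ : _ = 8 * n%:R ^+ 2 * (1 - cos (n%:R^-1 * u))); last by ring.
    apply: le_trans (ler_wpM2l _ h); last by rewrite mulr_ge0 // ltW.
    by rewrite mulr1 le_eqVlt; apply/orP; left; apply/eqP; field; rewrite gt_eqF.
rewrite -[leLHS]fineK; last exact: integrable_fin_num.
rewrite lee_fin -/(Rintegral _ _ _) RintegralZl //.
have := @cos_part_ge n%:R^-1; rewrite exprVn mulrC ler_pdivrMr // mul1r => /(_ nV).
rewrite -/(cos_part _) /c lerNl => h.
have {}h : n%:R ^+ 2 * - cos_part n%:R^-1 <= V by rewrite mulrC -ler_pdivlMr.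
by lra.
Unshelve. all: by end_near. Qed.

Lemma integrable_abs_large :
  nu.-integrable setT (EFin \o (fun u : R => u * (1 < `|u|)%R%:R)).
Proof.
apply: (@integrable_dominated _ _ _ _ _ (fun u : R => u ^+ 2)).
- rewrite (_ : (fun _ => _) = (fun u : R => u * \1_(~` `[-1, 1]%classic) u)).
    apply: measurable_funM => //; apply: measurable_indic.
    by apply: measurableC; exact: measurable_itv.
  apply/funext => u; congr (_ * _); rewrite indicE in_setC mem_setE in_itv /=.
  by rewrite -ler_norml -ltNge.
- move=> u; case: ltP => u1; last by rewrite mulr0 normr0 sqr_ge0.
  by rewrite mulr1 -real_normK ?num_real // expr2 ler_peMl // ltW.
- exact: levy_sq_integrable.
Qed.

Lemma sq_integrable_dominated (c : R) (q : R -> R) : measurable_fun setT q ->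
    (forall u, `|q u| <= c * u ^+ 2) ->
  nu.-integrable setT (EFin \o q).
Proof.
move=> mq qc; apply: (integrable_dominated mq qc).
rewrite (_ : _ \o _ = (fun u => c%:E * (u ^+ 2)%:E)%E) //.
by apply: integrableZl => //; exact: levy_sq_integrable.
Qed.

Lemma measurable_sinB (s : R) :
  measurable_fun setT (fun u : R => sin (s * u) - s * u).
Proof. by apply: measurable_funB; [exact: measurable_sinM|exact: measurable_funM]. Qed.

Lemma sinB_le_sq (s u : R) : `|sin (s * u) - s * u| <= s ^+ 2 * u ^+ 2.
Proof. by rewrite -exprMn; exact: sinB_le. Qed.

Lemma cosB1_le_sq (s u : R) : `|cos (s * u) - 1| <= s ^+ 2 * u ^+ 2.
Proof.
rewrite -exprMn ler0_norm ?subr_le0 ?cos_le1 // opprB.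
by apply: le_trans (onem_cos_le _) _; rewrite ler_pdivrMr // ler_peMr ?sqr_ge0 // ler1n.
Qed.

(* With a finite second moment the compensator can be integrated over the
   whole line, which turns gamma into the mean. *)
Lemma levy_khintchine_mean : exists m1 : R, forall s : R,
  \int[P]_w cos (s * Y w) = expR (cos_part s) * cos (s * m1 + sin_part s) /\
  \int[P]_w sin (s * Y w) = expR (cos_part s) * sin (s * m1 + sin_part s).
Proof.
have [gamma H] := levy_khintchineE nuY.
exists (gamma + \int[nu]_u (u * (1 < `|u|)%R%:R)) => s.
have -> : s * (gamma + \int[nu]_u (u * (1 < `|u|)%R%:R)) + sin_part s =
    s * gamma + \int[nu]_u (sin (s * u) - s * u * (`|u| <= 1)%R%:R); last exact: H.
have iL := integrable_abs_large.
have isL : nu.-integrable setT (EFin \o (fun u : R => s * (u * (1 < `|u|)%R%:R))).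
  by rewrite (_ : _ \o _ = (fun u : R => s%:E * (u * (1 < `|u|)%R%:R)%:E)%E) //;
    exact: integrableZl.
rewrite mulrDr -addrA; congr (_ + _); rewrite -RintegralZl // -RintegralD //.
  apply: eq_Rintegral => u _; rewrite leNgt; case: ltP => _ /=; ring.
by apply: (sq_integrable_dominated (measurable_sinB s) (sinB_le_sq s)).
Qed.

End levy_khintchine.

Lemma ler_sqr_norm (R : realDomainType) (u v : R) : `|v| <= `|u| -> v ^+ 2 <= u ^+ 2.
Proof.
by move=> uv; rewrite -[leLHS]real_normK ?num_real // -[leRHS]real_normK ?num_real // ler_sqr.
Qed.

(** * Approximation by random walks *)

Section discretization.
Context {R : realType}.
Variable nu : {measure set R -> \bar R}.
Hypothesis nu2 : nu.-integrable setT (EFin \o (fun u : R => u ^+ 2)).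

(* The cells cut [1/k, k + 1/k[ and its mirror image, k = n + 1, into intervals
   of length 1/k; each is represented by its endpoint closest to 0. *)
Definition cell_index (n : nat) : finType := (bool * 'I_(n.+1 * n.+1))%type.

Definition cell_value n (j : cell_index n) : R :=
  (if j.1 then 1 else -1) * (j.2.+1%:R / n.+1%:R).

Definition cell n (j : cell_index n) : set R :=
  if j.1 then `[j.2.+1%:R / n.+1%:R, j.2.+2%:R / n.+1%:R[%classic
  else `](- (j.2.+2%:R / n.+1%:R)), (- (j.2.+1%:R / n.+1%:R))]%classic.

Lemma measurable_cell n (j : cell_index n) : measurable (cell j).
Proof. by rewrite /cell; case: ifP => _; exact: measurable_itv. Qed.

Lemma cellP n (j : cell_index n) u : cell j u <->
  j.2.+1%:R / n.+1%:R <= (if j.1 then u else - u) < j.2.+2%:R / n.+1%:R.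
Proof.
rewrite /cell; case: ifP => _ /=; rewrite in_itv //=.
by rewrite lerNr ltrNl andbC.
Qed.

Lemma cell_value_neq0 n (j : cell_index n) : cell_value j != 0.
Proof.
by rewrite /cell_value mulf_neq0 //; case: ifP => _; rewrite ?oppr_eq0 oner_eq0.
Qed.

Lemma cell_dist n (j : cell_index n) u : cell j u ->
  `|cell_value j| <= `|u| /\ `|cell_value j - u| <= n.+1%:R^-1.
Proof.
move/cellP => /andP[]; rewrite /cell_value.
have k0 : 0 < n.+1%:R :> R by [].
set x : R := j.2.+1%:R / _; have -> : j.2.+2%:R / n.+1%:R = x + n.+1%:R^-1.
  by rewrite /x -[j.2.+2%:R]natr1 mulrDl mul1r.
have x0 : 0 < x by rewrite divr_gt0.
move: x (n.+1%:R^-1 : R) x0 => x e x0.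
case: ifP => _ h1 h2; rewrite ?mul1r ?mulN1r.
  rewrite gtr0_norm // ger0_norm ?(le_trans (ltW x0)) // h1; split => //.
  by rewrite ler0_norm; lra.
rewrite normrN gtr0_norm // ler0_norm; last by lra.
by split => //; rewrite ger0_norm; lra.
Qed.

Lemma cell_inj n (j j' : cell_index n) u : cell j u -> cell j' u -> j = j'.
Proof.
case: j j' => [b i] [b' i'] /cellP /= + /cellP /=.
have k0 : 0 < n.+1%:R^-1 :> R by rewrite invr_gt0.
have p0 (m : nat) : 0 < m.+1%:R / n.+1%:R :> R by rewrite divr_gt0.
have := p0 i; have := p0 i'.
rewrite -!(ler_pdivlMr, ltr_pdivrMr) ?invr_gt0 //.
move=> hi' hi /andP[h1 h2] /andP[h3 h4].
have bb : b = b' by case: b h1 h2; case: b' h3 h4 => //=; lra.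
subst b'; congr (_, _); apply: val_inj; apply/eqP; rewrite eqn_leq.
have : (i.+1 < i'.+2)%N by rewrite -(ltr_nat R); exact: le_lt_trans h1 h4.
have : (i'.+1 < i.+2)%N by rewrite -(ltr_nat R); exact: le_lt_trans h3 h2.
by rewrite !ltnS => -> ->.
Qed.

Lemma cell_exists n u : n.+1%:R^-1 <= `|u| <= n.+1%:R ->
  exists j : cell_index n, cell j u.
Proof.
move=> /andP[u1 u2].
have k0 : 0 < n.+1%:R :> R by [].
pose m := Num.truncn (`|u| * n.+1%:R).
have m0 : (0 < m)%N by rewrite truncn_gt0 -ler_pdivrMr // mul1r.
have mle : (m.-1 < n.+1 * n.+1)%N.
  rewrite prednK // -(ler_nat R) natrM.
  apply: (@le_trans _ _ (`|u| * n.+1%:R)); first by rewrite truncn_le // mulr_ge0.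
  by rewrite ler_pM2r.
exists (0 <= u, Ordinal mle); apply/cellP => /=.
have -> : (if 0 <= u then u else - u) = `|u|.
  by case: ifPn => h; [rewrite ger0_norm|rewrite ltr0_norm // ltNge].
rewrite prednK // ler_pdivrMr // ltr_pdivlMr // truncnS_gt andbT.
by rewrite truncn_le // mulr_ge0.
Qed.

(** The integral of this step function is the weighted sum of [q] over the cells, which makes
    dominated convergence available. *)
Definition disc n (q : R -> R) (u : R) : R :=
  \sum_j q (@cell_value n j) * \1_(cell j) u.

Lemma discE n u :
  (exists2 j, @cell n j u & forall q, disc n q u = q (cell_value j)) \/
  (forall j, ~ @cell n j u) /\ (forall q, disc n q u = 0).
Proof.
have [[j uj]|no] := pselect (exists j, @cell n j u); [left|right].
  exists j => // q; rewrite /disc (bigD1 j) //= indicE mem_set // mulr1.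
  rewrite big1 ?addr0 // => i ij; rewrite indicE memNset ?mulr0 // => ui.
  by move/eqP: ij; apply; exact: cell_inj ui uj.
split=> [j uj|q]; first by apply: no; exists j.
by rewrite /disc big1 // => j _; rewrite indicE memNset ?mulr0 // => uj; apply: no; exists j.
Qed.

Lemma disc_cvg (q : R -> R) u : q 0 = 0 -> continuous q ->
  disc n q u @[n --> \oo] --> q u.
Proof.
move=> q0 qc; have [->|u0] := eqVneq u 0.
  rewrite q0; apply: cvg_near_cst; apply: nearW => n.
  have [[j /cell_dist[]]|[_ ->//]] := discE n 0.
  by rewrite normr0 normr_le0 (negbTE (cell_value_neq0 j)).
apply/cvgrPdist_le => e e0.
have /cvgrPdist_le/(_ _ e0)/nbhs_ballP[dl /= dl0 hd] := qc u.
near=> n.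
have [|j uj] := @cell_exists n u.
  apply/andP; split.
    rewrite -[leRHS]invrK lef_pV2 ?posrE ?invr_gt0 ?normr_gt0 //.
    apply: (@le_trans _ _ n%:R); last by rewrite ler_nat.
    by near: n; exact: nbhs_infty_ger.
  apply: (@le_trans _ _ n%:R); last by rewrite ler_nat.
  by near: n; exact: nbhs_infty_ger.
have [[j' uj' ->]|[no _]] := discE n u; last by case: (no j).
apply: hd; rewrite /ball /= distrC; have [_] := cell_dist uj'.
move=> /le_lt_trans; apply; rewrite -[ltRHS]invrK ltf_pV2 ?posrE ?invr_gt0 //.
apply: (@le_lt_trans _ _ n%:R); last by rewrite ltr_nat.
by near: n; exact: nbhs_infty_ger.
Unshelve. all: by end_near. Qed.

Lemma nu_cell_fin n (j : cell_index n) : (nu (cell j) < +oo)%E.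
Proof.
have v0 : 0 < cell_value j ^+ 2 by rewrite exprn_even_gt0 //= cell_value_neq0.
rewrite -[cell j]setIT -integral_indic //; last exact: measurable_cell.
apply: (@le_lt_trans _ _ (\int[nu]_u ((cell_value j ^+ 2)^-1 * u ^+ 2)%:E)%E).
  apply: ge0_le_integral => //.
  - by apply/measurable_EFinP; apply: measurable_indic; exact: measurable_cell.
  - by apply/measurable_EFinP; apply: measurable_funM.
  - move=> u _; rewrite lee_fin indicE.
    case: (boolP (u \in cell j)) => [|_]; last by rewrite mulr_ge0 ?invr_ge0 ?sqr_ge0.
    rewrite inE => /cell_dist[h _]; rewrite mulrC ler_pdivlMr // mul1r.
    exact: ler_sqr_norm.
have iv : nu.-integrable setT (EFin \o (fun u : R => (cell_value j ^+ 2)^-1 * u ^+ 2)).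
  rewrite (_ : _ \o _ = (fun u => (cell_value j ^+ 2)^-1%:E * (u ^+ 2)%:E)%E) //.
  exact: integrableZl.
rewrite -[ltLHS]fineK ?ltry //; exact: (integrable_fin_num _ iv).
Qed.

Definition weight n (j : cell_index n) : R := fine (nu (cell j)).

Lemma weight_ge0 n (j : cell_index n) : 0 <= weight j.
Proof. by rewrite fine_ge0. Qed.

Lemma integrable_disc n q : nu.-integrable setT (EFin \o disc n q).
Proof.
apply: integrable_sumR => j.
rewrite (_ : _ \o _ = (fun u => (q (cell_value j))%:E * (\1_(cell j) u)%:E)%E) //.
apply: integrableZl => //; apply: integrable_ge0.
- by apply: measurable_indic; exact: measurable_cell.
- by move=> u; rewrite indicE.
- by rewrite integral_indic ?setIT ?nu_cell_fin //; exact: measurable_cell.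
Qed.

Lemma Rintegral_disc n q :
  \int[nu]_u disc n q u = \sum_j weight j * q (@cell_value n j).
Proof.
have ij (j : cell_index n) : nu.-integrable setT (EFin \o (\1_(cell j) : R -> R)).
  apply: integrable_ge0.
  - by apply: measurable_indic; exact: measurable_cell.
  - by move=> u; rewrite indicE.
  - by rewrite integral_indic ?setIT ?nu_cell_fin //; exact: measurable_cell.
rewrite /disc Rintegral_sum => [|j].
  apply: eq_bigr => j _; rewrite RintegralZl //.
  by rewrite /Rintegral integral_indic ?setIT 1?mulrC //; exact: measurable_cell.
rewrite (_ : _ \o _ = (fun u => (q (cell_value j))%:E * (\1_(cell j) u)%:E)%E) //.
by apply: integrableZl => //; exact: ij.
Qed.

Lemma disc_norm_le n q (g : R -> R) u : (forall v, 0 <= g v) ->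
    (forall v, `|q v| <= g v) -> (forall u v, `|v| <= `|u| -> g v <= g u) ->
  `|disc n q u| <= g u.
Proof.
move=> g0 qg gm; have [[j /cell_dist[ju _] ->]|[_ ->]] := discE n u.
  by apply: le_trans (qg _) _; exact: gm.
by rewrite normr0.
Qed.

Lemma measurable_disc n q : measurable_fun setT (disc n q).
Proof.
apply: measurable_sum => j; apply: measurable_funM => //.
by apply: measurable_indic; exact: measurable_cell.
Qed.

(** Since a cell is represented by its endpoint nearest to 0, a function increasing in [|u|] is
    undervalued by its step function: the bound holds for every [n], without a discretization
    error. *)
Lemma weight_sum_le n (g : R -> R) : (forall v, 0 <= g v) ->
    (forall u v, `|v| <= `|u| -> g v <= g u) -> nu.-integrable setT (EFin \o g) ->
  \sum_j weight j * g (@cell_value n j) <= \int[nu]_u g u.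
Proof.
move=> g0 gm ig; rewrite -Rintegral_disc; apply: le_Rintegral => //.
  exact: integrable_disc.
move=> u _; apply: le_trans (ler_norm _) _; apply: disc_norm_le => // v.
by rewrite ger0_norm.
Qed.

Lemma weight_sum_sq_le n :
  \sum_j weight j * (@cell_value n j) ^+ 2 <= \int[nu]_u u ^+ 2.
Proof.
apply: (@weight_sum_le n (fun v => v ^+ 2)) => // [v|u v uv]; first exact: sqr_ge0.
exact: ler_sqr_norm.
Qed.

(** The quadratic bound on [q] forces [q 0 = 0] and dominates all the step functions at once. *)
Lemma weight_sum_cvg (q : R -> R) (c : R) : continuous q -> 0 <= c ->
    (forall u, `|q u| <= c * u ^+ 2) ->
  \sum_j weight j * q (@cell_value n j) @[n --> \oo] --> \int[nu]_u q u.
Proof.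
move=> qc c0 qle.
have q0 : q 0 = 0.
  by apply/eqP; rewrite -normr_le0; apply: le_trans (qle 0) _; rewrite expr0n mulr0.
under eq_fun do rewrite -Rintegral_disc.
apply: (@dominated_Rintegral _ _ _ nu (fun n => disc n q) q (fun u => c * u ^+ 2)).
- by move=> n; exact: measurable_disc.
- exact: continuous_measurable_fun.
- by move=> u; exact: disc_cvg.
- rewrite (_ : _ \o _ = (fun u => c%:E * (u ^+ 2)%:E)%E) //.
  exact: integrableZl.
- move=> n u; apply: (@disc_norm_le n q (fun v => c * v ^+ 2)) => // [v|u' v uv]; first by rewrite mulr_ge0 ?sqr_ge0.
  by rewrite ler_wpM2l // ler_sqr_norm.
Qed.

End discretization.

(** * Powers of 1 + z/N against exponentials *)

Section complex_limit.
Context {R : realType}.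
Local Open Scope complex_scope.
Implicit Types z w : R[i].

Lemma exprB_norm_le (K : numDomainType) (x y : K) m : `|x| <= 1 -> `|y| <= 1 ->
  `|x ^+ m - y ^+ m| <= m%:R * `|x - y|.
Proof.
move=> x1 y1; elim: m => [|m IH]; first by rewrite !expr0 subrr normr0 mul0r.
rewrite (_ : _ - _ = (x - y) * x ^+ m + y * (x ^+ m - y ^+ m)); last by rewrite !exprS; ring.
apply: le_trans (ler_normD _ _) _; rewrite -[m.+1%:R]natr1 [leRHS]mulrDl mul1r addrC !normrM.
apply: lerD; first by apply: le_trans IH; rewrite ler_piMl.
by rewrite ler_piMr // normrX exprn_ile1.
Qed.

Lemma cexpD z w : cexp (z + w) = cexp z * cexp w.
Proof.
case: z w => [a b] [a' b']; rewrite /cexp /= expRD cosD sinD.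
by apply/eqP; rewrite eq_complex /=; apply/andP; split; apply/eqP; ring.
Qed.

Lemma cexp0 : cexp (0 : R[i]) = 1.
Proof. by rewrite /cexp /= expR0 cos0 sin0; apply/eqP; rewrite eq_complex /= !(mul1r, mul0r, mulr0, subr0, addr0) !eqxx. Qed.

Lemma cexpMn z m : cexp (z *+ m) = cexp z ^+ m.
Proof.
by elim: m => [|m IH]; rewrite ?mulr0n ?cexp0 // mulrS cexpD IH exprS.
Qed.

Lemma cexpE (a b : R) : cexp (a +i* b) = (expR a * cos b) +i* (expR a * sin b).
Proof. by apply/eqP; rewrite eq_complex /= !(mul0r, subr0, addr0) !eqxx. Qed.

Lemma norm_cexp z : `|cexp z| = (expR (complex.Re z))%:C.
Proof.
case: z => a b; rewrite cexpE normc_def /= !exprMn -mulrDr cos2Dsin2 mulr1.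
by rewrite sqrtr_sqr ger0_norm // expR_ge0.
Qed.

Lemma normc_le_sum (a b : R) : `|a +i* b| <= (`|a| + `|b|)%:C.
Proof.
rewrite normc_def lecR -[leRHS]ger0_norm ?addr_ge0 // -sqrtr_sqr ler_wsqrtr //=.
rewrite -(real_normK (num_real a)) -(real_normK (num_real b)).
by have := mulr_ge0 (normr_ge0 a) (normr_ge0 b); nra.
Qed.

Lemma cexpB1_dist (a b : R) : a <= 0 ->
  `|cexp (a +i* b) - (1 + a +i* b)| <= (2 * a ^+ 2 + 3 * b ^+ 2)%:C.
Proof.
move=> a0; rewrite cexpE.
have -> : (expR a * cos b) +i* (expR a * sin b) - (1 + a +i* b) =
    (expR a * cos b - 1 - a) +i* (expR a * sin b - b).
  by apply/eqP; rewrite eq_complex /=; apply/andP; split; apply/eqP; ring.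
apply: le_trans (normc_le_sum _ _) _; rewrite lecR.
have e1 : expR a <= 1 by rewrite -expR0 ler_expR.
have e0 := expR_gt0 a.
have /andP[h1 h2] := expRB1x_le a0.
have c1 := cos_le1 b; have := onem_cos_le b => c2.
have s1 := sinB_le b.
have re : `|expR a * cos b - 1 - a| <= a ^+ 2 + b ^+ 2.
  by rewrite ler_norml; apply/andP; split; nra.
have im : `|expR a * sin b - b| <= a ^+ 2 + 2 * b ^+ 2.
  have -> : expR a * sin b - b = expR a * (sin b - b) + (expR a - 1) * b by ring.
  apply: le_trans (ler_normD _ _) _; rewrite !normrM (gtr0_norm e0).
  have ea : `|expR a - 1| <= - a.
    rewrite ler0_norm; last by lra.
    by have := expR_ge1Dx a; lra.
  have : expR a * `|sin b - b| <= b ^+ 2.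
    by apply: le_trans s1; rewrite ler_piMl.
  have : `|expR a - 1| * `|b| <= - a * `|b| by rewrite ler_wpM2r.
  have := sqr_ge0 (- a - `|b|); have := real_normK (num_real b).
  by rewrite sqrrB sqrrN; nra.
lra.
Qed.

(** [cexp z] is the [m.+1]-th power of [cexp(z / m.+1)]. Both bases lie in the closed unit disc, so
    the difference of the powers costs at most [m.+1] one-step errors, each quadratic in
    [z / m.+1]. *)
Lemma cexp_approx (w : R[i]) (a b : R) (m : nat) : a <= 0 -> `|w| <= 1 ->
    `|1 + (a +i* b) / m.+1%:R| <= 1 ->
  `|complex.Re (w * (1 + (a +i* b) / m.+1%:R) ^+ m.+1) -
    complex.Re (w * cexp (a +i* b))| <= (2 * a ^+ 2 + 3 * b ^+ 2) / m.+1%:R.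
Proof.
move=> a0 w1 z1; set k : R := m.+1%:R; have k0 : 0 < k by rewrite /k.
have zk : (a +i* b) / m.+1%:R = (a / k) +i* (b / k).
  have -> : m.+1%:R = k%:C by rewrite /k raddfMn.
  rewrite (_ : k%:C^-1 = (k^-1)%:C); last by rewrite fmorphV.
  by apply/eqP; rewrite eq_complex /= !(mulr0, subr0, addr0, add0r) !eqxx.
have ze : a +i* b = ((a / k) +i* (b / k)) *+ m.+1.
  rewrite -zk -[RHS]mulr_natr divfK //.
rewrite [in cexp _]ze cexpMn; rewrite zk in z1 *.
have -> (x y : R[i]) : complex.Re x - complex.Re y = complex.Re (x - y).
  by case: x y => ? ? [].
rewrite -lecR; apply: le_trans (normc_ge_Re _) _.
rewrite -mulrBr normrM; apply: le_trans (ler_piMl (normr_ge0 _) w1) _.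
apply: le_trans (exprB_norm_le _ z1 _) _.
  by rewrite norm_cexp /= lecR -expR0 ler_expR pmulr_lle0 ?invr_gt0.
rewrite distrC; have ak0 : a / k <= 0 by rewrite pmulr_lle0 ?invr_gt0.
have h := cexpB1_dist (b / k) ak0.
rewrite (_ : m.+1%:R = k%:C); last by rewrite /k raddfMn.
apply: le_trans (ler_wpM2l _ h) _; first by rewrite lecR ltW.
by rewrite -rmorphM lecR le_eqVlt; apply/orP; left; apply/eqP; field; rewrite gt_eqF.
Qed.

End complex_limit.

Lemma cvg_finsum (R : realType) (I : finType) (F : nat -> I -> R) (l : I -> R) :
  (forall i, F n i @[n --> \oo] --> l i) ->
  \sum_i F n i @[n --> \oo] --> \sum_i l i.
Proof.
move=> Fl; elim: (index_enum I) => [|i r IH].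
  by under eq_fun do rewrite big_nil; rewrite big_nil; exact: cvg_cst.
by under eq_fun do rewrite big_cons; rewrite big_cons; exact: cvgD.
Qed.

Lemma lipschitz_continuous (R : realType) (C : R) (q : R -> R) :
  (forall u v, `|q u - q v| <= C * `|u - v|) -> continuous q.
Proof.
move=> qC u; apply/cvgrPdist_le => e e0.
have C0 : 0 < `|C| + 1 by rewrite ltr_wpDl.
apply/nbhs_ballP; exists (e / (`|C| + 1)) => /= [|v]; first exact: divr_gt0.
rewrite /ball /= => /ltW; rewrite ler_pdivlMr // => uv.
apply: le_trans (qC u v) _; apply: le_trans uv.
by rewrite mulrC ler_wpM2l // ler_wpDr // ler_norm.
Qed.

Lemma sum_unit (M : nmodType) (F : unit -> M) : \sum_i F i = F tt.
Proof. by rewrite (big_pred1 tt) // => -[]. Qed.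

Section approximation.
Context {R : realType} {d : nat}.
Local Notation V := 'rV[R]_d.
Variables (nu : 'I_d -> {measure set R -> \bar R}) (m1 : V).
Hypothesis nu2 : forall k, (nu k).-integrable setT (EFin \o (fun u : R => u ^+ 2)).

(** The summand [unit] is the step that stays put. *)
Definition jump_index n : finType := (('I_d * cell_index n) + unit)%type.

Definition jump n (j : jump_index n) : V :=
  match j with inl ki => @cell_value R n ki.2 *: delta_mx 0 ki.1 | inr _ => 0 end.

Definition rate n (j : jump_index n) : R :=
  match j with inl ki => weight (nu ki.1) ki.2 | inr _ => 0 end.

Definition total n : R := \sum_j @rate n j.

(** Above [total n], so that the probability of staying put is nonnegative, and above [m], so that
    it tends to infinity with [m]. *)
Definition steps n m : nat := (Num.truncn (total n) + m).+1.

Definition jump_prob n m (j : jump_index n) : R :=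
  match j with
  | inl ki => weight (nu ki.1) ki.2 / (steps n m)%:R
  | inr _ => 1 - total n / (steps n m)%:R
  end.

Definition drift n : V :=
  \row_k (m1 0 k - \sum_i weight (nu k) i * @cell_value R n i).

(* The drift makes every walk have the mean m1 of X. *)
Definition Phi n m (psi : V -> R) : R :=
  walk (@jump_prob n m) (@jump n) (steps n m) psi (drift n).

Lemma rate_ge0 n (j : jump_index n) : 0 <= rate j.
Proof. by case: j => [ki|[]] //=; exact: weight_ge0. Qed.

Lemma total_lt_steps n m : total n < (steps n m)%:R.
Proof.
rewrite /steps; apply: lt_le_trans (truncnS_gt _) _.
by rewrite ler_nat ltnS leq_addr.
Qed.

Lemma steps_gt0 n m : 0 < (steps n m)%:R :> R.
Proof. by rewrite ltr0n. Qed.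

Lemma jump_prob_ge0 n m (j : jump_index n) : 0 <= jump_prob m j.
Proof.
case: j => [ki|[]] /=; first by rewrite divr_ge0 ?weight_ge0.
by rewrite subr_ge0 ler_pdivrMr ?steps_gt0 // mul1r ltW // total_lt_steps.
Qed.

(** The ring morphism lets one statement serve both the real weights and their images in [R[i]].
    Subtracting the value at rest isolates the part of order [1/N]. *)
Lemma sum_jump_prob (K : comNzRingType) (f : {rmorphism R -> K}) n m
    (g : jump_index n -> K) :
  \sum_j f (jump_prob m j) * g j =
  g (inr tt) + f (steps n m)%:R^-1 * \sum_j f (rate j) * (g j - g (inr tt)).
Proof.
rewrite !big_sumType /= !sum_unit rmorph0 mul0r addr0.
under [in RHS]eq_bigr do rewrite mulrBr.
rewrite sumrB mulrBr -mulr_suml mulr_sumr.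
have -> : \sum_(i : 'I_d * cell_index n) f (weight (nu i.1) i.2) = f (total n).
  by rewrite /total big_sumType /= sum_unit addr0 rmorph_sum.
rewrite rmorphB rmorph1 mulrBl mul1r !rmorphM mulrA [f _^-1 * _]mulrC.
rewrite addrC -!addrA; congr (_ + _).
rewrite addrC; congr (_ + _); apply: eq_bigr => j _.
by rewrite rmorphM mulrA [f _^-1 * _]mulrC.
Qed.

Lemma sum_jump_probR n m (g : jump_index n -> R) :
  \sum_j jump_prob m j * g j =
  g (inr tt) + (steps n m)%:R^-1 * \sum_j rate j * (g j - g (inr tt)).
Proof. exact: (sum_jump_prob idfun). Qed.

Lemma jump_prob_sum1 n m : \sum_j @jump_prob n m j = 1.
Proof.
rewrite -[RHS]addr0 -[X in _ + X](mulr0 (steps n m)%:R^-1).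
under eq_bigr do rewrite -[jump_prob _ _]mulr1.
by rewrite (sum_jump_probR m (fun=> 1)) subrr; under eq_bigr do rewrite mulr0; rewrite big1_eq.
Qed.

Lemma sum_rate n (g : V -> R) :
  \sum_j rate j * g (@jump n j) =
  \sum_k \sum_i weight (nu k) i * g (@cell_value R n i *: delta_mx 0 k).
Proof. by rewrite big_sumType /= sum_unit mul0r addr0 pair_bigA. Qed.

Lemma Phi_mean n m : mean (Phi n m).
Proof.
split=> [phi psi _ _|c psi _|phi psi _ _ le|].
- exact: walkD.
- exact: walkZ.
- by apply: le_walk => // j; exact: jump_prob_ge0.
- by rewrite /Phi walk_cst // jump_prob_sum1.
Qed.

Definition sq_const : R := \sum_k (m1 0 k ^+ 2 + \int[nu k]_u u ^+ 2).

Lemma sq_const_ge0 : 0 <= sq_const.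
Proof.
apply: sumr_ge0 => k _; apply: addr_ge0; first exact: sqr_ge0.
by apply: Rintegral_ge0 => u _; exact: sqr_ge0.
Qed.

Lemma coord_jump_sum n k (q : R -> R) : q 0 = 0 ->
  \sum_j rate j * q (@jump n j 0 k) = \sum_i weight (nu k) i * q (@cell_value R n i).
Proof.
move=> q0; rewrite (sum_rate _ (fun v => q (v 0 k))) (bigD1 k) //=.
rewrite [X in _ + X]big1 ?addr0 => [|l lk].
  by apply: eq_bigr => i _; rewrite !mxE !eqxx mulr1.
by apply: big1 => i _; rewrite !mxE eq_sym (negbTE lk) andbF mulr0 q0 mulr0.
Qed.

Lemma coord_jump_prob n m k (q : R -> R) : q 0 = 0 ->
  \sum_j jump_prob m j * q (@jump n j 0 k) =
  (steps n m)%:R^-1 * \sum_i weight (nu k) i * q (@cell_value R n i).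
Proof.
move=> q0; rewrite sum_jump_probR -coord_jump_sum //= mxE q0 add0r.
by congr (_ * _); apply: eq_bigr => j _; rewrite subr0.
Qed.

(** The drift makes the mean exactly [m1], and the variance is at most the weighted sum of squared
    jumps, itself below the integral of [u^2]: a bound uniform in [n] and [m]. *)
Lemma Phi_coord_sq n m k :
  Phi n m (fun x => x 0 k ^+ 2) <= m1 0 k ^+ 2 + \int[nu k]_u u ^+ 2.
Proof.
rewrite /Phi (eq_walk _ _ _ (psi := fun x : V => (x 0 k + 0) ^+ 2)); last first.
  by move=> x; rewrite addr0.
rewrite (@walk_sqr_affine _ _ _ _ _ (fun x : V => x 0 k)) ?jump_prob_sum1 //; last first.
  by move=> x y; rewrite mxE.
rewrite (@coord_jump_prob n m k id) // (@coord_jump_prob n m k (fun v => v ^+ 2)) ?expr0n //.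
rewrite mxE addr0 mulrA divff ?gt_eqF ?steps_gt0 // mul1r subrK lerD2l.
apply: le_trans (weight_sum_sq_le (nu2 k) n).
rewrite mulrBr mulrA divff ?gt_eqF ?steps_gt0 // mul1r lerBlDr lerDl.
by rewrite mulr_ge0 ?sqr_ge0.
Qed.

Lemma Phi_sqnorm n m : Phi n m (@sqnorm R d) <= sq_const.
Proof.
rewrite /Phi /sqnorm walk_sum; apply: ler_sum => k _; exact: Phi_coord_sq.
Qed.

Lemma Phi_sq_bounded n m : sq_bounded sq_const (Phi n m).
Proof.
move=> phi psi c _ _ c0 le; apply: le_trans.
  by apply: walk_normB => j; exact: jump_prob_ge0.
apply: le_trans; first by apply: le_walk le => j; exact: jump_prob_ge0.
by rewrite walkZ ler_wpM2l // Phi_sqnorm.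
Qed.

Local Open Scope complex_scope.

Lemma Re_sum (I : finType) (F : I -> R[i]) :
  complex.Re (\sum_i F i) = \sum_i complex.Re (F i).
Proof. by apply: (big_morph (@complex.Re R)) => // -[? ?] []. Qed.

Lemma Im_sum (I : finType) (F : I -> R[i]) :
  complex.Im (\sum_i F i) = \sum_i complex.Im (F i).
Proof. by apply: (big_morph (@complex.Im R)) => // -[? ?] []. Qed.

Lemma Re_realM (c : R) (z : R[i]) : complex.Re (c%:C * z) = c * complex.Re z.
Proof. by case: z => x y /=; rewrite mul0r subr0. Qed.

(** The weights are real, so taking real parts commutes with the walk; cosines thus inherit the
    eigenvalue computation for complex characters. *)
Lemma walk_Re (J : finType) (p : J -> R) (v : J -> V) m (psi : V -> R[i]) x :
  complex.Re (walk (fun j => (p j)%:C) v m psi x) =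
  walk p v m (fun y => complex.Re (psi y)) x.
Proof.
elim: m x => // m IH x; rewrite !walkSl Re_sum.
by apply: eq_bigr => j _; rewrite Re_realM IH.
Qed.

Definition cos_sum n (s : V) : R :=
  \sum_k \sum_i weight (nu k) i * (cos (s 0 k * @cell_value R n i) - 1).
Definition sin_sum n (s : V) : R :=
  \sum_k \sum_i weight (nu k) i * sin (s 0 k * @cell_value R n i).

Lemma edotZ_delta (s : V) c k : edot s (c *: delta_mx 0 k) = s 0 k * c.
Proof.
rewrite /edot (bigD1 k) //= !mxE !eqxx mulr1 big1 ?addr0 // => l lk.
by rewrite !mxE (negbTE lk) andbF !mulr0.
Qed.

Lemma character_mean n m (s : V) :
  \sum_j (@jump_prob n m j)%:C * cexp (0 +i* edot s (@jump n j)) =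
  1 + (cos_sum n s +i* sin_sum n s) / (steps n m)%:R.
Proof.
rewrite (sum_jump_prob (real_complex R)) /=.
have -> : edot s 0 = 0 by rewrite /edot big1 // => k _; rewrite mxE mulr0.
rewrite cexp0; congr (_ + _); rewrite mulrC; congr (_ * _); last first.
  by rewrite fmorphV rmorph_nat.
rewrite /cos_sum /sin_sum.
apply/eqP; rewrite eq_complex Re_sum Im_sum /=; apply/andP; split; apply/eqP.
  rewrite [LHS](_ : _ = \sum_j rate j * (cos (edot s (@jump n j)) - 1)); last first.
    by apply: eq_bigr => j _; rewrite expR0; ring.
  rewrite (sum_rate n (fun v => cos (edot s v) - 1)).
  by apply: eq_bigr => k _; apply: eq_bigr => i _; rewrite edotZ_delta.
rewrite [LHS](_ : _ = \sum_j rate j * sin (edot s (@jump n j))); last first.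
  by apply: eq_bigr => j _; rewrite expR0; ring.
rewrite (sum_rate n (fun v => sin (edot s v))).
by apply: eq_bigr => k _; apply: eq_bigr => i _; rewrite edotZ_delta.
Qed.

Lemma Phi_trigE n m s al : Phi n m (trig s al) =
  complex.Re (cexp (0 +i* (al + edot s (drift n))) *
    (1 + (cos_sum n s +i* sin_sum n s) / (steps n m)%:R) ^+ steps n m).
Proof.
rewrite -character_mean.
pose chi (x : V) : R[i] := cexp (0 +i* edot s x).
have chiD x y : chi (x + y) = chi x * chi y.
  rewrite /chi -cexpD; congr cexp; apply/eqP; rewrite eq_complex /= addr0 eqxx /=.
  by apply/eqP; rewrite /edot -big_split; apply: eq_bigr => k _; rewrite mxE mulrDr.
rewrite (_ : cexp (0 +i* (al + edot s (drift n))) = cexp (0 +i* al) * chi (drift n)).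
  rewrite -mulrA [chi _ * _]mulrC.
  rewrite -(@walk_character R[i] V _ (fun j => (@jump_prob n m j)%:C) (@jump n) chi) //.
  rewrite -walkZ walk_Re; apply: eq_walk => x.
  rewrite /trig /chi !cexpE /= !expR0 !mul1r addrC cosD.
  by rewrite mulrC.
by rewrite /chi -cexpD; congr cexp; apply/eqP; rewrite eq_complex /= addr0 !eqxx.
Qed.

Lemma cos_sum_le0 n s : cos_sum n s <= 0.
Proof.
apply: sumr_le0 => k _; apply: sumr_le0 => i _.
by rewrite mulr_ge0_le0 ?weight_ge0 // subr_le0 cos_le1.
Qed.

Lemma Phi_trig_dist n m s al :
  `|Phi n m (trig s al) -
    expR (cos_sum n s) * cos (al + edot s (drift n) + sin_sum n s)| <=
  (2 * cos_sum n s ^+ 2 + 3 * sin_sum n s ^+ 2) / (steps n m)%:R.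
Proof.
rewrite Phi_trigE.
have -> : expR (cos_sum n s) * cos (al + edot s (drift n) + sin_sum n s) =
    complex.Re (cexp (0 +i* (al + edot s (drift n))) * cexp (cos_sum n s +i* sin_sum n s)).
  by rewrite -cexpD cexpE /= add0r.
apply: cexp_approx; first exact: cos_sum_le0.
  by rewrite norm_cexp /= expR0.
rewrite -/(steps n m) -character_mean; apply: le_trans (ler_norm_sum _ _ _) _.
apply: (@le_trans _ _ (\sum_j (@jump_prob n m j)%:C)).
  apply: ler_sum => j _; rewrite normrM norm_cexp expR0 mulr1.
  by rewrite ger0_norm // lecR jump_prob_ge0.
by rewrite -rmorph_sum jump_prob_sum1.
Qed.

Local Close Scope complex_scope.

(** The Levy-Khintchine value of [E cos(<s, X> + al)] for independent coordinates with linear part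
    [m1]; see [Ex_trig]. *)
Definition levy_trig_mean (s : V) (al : R) : R :=
  expR (\sum_k cos_part (nu k) (s 0 k)) *
  cos (\sum_k (s 0 k * m1 0 k + sin_part (nu k) (s 0 k)) + al).

Lemma Phi_trig_cvg s al (e : R) : 0 < e ->
  \forall n \near \oo, \forall m \near \oo,
    `|Phi n m (trig s al) - levy_trig_mean s al| <= e.
Proof.
move=> e0; have e20 : 0 < e / 2 by rewrite divr_gt0.
have cC : cos_sum n s @[n --> \oo] --> \sum_k cos_part (nu k) (s 0 k).
  apply: cvg_finsum => k.
  apply: (@weight_sum_cvg _ _ (nu2 k) (fun u => cos (s 0 k * u) - 1)).
  - apply: (@lipschitz_continuous _ `|s 0 k|) => u v.
    rewrite opprB addrA subrK; apply: le_trans (cos_lip _ _) _.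
    by rewrite -mulrBr normrM.
  - exact: (sqr_ge0 (s 0 k)).
  - exact: cosB1_le_sq.
have cS : al + edot s (drift n) + sin_sum n s @[n --> \oo] -->
    \sum_k (s 0 k * m1 0 k + sin_part (nu k) (s 0 k)) + al.
  rewrite addrC; under eq_fun do rewrite -addrA.
  apply: cvgD; first exact: cvg_cst.
  under eq_fun do rewrite /edot /sin_sum -big_split.
  apply: cvg_finsum => k /=.
  (* The drift compensates the jumps: [sin(su)] becomes [sin(su) - su], quadratic near 0, so the
     sums over cells converge even if [|u|] is not integrable. *)
  rewrite (_ : (fun n => _) = (fun n => s 0 k * m1 0 k +
      \sum_i weight (nu k) i * (sin (s 0 k * @cell_value R n i) - s 0 k * cell_value i))).
    apply: cvgD; first exact: cvg_cst.
    apply: (@weight_sum_cvg _ _ (nu2 k) (fun u => sin (s 0 k * u) - s 0 k * u)).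
    - apply: (@lipschitz_continuous _ (2 * `|s 0 k|)) => u v.
      rewrite (_ : _ - _ = (sin (s 0 k * u) - sin (s 0 k * v)) - s 0 k * (u - v)); last by ring.
      apply: le_trans (ler_normB _ _) _; rewrite normrM -mulrA mulr_natl mulr2n lerD2r.
      by apply: le_trans (sin_lip _ _) _; rewrite -mulrBr normrM.
    - exact: (sqr_ge0 (s 0 k)).
    - exact: sinB_le_sq.
  apply/funext => n; rewrite mxE mulrBr -addrA; congr (_ + _).
  rewrite mulr_sumr -sumrN -big_split; apply: eq_bigr => i _ /=; ring.
have cT : expR (cos_sum n s) * cos (al + edot s (drift n) + sin_sum n s)
    @[n --> \oo] --> levy_trig_mean s al.
  apply: cvgM.
    exact: (continuous_cvg _ (@continuous_expR R _) cC).
  exact: (continuous_cvg _ (@continuous_cos R _) cS).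
have /cvgrPdist_le/(_ _ e20) := cT.
apply: filterS => n hn.
near=> m.
rewrite (_ : Phi n m (trig s al) - levy_trig_mean s al =
  (Phi n m (trig s al) - expR (cos_sum n s) * cos (al + edot s (drift n) + sin_sum n s))
  - (levy_trig_mean s al -
     expR (cos_sum n s) * cos (al + edot s (drift n) + sin_sum n s))); last by ring.
rewrite (splitr e); apply: le_trans (ler_normB _ _) _; apply: lerD => //.
apply: le_trans (Phi_trig_dist _ _ _ _) _.
set B := (X in X / _); rewrite ler_pdivrMr ?steps_gt0 // mulrC -ler_pdivrMr //.
apply: (@le_trans _ _ m%:R); first by near: m; exact: nbhs_infty_ger.
by rewrite ler_nat /steps leqW // leq_addl.
Unshelve. all: by end_near. Qed.

End approximation.

Section bounded_expectation.
Context {dT : measure_display} {T : measurableType dT} {R : realType}.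
Variable P : probability T R.

Lemma bounded_integrable (f : T -> R) (K : R) : measurable_fun setT f ->
  (forall w, `|f w| <= K) -> P.-integrable setT (EFin \o f).
Proof.
move=> mf fK; apply: (integrable_dominated mf fK).
exact: finite_measure_integrable_cst.
Qed.

Lemma Rintegral_cst_prob (c : R) : \int[P]_w c = c.
Proof. by rewrite Rintegral_cst // [X in fine X](probability_setT P) /= mulr1. Qed.

Lemma bounded_Rintegral_le (f : T -> R) (K : R) : measurable_fun setT f ->
  (forall w, `|f w| <= K) -> `|\int[P]_w f w| <= K.
Proof.
move=> mf fK; have fi := bounded_integrable mf fK.
apply: le_trans (le_normr_Rintegral measurableT fi) _.
rewrite -[leRHS]Rintegral_cst_prob; apply: le_Rintegral => //.
- by apply: (@bounded_integrable _ K) => [|w]; [exact: measurableT_comp|rewrite normr_id].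
- exact: finite_measure_integrable_cst.
Qed.

(* Approximates g uniformly by the step functions floor(N g) / N. *)
Lemma factor_through_indicators (U Y : T -> R) (c : R) :
    measurable_fun setT U -> (exists K : R, forall w, `|U w| <= K) ->
    measurable_fun setT Y ->
    (forall A : set R, measurable A ->
       \int[P]_w (U w * \1_A (Y w)) = c * \int[P]_w \1_A (Y w)) ->
  forall g : R -> R, measurable_fun setT g -> (exists K : R, forall u, `|g u| <= K) ->
  \int[P]_w (U w * g (Y w)) = c * \int[P]_w g (Y w).
Proof.
move=> mU [B UB] mY H g mg [K gK].
have B0 : 0 <= B by apply: le_trans (UB point); exact: normr_ge0.
have K0 : 0 <= K by apply: le_trans (gK 0); exact: normr_ge0.
have mgY (q : R -> R) : measurable_fun setT q -> measurable_fun setT (fun w => q (Y w)).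
  by move=> mq; apply: (measurableT_comp mq).
suff D N : `|\int[P]_w (U w * g (Y w)) - c * \int[P]_w g (Y w)| <= (B + `|c|) / N.+1%:R.
  apply/eqP; rewrite -subr_eq0 -normr_le0; apply/ler_addgt0Pl => e e0.
  rewrite addr0; pose N := Num.truncn ((B + `|c|) / e).
  apply: le_trans (D N) _; rewrite ler_pdivrMr // mulrC -ler_pdivrMr //.
  by rewrite ltW // truncnS_gt.
set k : R := N.+1%:R; have k0 : 0 < k by rewrite /k.
clearbody k.
(* Enough intervals of length [1/k] to cover [-K, K]. *)
pose Q := (Num.truncn (2 * K * k)).+1.
pose A (i : 'I_Q) : set R := g @^-1` `[i%:R / k - K, i.+1%:R / k - K[%classic.
have mA i : measurable (A i).
  by rewrite -[A i]setTI; apply: mg => //; exact: measurable_itv.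
pose a (i : 'I_Q) : R := i%:R / k - K.
pose gN (u : R) : R := \sum_i a i * \1_(A i) u.
have mgN : measurable_fun setT gN.
  by apply: measurable_sum => i; apply: measurable_funM.
have gNE u : `|g u - gN u| <= k^-1.
  have /andP[g1 g2] : - K <= g u <= K by rewrite -ler_norml.
  have gk0 : 0 <= (g u + K) * k by apply: mulr_ge0; [lra|exact: ltW].
  have iQ : (Num.truncn ((g u + K) * k) < Q)%N.
    rewrite /Q ltnS; apply: le_truncn; rewrite ler_pM2r //; lra.
  have Aiu i : A i u <-> i = Ordinal iQ.
    rewrite /A /= in_itv /= lerBlDr ltrBrDr ler_pdivrMr // ltr_pdivlMr //.
    split=> [h|->] /=; last exact: truncn_itv.
    by apply: val_inj => /=; apply/esym; exact: truncn_def.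
  rewrite /gN (bigD1 (Ordinal iQ)) //= big1 ?addr0 => [|i ij]; last first.
    by rewrite indicE memNset ?mulr0 // => /Aiu; exact/eqP.
  have Au : A (Ordinal iQ) u by exact/Aiu.
  rewrite indicE mem_set // mulr1 /a.
  move: Au; rewrite /A /= in_itv /= => /andP[h1 h2].
  rewrite ger0_norm ?subr_ge0 //.
  by move: h2; set q := Num.truncn _; rewrite -[q.+1%:R]natr1 mulrDl mul1r; lra.
have ig : P.-integrable setT (EFin \o (fun w => g (Y w))).
  by apply: (@bounded_integrable _ K) => //; exact: mgY.
have igN : P.-integrable setT (EFin \o (fun w => gN (Y w))).
  apply: (@bounded_integrable _ (K + k^-1)) => [|w]; first exact: mgY.
  have := gNE (Y w); have := gK (Y w); rewrite !ler_norml => /andP[? ?] /andP[? ?].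
  by apply/andP; split; lra.
have iUg (q : R -> R) (L : R) : measurable_fun setT q -> (forall u, `|q u| <= L) ->
    P.-integrable setT (EFin \o (fun w => U w * q (Y w))).
  move=> mq qL; apply: (@bounded_integrable _ (B * L)) => [|w].
    by apply: measurable_funM => //; exact: mgY.
  by rewrite normrM; apply: ler_pM.
have gNb u : `|gN u| <= K + k^-1.
  have := gNE u; have := gK u; rewrite !ler_norml => /andP[? ?] /andP[? ?].
  by apply/andP; split; lra.
have EgN : \int[P]_w (U w * gN (Y w)) = c * \int[P]_w gN (Y w).
  have ib (i : 'I_Q) (u : R) : `|a i * \1_(A i) u| <= `|a i|.
    by rewrite normrM ler_piMr // indicE; case: (_ \in _); rewrite ?normr1 ?normr0.
  have mi (i : 'I_Q) : measurable_fun setT (fun u : R => a i * \1_(A i) u).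
    exact: measurable_funM.
  rewrite /gN; under eq_Rintegral do rewrite mulr_sumr.
  rewrite Rintegral_sum => [|i]; last exact: (iUg _ _ (mi i) (ib i)).
  rewrite Rintegral_sum => [|i]; last first.
    by apply: (@bounded_integrable _ `|a i|) => [|w]; [exact: (mgY _ (mi i))|exact: ib].
  rewrite mulr_sumr; apply: eq_bigr => i _.
  under eq_Rintegral do rewrite mulrCA.
  have i1 u : `|\1_(A i) u : R| <= 1.
    by rewrite indicE; case: (_ \in _); rewrite ?normr1 ?normr0.
  have mi1 : measurable_fun setT (\1_(A i) : R -> R) by exact: measurable_indic.
  have ii : P.-integrable setT (EFin \o (fun w => \1_(A i) (Y w) : R)).
    by apply: (@bounded_integrable _ 1) => [|w]; [exact: mgY|exact: i1].
  rewrite (RintegralZl _ measurableT (iUg _ _ mi1 i1)) (RintegralZl _ measurableT ii).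
  by rewrite H // mulrCA.
have -> : \int[P]_w (U w * g (Y w)) - c * \int[P]_w g (Y w) =
    \int[P]_w (U w * (g (Y w) - gN (Y w))) - c * \int[P]_w (g (Y w) - gN (Y w)).
  under [X in _ = X - _]eq_Rintegral do rewrite mulrBr.
  rewrite !RintegralB //; [|exact: (iUg _ _ mg gK)|exact: (iUg _ _ mgN gNb)].
  by rewrite EgN; ring.
apply: le_trans (ler_normB _ _) _; rewrite mulrDl; apply: lerD.
  apply: bounded_Rintegral_le => [|w].
    by apply: measurable_funM => //; apply: measurable_funB; exact: mgY.
  by rewrite normrM; apply: ler_pM.
rewrite normrM ler_wpM2l //; apply: bounded_Rintegral_le => [|w]; last exact: gNE.
by apply: measurable_funB; exact: mgY.
Qed.

End bounded_expectation.

(** * The law of X tested on trigonometric functions *)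

Section law.
Context {dT : measure_display} {T : measurableType dT} {R : realType} {d : nat}.
Local Notation V := 'rV[R]_d.
Variables (P : probability T R) (X : T -> V).
Hypothesis mX : measurable_fun setT X.
Variables (nu : 'I_d -> {measure set R -> \bar R}) (m1 : V).
Hypothesis X_indep : mutually_independent P (fun k w => X w 0 k).
Hypothesis X_char : forall k (s : R),
  \int[P]_w cos (s * X w 0 k) =
    expR (cos_part (nu k) s) * cos (s * m1 0 k + sin_part (nu k) s) /\
  \int[P]_w sin (s * X w 0 k) =
    expR (cos_part (nu k) s) * sin (s * m1 0 k + sin_part (nu k) s).

Definition Ex (psi : V -> R) : R := \int[P]_w psi (X w).

Lemma measurable_compX (psi : V -> R) : measurable_fun setT psi ->
  measurable_fun setT (fun w => psi (X w)).
Proof. by move=> mpsi; apply: (measurableT_comp mpsi). Qed.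

Lemma measurable_coordX k : measurable_fun setT (fun w => X w 0 k).
Proof. exact: (measurable_compX (measurable_coord k)). Qed.

Lemma bounded_mfun_integrable (psi : V -> R) : bounded_mfun psi ->
  P.-integrable setT (EFin \o (fun w => psi (X w))).
Proof.
move=> [mpsi [K psiK]]; apply: (@bounded_integrable _ _ _ _ _ K) => [|w //].
exact: measurable_compX.
Qed.

Lemma Ex_mean : mean Ex.
Proof.
split=> [phi psi bphi bpsi|c psi bpsi|phi psi bphi bpsi le|].
- by rewrite /Ex RintegralD //; exact: bounded_mfun_integrable.
- by rewrite /Ex RintegralZl //; exact: bounded_mfun_integrable.
- by apply: le_Rintegral => //; exact: bounded_mfun_integrable.
- exact: Rintegral_cst_prob.
Qed.

Lemma measurable_indic_prod (A : 'I_d -> set R) (Q : pred 'I_d) :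
  (forall k, measurable (A k)) ->
  measurable_fun setT (fun w => \prod_(k | Q k) \1_(A k) (X w 0 k) : R).
Proof.
move=> mA; rewrite (_ : (fun _ => _) =
  (fun w => \prod_(k <- [seq k <- index_enum 'I_d | Q k]) \1_(A k) (X w 0 k))); last first.
  by apply/funext => w; rewrite big_filter.
apply: measurable_prod => k _.
have mi : measurable_fun setT (\1_(A k) : R -> R) by exact: measurable_indic.
exact: (measurableT_comp mi (measurable_coordX k)).
Qed.

Lemma indic_prod_le1 (A : 'I_d -> set R) (Q : pred 'I_d) w :
  `|\prod_(k | Q k) \1_(A k) (X w 0 k) : R| <= 1.
Proof.
rewrite normr_prod; apply: prodr_ile1 => k _; rewrite normr_ge0 indicE.
by case: (_ \in _); rewrite ?normr1 ?normr0 ?lexx ?ler01.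
Qed.

Definition law_of k (A : set R) : R := fine (P ((fun w => X w 0 k) @^-1` A)).

Lemma law_ofE k (A : set R) : measurable A ->
  \int[P]_w \1_A (X w 0 k) = law_of k A.
Proof.
move=> mA; rewrite /Rintegral /law_of.
have mXA : measurable ((fun w => X w 0 k) @^-1` A).
  by rewrite -[_ @^-1` _]setTI; exact: measurable_coordX.
rewrite -[in RHS](setIT (_ @^-1` A)) -integral_indic //.
Qed.

Lemma law_ofT k : law_of k setT = 1.
Proof. by rewrite /law_of preimage_setT [X in fine X](probability_setT P). Qed.

Lemma mean_indic_prod (A : 'I_d -> set R) : (forall k, measurable (A k)) ->
  \int[P]_w (\prod_k \1_(A k) (X w 0 k)) = \prod_k law_of k (A k).
Proof.
move=> mA.
have mXA k : measurable ((fun w => X w 0 k) @^-1` A k).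
  by rewrite -[_ @^-1` _]setTI; exact: measurable_coordX.
have E w : \prod_k \1_(A k) (X w 0 k) =
    \1_(\bigcap_k ((fun w => X w 0 k) @^-1` A k)) w :> R.
  rewrite indicE; case: (boolP (w \in _)) => [|wA].
    by rewrite inE => wA; rewrite big1 // => k _; rewrite indicE mem_set //; exact: wA.
  have [k Ak] : exists k, ~ A k (X w 0 k).
    apply/existsNP => h; move/negP: wA; apply; rewrite inE => k _; exact: h.
  by rewrite (bigD1 k) //= indicE memNset // mul0r.
under eq_Rintegral do rewrite E.
rewrite /Rintegral integral_indic ?setIT //; last first.
  by apply: fin_bigcap_measurable => // k _; exact: mXA.
rewrite [X in fine X](X_indep mA) (eq_bigr (fun k => (law_of k (A k))%:E)).
  by rewrite prodEFin.
by move=> k _; rewrite /law_of fineK // fin_num_measure.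
Qed.

(** Independence is given for events only. The cosine is built one coordinate at a time: those below
    [j] carry a phase, the others an indicator, and [factor_through_indicators] turns the indicator
    of the next one into a phase. *)
Lemma mean_trig_indic (s : V) (j : nat) : (j <= d)%N ->
  forall (A : 'I_d -> set R) (al : R), (forall k, measurable (A k)) ->
    (forall k : 'I_d, (k < j)%N -> A k = setT) ->
  \int[P]_w (cos (al + \sum_(k < d | (k < j)%N) s 0 k * X w 0 k) *
     \prod_k \1_(A k) (X w 0 k)) =
  expR (\sum_(k < d | (k < j)%N) cos_part (nu k) (s 0 k)) *
  cos (al + \sum_(k < d | (k < j)%N) (s 0 k * m1 0 k + sin_part (nu k) (s 0 k))) *
  \prod_k law_of k (A k).
Proof.
elim: j => [|j IH] jd A al mA AT.
  have z (F : 'I_d -> R) : \sum_(k < d | (k < 0)%N) F k = 0 by rewrite big_pred0.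
  rewrite !z expR0 mul1r addr0.
  under eq_Rintegral do rewrite z addr0.
  rewrite RintegralZl // ?mean_indic_prod //.
  apply: (@bounded_integrable _ _ _ _ _ 1) => [|w]; first exact: measurable_indic_prod.
  exact: indic_prod_le1.
pose k0 := Ordinal jd.
have sumS (F : 'I_d -> R) : \sum_(k < d | (k < j.+1)%N) F k =
    \sum_(k < d | (k < j)%N) F k + F k0.
  rewrite (bigD1 k0) //= addrC; congr (_ + _); apply: eq_bigl => k.
  by rewrite ltnS -val_eqE /= ltn_neqAle andbC.
pose U be w := cos (be + \sum_(k < d | (k < j)%N) s 0 k * X w 0 k) *
  \prod_(k | k != k0) \1_(A k) (X w 0 k).
pose c be := expR (\sum_(k < d | (k < j)%N) cos_part (nu k) (s 0 k)) *
  cos (be + \sum_(k < d | (k < j)%N) (s 0 k * m1 0 k + sin_part (nu k) (s 0 k))) *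
  \prod_(k | k != k0) law_of k (A k).
have mU be : measurable_fun setT (U be).
  apply: measurable_funM; last exact: measurable_indic_prod.
  apply: (measurableT_comp (f := @cos R)).
    by apply: continuous_measurable_fun; exact: continuous_cos.
  apply: measurable_funD => //.
  rewrite (_ : (fun _ => _) =
    (fun w => \sum_(k <- [seq k : 'I_d <- index_enum 'I_d | (k < j)%N]) s 0 k * X w 0 k)).
    apply: measurable_sum => k; apply: measurable_funM => //; exact: measurable_coordX.
  by apply/funext => w; rewrite big_filter.
have U1 be w : `|U be w| <= 1.
  rewrite normrM mulr_ile1 //; first by rewrite ler_norml cos_geN1 cos_le1.
  exact: indic_prod_le1.
have indicU be (B : set R) : measurable B ->
    \int[P]_w (U be w * \1_B (X w 0 k0)) = c be * \int[P]_w \1_B (X w 0 k0).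
  (* Coordinate [k0] still carries an indicator at stage [j], so the induction hypothesis may be
     applied with [B] there. *)
  move=> mB; pose A' k := if k == k0 then B else A k.
  have := IH (ltnW jd) A' be.
  have mA' k : measurable (A' k) by rewrite /A'; case: ifP.
  move=> /(_ mA') H; rewrite law_ofE //.
  transitivity (\int[P]_w (cos (be + \sum_(k < d | (k < j)%N) s 0 k * X w 0 k) *
     \prod_k \1_(A' k) (X w 0 k))).
    apply: eq_Rintegral => w _; rewrite /U (bigD1 k0 isT) //= /A' eqxx.
    rewrite -mulrA [\1_B _ * _]mulrC; congr (_ * (_ * _)).
    by apply: eq_bigr => k /negbTE ->.
  rewrite H => [|k kj]; last first.
    rewrite /A'; case: eqP => [kk0|_]; last by apply: AT; exact: ltnW.
    by move: kj; rewrite kk0 ltnn.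
  rewrite /c -!mulrA; congr (_ * (_ * _)); rewrite (bigD1 k0 isT) //= /A' eqxx mulrC.
  by congr (_ * _); apply: eq_bigr => k /negbTE ->.
have H (g : R -> R) be : measurable_fun setT g -> (exists K : R, forall u, `|g u| <= K) ->
    \int[P]_w (U be w * g (X w 0 k0)) = c be * \int[P]_w g (X w 0 k0).
  move=> mg bg; apply: (@factor_through_indicators _ _ _ P (U be) (fun w => X w 0 k0)) => //.
  - by exists 1 => w; exact: U1.
  - exact: measurable_coordX.
  - exact: indicU.
have bcos (u : R) : `|cos u| <= 1 by rewrite ler_norml cos_geN1 cos_le1.
have bsin (u : R) : `|sin u| <= 1 by rewrite ler_norml sin_geN1 sin_le1.
have Hc be : \int[P]_w (U be w * cos (s 0 k0 * X w 0 k0)) =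
    c be * \int[P]_w cos (s 0 k0 * X w 0 k0).
  apply: (H (fun u => cos (s 0 k0 * u))); first exact: measurable_cosM.
  by exists 1 => u; exact: bcos.
have Hs be : \int[P]_w (U be w * sin (s 0 k0 * X w 0 k0)) =
    c be * \int[P]_w sin (s 0 k0 * X w 0 k0).
  apply: (H (fun u => sin (s 0 k0 * u))); first exact: measurable_sinM.
  by exists 1 => u; exact: bsin.
have iU (g : R -> R) be : measurable_fun setT g -> (forall u, `|g u| <= 1) ->
    P.-integrable setT (EFin \o (fun w => U be w * g (X w 0 k0))).
  move=> mg bg; apply: (@bounded_integrable _ _ _ _ _ 1) => [|w].
    apply: measurable_funM => //.
    exact: (measurableT_comp mg (measurable_coordX k0)).
  by rewrite normrM mulr_ile1.
have sinE (x : R) : sin x = cos (x - pi / 2).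
  by rewrite cosB cos_pihalf sin_pihalf mulr0 add0r mulr1.
have [Xc Xs] := X_char k0 (s 0 k0).
(* Addition formula for the new phase. The sine of the old phase is a cosine with [al] shifted by
   [pi / 2], so the induction can be stated for cosines alone. *)
transitivity (\int[P]_w (U al w * cos (s 0 k0 * X w 0 k0) -
    U (al - pi / 2) w * sin (s 0 k0 * X w 0 k0))).
  apply: eq_Rintegral => w _; rewrite sumS addrA cosD (bigD1 k0 isT) //=.
  rewrite AT //= indicT /U (addrAC al (- _)) -sinE /cst.
  by rewrite mulrBl mul1r mulrAC; congr (_ - _); rewrite mulrAC.
rewrite RintegralB //; [|exact: (iU _ _ (measurable_cosM _) (fun u => bcos _))
  |exact: (iU _ _ (measurable_sinM _) (fun u => bsin _))].
rewrite Hc Hs Xc Xs !sumS expRD [in RHS](bigD1 k0 isT) //= AT //= law_ofT mul1r.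
rewrite addrA (cosD (al + _)) /c (addrAC al (- _)) -sinE; ring.
Qed.

Lemma Ex_trig (s : V) (al : R) : Ex (trig s al) = levy_trig_mean nu m1 s al.
Proof.
have := @mean_trig_indic s d (leqnn d) (fun=> setT) al (fun=> measurableT) (fun _ _ => erefl).
have sT (F : 'I_d -> R) : \sum_(k < d | (k < d)%N) F k = \sum_k F k.
  by apply: eq_bigl => k; rewrite ltn_ord.
have pT : \prod_(k < d) law_of k setT = 1 by apply: big1 => k _; exact: law_ofT.
rewrite !sT pT mulr1.
rewrite /levy_trig_mean addrC => <-; apply: eq_Rintegral => w _.
rewrite /trig sT addrC [X in _ = _ * X]big1 ?mulr1 //.
by move=> k _; rewrite indicT.
Qed.

Hypothesis X2 : forall k, P.-integrable setT (EFin \o (fun w => X w 0 k ^+ 2)).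

Lemma Ex_sq_bounded : sq_bounded (\sum_k \int[P]_w (X w 0 k ^+ 2)) Ex.
Proof.
move=> phi psi c bphi bpsi c0 le; rewrite /Ex -RintegralB //;
  [|exact: bounded_mfun_integrable..].
have isq : P.-integrable setT (EFin \o (fun w => sqnorm (X w))).
  exact: integrable_sumR.
have iB : P.-integrable setT (EFin \o (fun w => phi (X w) - psi (X w))).
  apply: (bounded_mfun_integrable (psi := fun x => phi x - psi x)).
  by apply: bounded_mfunD => //; exact: bounded_mfunN.
apply: le_trans (le_normr_Rintegral measurableT iB) _.
rewrite -Rintegral_sum // -(RintegralZl _ measurableT isq); apply: le_Rintegral => //.
- apply: (@integrable_dominated _ _ _ _ _ (fun w => `|phi (X w) - psi (X w)|)) => //.
  + by apply: measurableT_comp => //; case/integrableP: iB => /measurable_EFinP.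
  + by move=> w; rewrite normr_id.
  + by have := integrable_abse iB.
- rewrite (_ : _ \o _ = (fun w => c%:E * (sqnorm (X w))%:E)%E) //.
  exact: integrableZl.
Qed.

End law.

Section lipschitz_truncation.
Context {R : realType}.
Implicit Types (u v a b c th kap rho : R).

Lemma expR_lip a b c : a <= c -> b <= c ->
  `|expR a - expR b| <= expR c * `|a - b|.
Proof.
wlog ba : a b / b <= a.
  move=> H ac bc; case: (leP b a) => [/H|/ltW/H]; first exact.
  by rewrite distrC (distrC b a); apply.
move=> ac _; rewrite !ger0_norm ?subr_ge0 ?ler_expR //.
apply: le_trans (expRB_le _ _) _.
by rewrite ler_wpM2r ?subr_ge0 // ler_expR.
Qed.

Lemma min_lip a b c : `|Num.min a c - Num.min b c| <= `|a - b|.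
Proof.
have h1 := ler_norm (a - b); have h0 := normr_ge0 (a - b).
have h2 : b - a <= `|a - b| by rewrite distrC ler_norm.
by rewrite ler_norml !minEle; apply/andP; split; case: (leP a c); case: (leP b c); lra.
Qed.

Lemma max_lip a b c : `|Num.max a c - Num.max b c| <= `|a - b|.
Proof.
have h1 := ler_norm (a - b); have h0 := normr_ge0 (a - b).
have h2 : b - a <= `|a - b| by rewrite distrC ler_norm.
by rewrite ler_norml !maxEle; apply/andP; split; case: (leP a c); case: (leP b c); lra.
Qed.

(** A bounded Lipschitz truncation of [exp(th |u|)], to which weak convergence applies; it increases
    to [exp(th |u|)] with [kap]. *)
Definition texp (th kap u : R) : R := expR (th * Num.min `|u| kap).

Lemma texp_lip th kap u v : 0 <= th ->
  `|texp th kap u - texp th kap v| <= expR (th * kap) * th * `|u - v|.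
Proof.
move=> th0; apply: le_trans (expR_lip (c := th * kap) _ _) _;
  try by rewrite ler_wpM2l // ge_min lexx orbT.
rewrite -mulrA ler_wpM2l ?expR_ge0 // -mulrBr normrM ger0_norm // ler_wpM2l //.
apply: le_trans (min_lip _ _ _) _; exact: ler_dist_dist.
Qed.

Lemma texp_ge0 th kap u : 0 <= texp th kap u.
Proof. exact: expR_ge0. Qed.

Lemma texp_le th kap u : 0 <= th -> texp th kap u <= expR (th * kap).
Proof. by move=> th0; rewrite ler_expR ler_wpM2l // ge_min lexx orbT. Qed.

Lemma texp_le_exp th kap u : 0 <= th -> texp th kap u <= expR (th * `|u|).
Proof. by move=> th0; rewrite ler_expR ler_wpM2l // ge_min lexx. Qed.

(** [|v| <= |u + v| + |u|]: displacing a jump [v] by [u] loses at most the factor [exp(-th |u|)]. *)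
Lemma texpD th kap u v : 0 <= th ->
  expR (- th * `|u|) * texp th kap v <= texp th kap (u + v).
Proof.
move=> th0; rewrite -expRD ler_expR mulNr -mulrN -mulrDr ler_wpM2l //.
have h : `|v| <= `|u + v| + `|u|.
  by rewrite -{1}(addKr u v) addrC (le_trans (ler_normB _ _)).
by have := normr_ge0 u; rewrite !minEle; case: (leP `|v| kap); case: (leP `|u + v| kap); lra.
Qed.

(** A Lipschitz stand-in for the indicator of [|u| > rho], so that weighted sums over the cells
    converge. *)
Definition ramp (rho u : R) : R := Num.min (Num.max (`|u| - rho) 0) 1.

Lemma ramp_lip rho u v : `|ramp rho u - ramp rho v| <= `|u - v|.
Proof.
apply: le_trans (min_lip _ _ _) _; apply: le_trans (max_lip _ _ _) _.
by rewrite opprB addrA subrK; exact: ler_dist_dist.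
Qed.

Lemma ramp_ge0 rho u : 0 <= ramp rho u.
Proof. by rewrite /ramp le_min le_max lexx orbT ler01. Qed.

Lemma ramp_le1 rho u : ramp rho u <= 1.
Proof. by rewrite /ramp ge_min lexx orbT. Qed.

Lemma ramp_eq0 rho u : `|u| <= rho -> ramp rho u = 0.
Proof. by move=> h; rewrite /ramp max_r ?subr_le0 // min_l. Qed.

Lemma ramp_eq1 rho u : rho + 1 <= `|u| -> ramp rho u = 1.
Proof.
by move=> h; rewrite /ramp max_l ?min_r // ?lerBrDr 1?addrC //; lra.
Qed.

End lipschitz_truncation.

Section weak_convergence.
Context {dT : measure_display} {T : measurableType dT} {R : realType} {d : nat}.
Local Notation V := 'rV[R]_d.
Variables (P : probability T R) (X : T -> V).
Hypothesis mX : measurable_fun setT X.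
Variables (nu : 'I_d -> {measure set R -> \bar R}) (m1 : V).
Hypothesis X_indep : mutually_independent P (fun k w => X w 0 k).
Hypothesis X2 : forall k, P.-integrable setT (EFin \o (fun w => X w 0 k ^+ 2)).
Hypothesis nu2 : forall k, (nu k).-integrable setT (EFin \o (fun u : R => u ^+ 2)).
Hypothesis X_char : forall k (s : R),
  \int[P]_w cos (s * X w 0 k) =
    expR (cos_part (nu k) s) * cos (s * m1 0 k + sin_part (nu k) s) /\
  \int[P]_w sin (s * X w 0 k) =
    expR (cos_part (nu k) s) * sin (s * m1 0 k + sin_part (nu k) s).

Local Notation Psi := (Phi nu m1).
Local Notation Ex := (Ex P X).

Lemma sq_boundedW (C C' : R) (E : (V -> R) -> R) : C <= C' ->
  sq_bounded C E -> sq_bounded C' E.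
Proof.
move=> CC' H phi psi c bphi bpsi c0 le; apply: le_trans (H _ _ _ bphi bpsi c0 le) _.
by rewrite ler_wpM2l.
Qed.

Lemma weak_convergence (A : R) (psi : V -> R) : 0 <= A ->
    (exists K : R, forall x, `|psi x| <= K) -> l1_lipschitz A psi ->
  converges Psi Ex psi.
Proof.
pose EX2 : R := \sum_k \int[P]_w (X w 0 k ^+ 2).
have EX20 : 0 <= EX2.
  by apply: sumr_ge0 => k _; apply: Rintegral_ge0 => w _; exact: sqr_ge0.
have sq0 := sq_const_ge0 nu m1.
apply: (@converges_lipschitz _ _ _ _ (sq_const nu m1 + EX2)).
- exact: Phi_mean.
- exact: Ex_mean.
- by move=> n m; apply: sq_boundedW (Phi_sq_bounded _ _ _ _); rewrite ?lerDl.
- by apply: sq_boundedW (Ex_sq_bounded _ _); rewrite ?lerDr.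
- exact: addr_ge0.
- move=> s al e e0; rewrite (Ex_trig mX X_indep X_char); exact: Phi_trig_cvg.
Qed.

(* Dropping one of the N steps changes the mean by O(1/N). *)
Lemma Phi_pred n m (psi : V -> R) (K : R) : (forall x, `|psi x| <= K) ->
  `|Psi n m psi - walk (@jump_prob R d nu n m) (@jump R d n) (steps nu n m).-1 psi (drift nu m1 n)|
  <= 2 * K * total nu n / (steps nu n m)%:R.
Proof.
move=> psiK; rewrite /Phi /steps -pred_Sn walkS.
set N := (_ + _)%N.
have p0 := @jump_prob_ge0 R d nu n m.
have p1 := @jump_prob_sum1 R d nu n m.
apply: le_trans; first exact: walk_normB.
rewrite -[leRHS](walk_cst (v := @jump R d n) p1 N _ (drift nu m1 n)).
apply: le_walk => // x; rewrite /step.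
rewrite (sum_jump_probR _ _ (fun j => psi (x + jump j))) /= addr0 addrC addKr.
rewrite mulrC normrM [`|_^-1|]ger0_norm ?invr_ge0 // ler_wpM2r ?invr_ge0 //.
apply: le_trans (ler_norm_sum _ _ _) _; rewrite /total mulr_sumr.
apply: ler_sum => j _; rewrite normrM (ger0_norm (rate_ge0 _ _)) mulrC.
rewrite ler_wpM2r ?rate_ge0 //; apply: le_trans (ler_normB _ _) _.
by rewrite mulr_natl mulr2n lerD.
Qed.

Lemma near_steps n (B e : R) : 0 < e ->
  \forall m \near \oo, B / (steps nu n m)%:R <= e.
Proof.
move=> e0; near=> m.
rewrite ler_pdivrMr ?steps_gt0 // mulrC -ler_pdivrMr //.
apply: (@le_trans _ _ m%:R); first by near: m; exact: nbhs_infty_ger.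
by rewrite ler_nat /steps leqW // leq_addl.
Unshelve. all: by end_near. Qed.

(** * Exponential moments of the Levy measure from those of a coordinate *)

Section one_big_jump.
Variables (k : 'I_d) (th : R).
Hypothesis th_ge0 : 0 <= th.

Let V2 : R := \int[nu k]_u u ^+ 2.
(** By Chebyshev's inequality the expected number of jumps beyond [rho] along [e_k] is at most
    [V2 / rho^2 <= 1/4], and the walk ends outside [|x_k| <= rad] with probability at most
    [sq_const / rad^2 <= 1/4]. *)
Let rho : R := 1 + 4 * V2.
Let rad : R := 1 + 4 * sq_const nu m1.

Let V2_ge0 : 0 <= V2.
Proof. by apply: Rintegral_ge0 => u _; exact: sqr_ge0. Qed.

Let rho_ge1 : 1 <= rho.
Proof. by rewrite lerDl mulr_ge0. Qed.

Let rad_ge1 : 1 <= rad.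
Proof. by rewrite lerDl mulr_ge0 // sq_const_ge0. Qed.

Definition big_jump n (j : @jump_index d n) : bool :=
  if j is inl ki then (ki.1 == k) && (rho < `|@cell_value R n ki.2|) else false.

Definition big_prob n m (j : @jump_index d n) : R :=
  if big_jump j then @jump_prob R d nu n m j else 0.
Definition small_prob n m (j : @jump_index d n) : R :=
  if big_jump j then 0 else @jump_prob R d nu n m j.

Lemma big_prob_ge0 n m (j : @jump_index d n) : 0 <= big_prob m j.
Proof. by rewrite /big_prob; case: ifP => // _; exact: jump_prob_ge0. Qed.

Lemma small_prob_ge0 n m (j : @jump_index d n) : 0 <= small_prob m j.
Proof. by rewrite /small_prob; case: ifP => // _; exact: jump_prob_ge0. Qed.

Lemma small_big_prob n m :
  (fun j => small_prob m j + big_prob m j) = @jump_prob R d nu n m.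
Proof.
apply/funext => j; rewrite /small_prob /big_prob.
by case: ifP => _; rewrite ?add0r ?addr0.
Qed.

Lemma small_big_prob_sum n m : \sum_j (@small_prob n m j + big_prob m j) = 1.
Proof.
by rewrite -(jump_prob_sum1 nu n m) -small_big_prob.
Qed.

Lemma big_prob_sum n m (g : V -> R) :
  (steps nu n m)%:R * (\sum_j big_prob m j * g (@jump R d n j)) =
  \sum_i (if rho < `|@cell_value R n i| then
    weight (nu k) i * g (@cell_value R n i *: delta_mx 0 k) else 0).
Proof.
rewrite big_sumType /= sum_unit mul0r addr0.
rewrite -(pair_bigA _ (fun l i => big_prob m (inl (l, i)) * g (cell_value i *: delta_mx 0 l))) /=.
rewrite (bigD1 k) //= [X in _ + X]big1 ?addr0 => [|l /negbTE lk]; last first.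
  by apply: big1 => i _; rewrite /big_prob /= lk mul0r.
rewrite mulr_sumr; apply: eq_bigr => i _; rewrite /big_prob /= eqxx /=.
case: ifP => _; last by rewrite mul0r mulr0.
by rewrite mulrA [_ * (_ / _)]mulrC divfK // gt_eqF ?steps_gt0.
Qed.

Lemma big_prob_total n m : (steps nu n m)%:R * (\sum_j @big_prob n m j) <= 1 / 4.
Proof.
under eq_bigr do rewrite -[big_prob _ _]mulr1.
rewrite (big_prob_sum n m (fun=> 1)).
have r2 : 0 < rho ^+ 2 by rewrite exprn_gt0 // (lt_le_trans ltr01).
apply: (@le_trans _ _ (\sum_i weight (nu k) i * @cell_value R n i ^+ 2 / rho ^+ 2)).
  apply: ler_sum => i _; case: ifP => h; last first.
    by rewrite mulr_ge0 ?invr_ge0 ?(ltW r2) // mulr_ge0 ?weight_ge0 ?sqr_ge0.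
  rewrite -mulrA ler_wpM2l ?weight_ge0 // ler_pdivlMr // mul1r ler_sqr_norm //.
  by rewrite ger0_norm ?(le_trans ler01) // ltW.
rewrite -mulr_suml ler_pdivrMr //; apply: le_trans (weight_sum_sq_le (nu2 k) n) _.
rewrite -/V2; have := V2_ge0; have := rho_ge1; rewrite /rho => h1 h2; nra.
Qed.

Let near0 (x : V) : R := (`|x 0 k| <= rad)%R%:R.

Lemma Phi_near0_ge n m : 3 / 4 <= Psi n m near0.
Proof.
have r2 : 0 < rad ^+ 2 by rewrite exprn_gt0 // (lt_le_trans ltr01).
apply: (@le_trans _ _ (Psi n m (fun x => 1 + (- (rad ^+ 2)^-1) * x 0 k ^+ 2))).
  rewrite /Phi walkD walk_cst ?jump_prob_sum1 // walkZ mulNr.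
  have := Phi_coord_sq m1 nu2 n m k.
  have : m1 0 k ^+ 2 + \int[nu k]_u u ^+ 2 <= sq_const nu m1.
    rewrite /sq_const [leRHS](bigD1 k) //= lerDl sumr_ge0 // => l _.
    apply: addr_ge0; first exact: sqr_ge0.
    by apply: Rintegral_ge0 => u _; exact: sqr_ge0.
  rewrite /Phi; set W := walk _ _ _ _ _ => h1 h2.
  suff : (rad ^+ 2)^-1 * W <= 1 / 4 by lra.
  rewrite mulrC ler_pdivrMr //; have := rad_ge1; rewrite /rad.
  have := sq_const_ge0 nu m1; nra.
apply: le_walk => [j|x]; first exact: jump_prob_ge0.
rewrite /near0; case: (leP `|x 0 k| rad) => h /=; rewrite mulNr.
  by rewrite gerBl mulr_ge0 ?invr_ge0 ?sqr_ge0 // ltW.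
rewrite subr_le0 mulrC ler_pdivlMr // mul1r ler_sqr_norm // ger0_norm ?(le_trans ler01) //.
exact: ltW.
Qed.

(** A path with one jump [v] beyond [rho] along [e_k], whose other steps end in [|x_k| <= rad],
    contributes at least [exp(-th rad)] times [texp] at [v]. The other steps do so with probability
    at least 1/4, whence the factor 4. *)
Lemma weight_texp_le n kap : \forall m \near \oo,
  \sum_i weight (nu k) i * (ramp rho (@cell_value R n i) * texp th kap (@cell_value R n i))
  <= 4 * expR (th * rad) * Psi n m (fun x => texp th kap (x 0 k)).
Proof.
have e8 : 0 < 1 / 8 :> R by lra.
apply: filterS (near_steps n (2 * 1 * total nu n) e8) => m hm.
set c := drift nu m1 n; set N' := (steps nu n m).-1.
have NE : steps nu n m = N'.+1 by [].
have near01 x : 0 <= near0 x <= 1 by rewrite /near0; case: (leP `|x 0 k| rad); rewrite /= ?lexx ?ler01.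
have near1 x : `|near0 x| <= 1.
  by case/andP: (near01 x) => h1 h2; rewrite ger0_norm.
(* 3/4 for the full walk, minus 1/8 for the dropped step, minus 1/4 for the big jumps. *)
have q4 : 1 / 4 <= walk (@small_prob n m) (@jump R d n) N' near0 c.
  have := @walk_kill R V _ (@small_prob n m) (@big_prob n m) (@jump R d n) N' near0 c
    (@small_prob_ge0 n m) (@big_prob_ge0 n m).
  move=> /(_ (small_big_prob_sum n m) near01); rewrite small_big_prob.
  apply: le_trans.
  have h1 := big_prob_total n m.
  have h2 : N'%:R * (\sum_j @big_prob n m j) <= (steps nu n m)%:R * (\sum_j @big_prob n m j).
    by rewrite ler_wpM2r ?sumr_ge0 // ?ler_nat // => j _; exact: big_prob_ge0.
  have := Phi_pred n m near1; move=> /le_trans/(_ hm).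
  rewrite -/N' ler_norml => /andP[_ h3].
  have := Phi_near0_ge n m; move: h3 h1 h2; rewrite -/c.
  move: (walk _ _ _ _ _) (Phi _ _ _ _ _) => x1 x2.
  move: (N'%:R * _) (_%:R * _) => x3 x4.
  lra.
rewrite [in leRHS]/Phi NE -small_big_prob.
set psi := fun x : V => _.
have psi0 y : 0 <= psi y by rewrite texp_ge0.
have := @walk_one_jump R V _ (@small_prob n m) (@big_prob n m) (@jump R d n) N' psi c
  (@small_prob_ge0 n m) (@big_prob_ge0 n m) psi0.
rewrite -NE => H; apply: le_trans (ler_wpM2l _ H); last by rewrite mulr_ge0 // expR_ge0.
rewrite (big_prob_sum n m (fun v => walk (@small_prob n m) (@jump R d n) N' psi (c + v))).
rewrite mulr_sumr; apply: ler_sum => i _; case: (ltP rho `|cell_value i|) => h; last first.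
  by rewrite ramp_eq0 // mul0r mulr0 mulr0.
rewrite [leRHS]mulrCA ler_wpM2l ?weight_ge0 //.
set v := cell_value i *: _.
apply: (@le_trans _ _ (texp th kap (cell_value i))).
  by rewrite ler_piMl ?ramp_le1 // texp_ge0.
rewrite -walk_shift.
apply: (@le_trans _ _ (4 * expR (th * rad) *
  walk (@small_prob n m) (@jump R d n) N'
   (fun x => (expR (- (th * rad)) * texp th kap (cell_value i)) * near0 x) c)); last first.
  rewrite ler_wpM2l ?mulr_ge0 ?expR_ge0 //; apply: le_walk => [j|x].
    exact: small_prob_ge0.
  rewrite /psi !mxE !eqxx mulr1 /near0; case: (leP `|x 0 k| rad) => hx; last first.
    by rewrite mulr0 texp_ge0.
  rewrite mulr1; apply: le_trans (texpD _ _ _ th_ge0).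
  by rewrite ler_wpM2r ?texp_ge0 // ler_expR mulNr lerN2 ler_wpM2l.
rewrite walkZ !mulrA -(mulrA 4) expRxMexpNx_1 mulr1 mulrAC.
rewrite -[leLHS]mul1r ler_wpM2r ?texp_ge0 //.
by move: q4; set x := walk _ _ _ _ _; lra.
Qed.

Hypothesis X_exp : (\int[P]_w (expR (th * `|X w 0%R k|))%:E < +oo)%E.

Let texp_coord_lip kap : l1_lipschitz (expR (th * kap) * th) (fun x : V => texp th kap (x 0 k)).
Proof.
move=> x y; apply: le_trans (texp_lip _ _ _ th_ge0) _.
rewrite ler_wpM2l ?mulr_ge0 ?expR_ge0 // /l1norm (bigD1 k) //= !mxE lerDl.
exact: sumr_ge0.
Qed.

Let ramp_texp_le kap (u : R) :
  `|ramp rho u * texp th kap u| <= expR (th * kap) * u ^+ 2.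
Proof.
rewrite normrM [`|texp _ _ _|]ger0_norm ?texp_ge0 // mulrC.
apply: ler_pM => //; first by rewrite texp_ge0.
  exact: texp_le.
case: (leP `|u| 1) => u1; last first.
  rewrite ger0_norm ?ramp_ge0 //; apply: le_trans (ramp_le1 _ _) _.
  by rewrite -(expr1n _ 2) ler_sqr_norm // normr1 ltW.
by rewrite ramp_eq0 ?normr0 ?sqr_ge0 // (le_trans u1).
Qed.

(** Independent of the truncation level [kap]; the [+ 1] is the tolerance at which weak convergence
    is used. *)
Let exp_bound : R := 4 * expR (th * rad) * (\int[P]_w expR (th * `|X w 0 k|) + 1).

Lemma Rintegral_texp_le (kap : R) : 0 <= kap ->
  \int[nu k]_u (ramp rho u * texp th kap u) <= exp_bound.
Proof.
move=> kap0.
have B0 : 0 <= expR (th * kap) by exact: expR_ge0.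
have tb (x : V) : `|texp th kap (x 0 k)| <= expR (th * kap).
  by rewrite ger0_norm ?texp_le // texp_ge0.
have wc := @weak_convergence (expR (th * kap) * th)
  (fun x : V => texp th kap (x 0 k)) (mulr_ge0 B0 th_ge0)
  (ex_intro _ _ tb) (texp_coord_lip kap) 1 ltr01.
have iexp : P.-integrable setT (EFin \o (fun w => expR (th * `|X w 0 k|))).
  apply: integrable_ge0 => //.
  apply: (measurableT_comp (f := @expR R)) => //.
  apply: measurable_funM => //; apply: measurableT_comp => //.
  exact: measurable_coordX.
have le_exp : Ex (fun x => texp th kap (x 0 k)) <= \int[P]_w expR (th * `|X w 0 k|).
  apply: le_Rintegral => //; last by move=> w _; exact: texp_le_exp.
  apply: (@bounded_mfun_integrable _ _ _ _ P X mX (fun x : V => texp th kap (x 0 k))).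
  by split; [exact: measurable_lipschitz (texp_coord_lip kap)|exists (expR (th * kap))].
have qc : continuous (fun u => ramp rho u * texp th kap u).
  apply: (@lipschitz_continuous _ (expR (th * kap) * th + expR (th * kap))) => u v.
  rewrite (_ : _ - _ = ramp rho u * (texp th kap u - texp th kap v) +
    (ramp rho u - ramp rho v) * texp th kap v); last by ring.
  apply: le_trans (ler_normD _ _) _; rewrite !normrM mulrDl; apply: lerD.
    apply: le_trans (texp_lip _ _ _ th_ge0); rewrite ler_piMl //.
    by rewrite ger0_norm ?ramp_ge0 // ramp_le1.
  rewrite mulrC; apply: ler_pM => //; last exact: ramp_lip.
  by rewrite ger0_norm ?texp_le // texp_ge0.
have q_cvg := weight_sum_cvg (nu2 k) qc B0 (ramp_texp_le kap).
rewrite -(cvg_lim _ q_cvg) //; apply: limr_le; first by apply: cvgP; exact: q_cvg.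
apply: filterS wc => n hn.
have [m [h1 h2]] := filter_ex (filterI hn (weight_texp_le n kap)).
apply: le_trans h2 _; rewrite /exp_bound ler_wpM2l ?mulr_ge0 ?expR_ge0 //.
move: h1; rewrite ler_norml => /andP[_]; rewrite lerBlDr addrC => /le_trans; apply.
by rewrite lerD2r.
Qed.

(** Fatou's lemma along the truncation levels [kap = n], all bounded by [exp_bound]. *)
Lemma levy_exp_moment : exists r : R,
  (nu k).-integrable setT (EFin \o (fun u => ramp r u * expR (th * `|u|))).
Proof.
exists rho.
have mramp : measurable_fun setT (ramp rho).
  apply: continuous_measurable_fun; apply: (@lipschitz_continuous _ 1) => u v.
  by rewrite mul1r ramp_lip.
have mexp : measurable_fun setT (fun u : R => expR (th * `|u|)).
  apply: (measurableT_comp (f := @expR R)) => //.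
  by apply: measurable_funM => //; exact: measurableT_comp.
have mtexp kap : measurable_fun setT (texp th kap).
  apply: continuous_measurable_fun.
  by apply: (@lipschitz_continuous _ (expR (th * kap) * th)) => u v; exact: texp_lip.
apply: integrable_ge0.
- exact: measurable_funM.
- by move=> u; rewrite mulr_ge0 ?ramp_ge0 ?expR_ge0.
apply: (@le_lt_trans _ _ exp_bound%:E); last by rewrite ltry.
apply: (@fatou_le _ _ _ (nu k) (fun n u => ramp rho u * texp th n%:R u)
  (fun u => ramp rho u * expR (th * `|u|))).
- by move=> n; exact: measurable_funM.
- by move=> n u; rewrite mulr_ge0 ?ramp_ge0 // texp_ge0.
- move=> u; apply: cvg_near_cst; near=> n.
  by rewrite /texp min_l //; near: n; exact: nbhs_infty_ger.
apply: nearW => n; rewrite -[leLHS]fineK.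
  by rewrite lee_fin; exact: Rintegral_texp_le.
apply: integrable_fin_num => //.
apply: (@integrable_dominated _ _ _ _ _ (fun u : R => expR (th * n%:R) * u ^+ 2)).
- exact: measurable_funM.
- by move=> u; exact: ramp_texp_le.
- rewrite (_ : _ \o _ = (fun u => (expR (th * n%:R))%:E * (u ^+ 2)%:E)%E) //.
  exact: integrableZl.
Unshelve. all: by end_near. Qed.

End one_big_jump.

End weak_convergence.

(** * The covariance inequality *)

Section euclidean_norm.
Context {R : realType} {d : nat}.
Implicit Types (x y : 'rV[R]_d).

Lemma sum_cauchy_schwarz (I : finType) (F G : I -> R) :
  (\sum_i F i * G i) ^+ 2 <= (\sum_i F i ^+ 2) * (\sum_i G i ^+ 2).
Proof.
set A := \sum_i F i ^+ 2; set B := \sum_i F i * G i; set C := \sum_i G i ^+ 2.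
have A0 : 0 <= A by apply: sumr_ge0 => i _; exact: sqr_ge0.
have [A_eq0|A_neq0] := eqVneq A 0.
  have F0 i : F i = 0.
    apply/eqP; rewrite -sqrf_eq0; move/eqP: A_eq0; rewrite psumr_eq0.
      by move/allP/(_ i); rewrite mem_index_enum => /(_ isT).
    by move=> j _; exact: sqr_ge0.
  have -> : B = 0 by apply: big1 => i _; rewrite F0 mul0r.
  by rewrite A_eq0 mul0r expr0n.
have A_gt0 : 0 < A by rewrite lt_def A_neq0.
have : 0 <= \sum_i (B / A * F i - G i) ^+ 2.
  by apply: sumr_ge0 => i _; exact: sqr_ge0.
rewrite (_ : \sum_i _ = C - B ^+ 2 / A).
  by rewrite subr_ge0 ler_pdivrMr // mulrC.
transitivity ((B / A) ^+ 2 * A - 2 * (B / A) * B + C); last by field.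
rewrite /A /B /C !mulr_sumr -sumrB -big_split; apply: eq_bigr => i _ /=.
rewrite -/A -/B; ring.
Qed.

Lemma sum_normalized_le (I : finType) (F G H : I -> R) :
    (forall i, 0 <= F i) -> (forall i, 0 <= G i <= H i) -> \sum_i F i ^+ 2 <= 1 ->
  \sum_i F i * G i <= Num.sqrt (\sum_i H i ^+ 2).
Proof.
move=> F0 GH F1.
have S0 : 0 <= \sum_i F i * G i.
  by apply: sumr_ge0 => i _; rewrite mulr_ge0 //; case/andP: (GH i).
rewrite -(ger0_norm S0) -sqrtr_sqr ler_wsqrtr //.
apply: le_trans (sum_cauchy_schwarz _ _) _.
apply: le_trans (ler_wpM2r _ F1) _; first by apply: sumr_ge0 => i _; exact: sqr_ge0.
rewrite mul1r; apply: ler_sum => i _; case/andP: (GH i) => h1 h2.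
by rewrite ler_sqr ?nnegrE // (le_trans h1).
Qed.

Lemma edot_ge0 x : 0 <= edot x x.
Proof. by apply: sumr_ge0 => k _; rewrite -expr2 sqr_ge0. Qed.

Lemma enorm_ge0 x : 0 <= enorm x.
Proof. exact: sqrtr_ge0. Qed.

Lemma enorm_sqr x : enorm x ^+ 2 = sqnorm x.
Proof.
by rewrite sqr_sqrtr ?edot_ge0 //; apply: eq_bigr => k _; rewrite expr2.
Qed.

Lemma normr_coord_le x k : `|x 0 k| <= enorm x.
Proof.
rewrite -sqrtr_sqr ler_wsqrtr // /edot (bigD1 k) //= expr2 lerDl.
by apply: sumr_ge0 => l _; rewrite -expr2 sqr_ge0.
Qed.

Lemma enorm_le_l1norm x : enorm x <= l1norm x.
Proof.
rewrite -(ger0_norm (l1norm_ge0 x)) -sqrtr_sqr ler_wsqrtr // expr2 /edot.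
rewrite {1}/l1norm mulr_suml; apply: ler_sum => k _.
rewrite -expr2 -real_normK ?num_real // expr2 ler_wpM2l //.
by rewrite /l1norm (bigD1 k) //= lerDl sumr_ge0.
Qed.

Lemma enormN x : enorm (- x) = enorm x.
Proof. by rewrite /enorm /edot; congr Num.sqrt; apply: eq_bigr => k _; rewrite !mxE mulrNN. Qed.

Lemma enormD x y : enorm (x + y) <= enorm x + enorm y.
Proof.
have nn : 0 <= enorm x + enorm y by rewrite addr_ge0 ?enorm_ge0.
rewrite -(ler_sqr (enorm_ge0 _)) ?nnegrE // sqrrD !enorm_sqr /sqnorm.
have -> : \sum_k (x + y) 0 k ^+ 2 =
    \sum_k x 0 k ^+ 2 + (\sum_k x 0 k * y 0 k) *+ 2 + \sum_k y 0 k ^+ 2.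
  rewrite -sumrMnl -!big_split; apply: eq_bigr => k _.
  by rewrite mxE sqrrD.
rewrite lerD2r lerD2l lerMn2r /=; apply: le_trans (ler_norm _) _.
rewrite -(ger0_norm (mulr_ge0 (enorm_ge0 x) (enorm_ge0 y))).
rewrite -ler_sqr ?nnegrE // !real_normK ?num_real // exprMn !enorm_sqr.
exact: sum_cauchy_schwarz.
Qed.

Lemma enorm_dist x y : `|enorm x - enorm y| <= enorm (x - y).
Proof.
have h1 := enormD (x - y) y; have h2 := enormD (y - x) x.
rewrite !subrK in h1 h2; rewrite -(enormN (y - x)) opprB in h2.
by rewrite ler_norml; apply/andP; split; lra.
Qed.

Lemma enorm_add_coord x (u : R) k :
  enorm (x + u *: delta_mx 0 k) ^+ 2 = enorm x ^+ 2 + 2 * u * x 0 k + u ^+ 2.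
Proof.
rewrite !enorm_sqr /sqnorm (bigD1 k) //= [in RHS](bigD1 k) //= !mxE !eqxx mulr1.
under eq_bigr => l /negbTE lk do rewrite !mxE lk andbF mulr0 addr0.
ring.
Qed.

(** Let [N], [N'] be the two norms. If [N + N' <= eps] both excesses vanish. Otherwise
    [|N' - N| = |N'^2 - N^2| / (N + N')], where [N + N'] is bounded below by [N] in the linear term
    and by [eps] in the quadratic one. *)
Lemma excess_norm_diff (eps : R) x (u : R) k : 0 < eps ->
  `|Num.max (enorm (x + u *: delta_mx 0 k) - eps) 0 - Num.max (enorm x - eps) 0|
  <= 2 * (`|x 0 k| / enorm x) * `|u| + u ^+ 2 / eps.
Proof.
move=> eps0; have := enorm_add_coord x u k.
have := normr_coord_le x k; have := enorm_ge0 x.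
have := enorm_ge0 (x + u *: delta_mx 0 k).
move: (enorm x) (enorm _) => N N' N'0 N0 xN sq.
have rhs0 : 0 <= 2 * (`|x 0 k| / N) * `|u| + u ^+ 2 / eps.
  apply: addr_ge0; first by rewrite !mulr_ge0 ?invr_ge0.
  by rewrite mulr_ge0 ?sqr_ge0 ?invr_ge0 ?(ltW eps0).
have [small|large] := leP (N + N') eps.
  by rewrite !max_r ?subrr ?normr0 //; lra.
apply: le_trans (max_lip _ _ _) _; rewrite opprB addrA subrK.
have S0 : 0 < N + N' by exact: lt_trans large.
have {sq} sq : `|N' - N| * (N + N') <= 2 * `|x 0 k| * `|u| + u ^+ 2.
  rewrite -{1}(ger0_norm (ltW S0)) -normrM.
  rewrite (_ : (N' - N) * _ = 2 * u * x 0 k + u ^+ 2); last first.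
    by transitivity (N' ^+ 2 - N ^+ 2); [ring|rewrite sq; ring].
  apply: le_trans (ler_normD _ _) _.
  by rewrite [`|u ^+ 2|]ger0_norm ?sqr_ge0 // !normrM normr_nat mulrAC.
rewrite -ler_pdivlMr // in sq; apply: le_trans sq _; rewrite mulrDl; apply: lerD.
  (* At [N = 0] the quotient by the norm is 0 by convention, and [x_k] vanishes as well. *)
  have [N_eq0|N_neq0] := eqVneq N 0.
    have -> : x 0 k = 0 by apply/eqP; rewrite -normr_le0 -N_eq0.
    by rewrite normr0 !(mulr0, mul0r).
  have N_gt0 : 0 < N by rewrite lt_def N_neq0.
  rewrite [leRHS](_ : _ = 2 * `|x 0 k| * `|u| / N); last by ring.
  by rewrite ler_wpM2l ?mulr_ge0 // lef_pV2 ?posrE // lerDl.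
by rewrite ler_wpM2l ?sqr_ge0 // lef_pV2 ?posrE // ltW.
Qed.

Lemma sum_direction_sqr x : \sum_k (`|x 0 k| / enorm x) ^+ 2 <= 1.
Proof.
under eq_bigr do rewrite expr_div_n real_normK ?num_real //.
rewrite -mulr_suml -/(sqnorm x) -enorm_sqr.
have [->|n0] := eqVneq (enorm x) 0; first by rewrite expr0n mul0r.
by rewrite divff // sqrf_eq0.
Qed.

End euclidean_norm.

(** Passage from the walks ([p]) to the limit ([g]) within [e]. Replacing both factors costs
    [e (gG + h + gF) + e^2]; one more [e] comes from the left side and one from the walk inequality,
    and 3 collects [e^2 + 2 e]. *)
Lemma perturbed_product_le (R : realDomainType) (pG pF pGF gG gF gGF h e : R) :
  0 <= pG -> 0 <= pF -> 0 <= h -> 0 <= gG -> 0 <= gF -> 0 < e -> e <= 1 ->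
  pG - gG <= e -> pF - gF <= e -> gGF - pGF <= e -> pGF <= (pG + h) * pF + e ->
  gGF <= (gG + h) * gF + e * (3 + gG + h + gF).
Proof.
move=> pG0 pF0 h0 gG0 gF0 e0 e1 hG hF hGF cov.
have h1 : (pG + h) * pF <= (gG + e + h) * (gF + e) by apply: ler_pM; lra.
have h2 : e * e <= e by rewrite ler_piMr // ltW.
nra.
Qed.

Section tilted_mean.
Context {dT : measure_display} {T : measurableType dT} {R : realType} {d : nat}.
Local Notation V := 'rV[R]_d.
Variables (P : probability T R) (X : T -> V).
Hypothesis mX : measurable_fun setT X.
Variables (nu : 'I_d -> {measure set R -> \bar R}) (m1 : V).
Hypothesis X_indep : mutually_independent P (fun k w => X w 0 k).
Hypothesis X2 : forall k, P.-integrable setT (EFin \o (fun w => X w 0 k ^+ 2)).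
Hypothesis nu2 : forall k, (nu k).-integrable setT (EFin \o (fun u : R => u ^+ 2)).
Hypothesis X_char : forall k (s : R),
  \int[P]_w cos (s * X w 0 k) =
    expR (cos_part (nu k) s) * cos (s * m1 0 k + sin_part (nu k) s) /\
  \int[P]_w sin (s * X w 0 k) =
    expR (cos_part (nu k) s) * sin (s * m1 0 k + sin_part (nu k) s).

Local Notation Psi := (Phi nu m1).
Local Notation Ex := (Ex P X).
Local Notation steps := (steps nu).

Variables (f : V -> R) (a K Kg : R) (b : 'I_d -> R) (eps t : R).
Hypothesis f_lip : forall x y, `|f x - f y| <= a * enorm (x - y).
Hypothesis f_coord : forall k (u : R) (x : V),
  `|f (x + u *: delta_mx 0 k) - f x| <= b k * `|u|.
Hypothesis f_bound : forall x, `|f x| <= K.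
Hypothesis a_ge0 : 0 <= a.
Hypothesis b_ge0 : forall k, 0 <= b k.
Hypothesis Kg_ge0 : 0 <= Kg.
Hypothesis eps_gt0 : 0 < eps.
Hypothesis t_ge0 : 0 <= t.
Hypothesis int1 : forall k, (nu k).-integrable setT
  (EFin \o (fun u : R => `|u| * (expR (t * b k * `|u|) - 1))).
Hypothesis int2 : forall k, (nu k).-integrable setT
  (EFin \o (fun u : R => `|u| ^+ 2 * (expR (t * b k * `|u|) - 1))).

(** The cap [Kg] makes the function bounded for weak convergence; as [min] is 1-Lipschitz, it does
    not enlarge increments. *)
Definition excess (x : V) : R := Num.min (a * Num.max (enorm x - eps) 0) Kg.
Definition tilt (x : V) : R := expR (t * f x).

Lemma excess_ge0 x : 0 <= excess x.
Proof. by rewrite le_min Kg_ge0 mulr_ge0 // le_max lexx orbT. Qed.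

Lemma excess_le x : excess x <= Kg.
Proof. by rewrite ge_min lexx orbT. Qed.

Lemma excess_lip : l1_lipschitz a excess.
Proof.
move=> x y; apply: le_trans (min_lip _ _ _) _.
rewrite -mulrBr normrM ger0_norm // ler_wpM2l //.
apply: le_trans (max_lip _ _ _) _; rewrite opprB addrA subrK.
exact: le_trans (enorm_dist _ _) (enorm_le_l1norm _).
Qed.

Lemma tilt_ge0 x : 0 <= tilt x. Proof. exact: expR_ge0. Qed.

Lemma tilt_le x : tilt x <= expR (t * K).
Proof. by rewrite ler_expR ler_wpM2l // (le_trans (ler_norm _)). Qed.

Lemma tilt_lip : l1_lipschitz (expR (t * K) * (t * a)) tilt.
Proof.
move=> x y; apply: le_trans (expR_lip (c := t * K) _ _) _;
  try by rewrite ler_wpM2l // (le_trans (ler_norm _)).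
rewrite -mulrA ler_wpM2l ?expR_ge0 // -mulrBr normrM ger0_norm // -mulrA ler_wpM2l //.
by apply: le_trans (f_lip _ _) _; rewrite ler_wpM2l // enorm_le_l1norm.
Qed.

Lemma tilt_lip_cst_ge0 : 0 <= expR (t * K) * (t * a).
Proof. by rewrite mulr_ge0 ?expR_ge0 // mulr_ge0. Qed.

Lemma excess_tilt_lip :
  l1_lipschitz (Kg * (expR (t * K) * (t * a)) + a * expR (t * K))
    (fun x => excess x * tilt x).
Proof.
move=> x y; rewrite (_ : _ - _ = excess x * (tilt x - tilt y) +
  (excess x - excess y) * tilt y); last by ring.
apply: le_trans (ler_normD _ _) _; rewrite !normrM mulrDl; apply: lerD.
  rewrite -mulrA ger0_norm ?excess_ge0 //; apply: ler_pM => //.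
  - exact: excess_ge0.
  - exact: excess_le.
  - exact: tilt_lip.
rewrite mulrAC; apply: ler_pM => //; first exact: excess_lip.
by rewrite ger0_norm ?tilt_ge0 // tilt_le.
Qed.

Definition tilt_cost n (j : @jump_index d n) : R :=
  match j with
  | inl ki => expR (t * b ki.1 * `|@cell_value R n ki.2|) - 1
  | inr _ => 0
  end.

Lemma expB1_ge0 k (u : R) : 0 <= expR (t * b k * `|u|) - 1.
Proof. by rewrite subr_ge0 -expR0 ler_expR mulr_ge0 // mulr_ge0. Qed.

Lemma tilt_cost_ge0 n (j : @jump_index d n) : 0 <= tilt_cost j.
Proof. by case: j => [ki|[]] //=; exact: expB1_ge0. Qed.

Lemma tilt_diff n x (j : @jump_index d n) :
  `|tilt (x + @jump R d n j) - tilt x| <= tilt_cost j * tilt x.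
Proof.
case: j => [[k i]|[]] /=; last by rewrite addr0 subrr normr0 mul0r.
set v := cell_value i *: _; have -> : tilt (x + v) - tilt x =
    tilt x * (expR (t * (f (x + v) - f x)) - 1).
  by rewrite /tilt mulrBr mulr1 -expRD; congr (expR _ - _); ring.
rewrite normrM ger0_norm ?tilt_ge0 // mulrC ler_wpM2r ?tilt_ge0 //.
apply: le_trans (normr_expRB1_le _) _; rewrite lerD2r ler_expR normrM ger0_norm //.
by rewrite -mulrA ler_wpM2l // f_coord.
Qed.

Lemma excess_diff n x (k : 'I_d) (i : cell_index n) :
  `|excess (x + cell_value i *: delta_mx 0 k) - excess x| <=
  a * (2 * (`|x 0 k| / enorm x) * `|@cell_value R n i| + cell_value i ^+ 2 / eps).
Proof.
apply: le_trans (min_lip _ _ _) _.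
rewrite -mulrBr normrM ger0_norm // ler_wpM2l //.
exact: excess_norm_diff.
Qed.

Lemma sum_jump_prob0 n m (g : @jump_index d n -> R) : g (inr tt) = 0 ->
  (steps n m)%:R * \sum_j @jump_prob R d nu n m j * g j =
  \sum_k \sum_i weight (nu k) i * g (inl (k, i)).
Proof.
move=> g0; rewrite sum_jump_probR g0 add0r mulrA divff ?gt_eqF ?steps_gt0 // mul1r.
under eq_bigr do rewrite subr0.
by rewrite big_sumType /= sum_unit mul0r addr0 pair_bigA; apply: eq_bigr => -[].
Qed.

Let h := hfun a eps b nu t.

Lemma mono_expB1 (p : nat) k (u v : R) : `|v| <= `|u| ->
  `|v| ^+ p * (expR (t * b k * `|v|) - 1) <= `|u| ^+ p * (expR (t * b k * `|u|) - 1).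
Proof.
move=> uv; apply: ler_pM; rewrite ?exprn_ge0 ?expB1_ge0 //.
  by rewrite lerXn2r ?nnegrE.
by rewrite lerD2r ler_expR ler_wpM2l // mulr_ge0.
Qed.

(** The direction [|x_k| / |x|] is eliminated by [sum_normalized_le] and the sums over cells by
    [weight_sum_le], so the bound is [h] itself for all [n] and [x], one [N]-th of it per step. *)
Lemma excess_cost_le n m x :
  \sum_j @jump_prob R d nu n m j * (`|excess (x + @jump R d n j) - excess x| * tilt_cost j)
  <= h / (steps n m)%:R.
Proof.
rewrite ler_pdivlMr ?steps_gt0 // mulrC.
rewrite (sum_jump_prob0 m (g := fun j => `|excess (x + @jump R d n j) - excess x| * tilt_cost j)) /=;
  last by rewrite mulr0.
pose I k := \sum_i weight (nu k) i *
  (`|@cell_value R n i| * (expR (t * b k * `|@cell_value R n i|) - 1)).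
pose J k := \sum_i weight (nu k) i *
  (`|@cell_value R n i| ^+ 2 * (expR (t * b k * `|@cell_value R n i|) - 1)).
apply: (@le_trans _ _ (\sum_k (2 * a * (`|x 0 k| / enorm x * I k) + a / eps * J k))).
  apply: ler_sum => k _; rewrite /I /J !mulr_sumr -big_split; apply: ler_sum => i _ /=.
  apply: (@le_trans _ _ (weight (nu k) i * (a * (2 * (`|x 0 k| / enorm x) *
    `|@cell_value R n i| + cell_value i ^+ 2 / eps) *
     (expR (t * b k * `|@cell_value R n i|) - 1)))).
    by rewrite ler_wpM2l ?weight_ge0 // ler_wpM2r ?expB1_ge0 // excess_diff.
  rewrite -[cell_value i ^+ 2]real_normK ?num_real // le_eqVlt; apply/orP; left.
  by apply/eqP; ring.
rewrite big_split /= -!mulr_sumr /h /hfun; apply: lerD.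
  rewrite ler_wpM2l ?mulr_ge0 //.
  apply: sum_normalized_le => [k|k|]; last exact: sum_direction_sqr.
    by rewrite divr_ge0 ?enorm_ge0.
  apply/andP; split.
    by apply: sumr_ge0 => i _; rewrite mulr_ge0 ?weight_ge0 // mulr_ge0 ?expB1_ge0.
  apply: (@weight_sum_le R (nu k) (nu2 k) n (fun u => `|u| * (expR (t * b k * `|u|) - 1))) => //.
  - by move=> u; rewrite mulr_ge0 ?expB1_ge0.
  - by move=> u v; exact: (mono_expB1 1).
rewrite ler_wpM2l ?divr_ge0 ?(ltW eps_gt0) //; apply: ler_sum => k _.
apply: (@weight_sum_le R (nu k) (nu2 k) n (fun u => `|u| ^+ 2 * (expR (t * b k * `|u|) - 1))) => //.
- by move=> u; rewrite mulr_ge0 ?expB1_ge0 ?exprn_ge0.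
- by move=> u v; exact: (mono_expB1 2).
Qed.

Lemma h_ge0 : 0 <= h.
Proof.
rewrite /h /hfun addr_ge0 ?mulr_ge0 ?sqrtr_ge0 ?invr_ge0 ?(ltW eps_gt0) //.
apply: sumr_ge0 => k _; apply: Rintegral_ge0 => u _.
by rewrite mulr_ge0 ?expB1_ge0 ?exprn_ge0.
Qed.

(** Finite for each [n], this total and [cost_total] may be unbounded in [n]. Their product enters
    the covariance error divided by the number of steps, hence vanishes as [m] grows with [n]
    fixed. *)
Definition abs_total n : R := \sum_k \sum_i weight (nu k) i * `|@cell_value R n i|.
Definition cost_total n : R :=
  \sum_k \sum_i weight (nu k) i * (expR (t * b k * `|@cell_value R n i|) - 1).

Lemma abs_total_ge0 n : 0 <= abs_total n.
Proof. by apply: sumr_ge0 => k _; apply: sumr_ge0 => i _; rewrite mulr_ge0 ?weight_ge0. Qed.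

Lemma excess_diff_sum n m x :
  \sum_j @jump_prob R d nu n m j * `|excess (x + @jump R d n j) - excess x|
  <= a * abs_total n / (steps n m)%:R.
Proof.
rewrite ler_pdivlMr ?steps_gt0 // mulrC.
rewrite (sum_jump_prob0 m (g := fun j => `|excess (x + @jump R d n j) - excess x|)) /=;
  last by rewrite addr0 subrr normr0.
rewrite /abs_total mulr_sumr; apply: ler_sum => k _.
rewrite mulr_sumr; apply: ler_sum => i _; rewrite mulrCA ler_wpM2l ?weight_ge0 //.
apply: le_trans (excess_lip _ _) _; rewrite ler_wpM2l // addrC addKr /l1norm.
rewrite (bigD1 k) //= big1 => [|l /negbTE lk]; rewrite !mxE !eqxx ?mulr1 ?addr0 //.
by rewrite lk andbF mulr0 normr0.
Qed.

Lemma tilt_cost_sum n m :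
  \sum_j @jump_prob R d nu n m j * tilt_cost j = cost_total n / (steps n m)%:R.
Proof.
rewrite /cost_total -(sum_jump_prob0 m (g := @tilt_cost n)) //.
by rewrite mulrAC divff ?mul1r // gt_eqF ?steps_gt0.
Qed.

Lemma Phi_cov_le n (e : R) : 0 < e -> \forall m \near \oo,
  Psi n m (fun x => excess x * tilt x) <=
  (Psi n m excess + h) * Psi n m tilt + e.
Proof.
move=> e0; set E := expR (t * K).
pose B := h * (2 * E * total nu n) + a * abs_total n * cost_total n * E.
apply: filterS (near_steps nu n B e0) => m hm.
have p0 := @jump_prob_ge0 R d nu n m; have p1 := @jump_prob_sum1 R d nu n m.
set N : R := (steps n m)%:R; have N0 : 0 < N by exact: steps_gt0.
have NE : steps n m = (steps n m).-1.+1 by [].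
have := @walk_cov_le R V _ (@jump_prob R d nu n m) (@jump R d n) (@tilt_cost n) p0 p1
  (@tilt_cost_ge0 n) (steps n m).-1 excess tilt (h / N) (a * abs_total n / N)
  (cost_total n / N) _ _ _ tilt_ge0 (@tilt_diff n) (@excess_cost_le n m)
  (@excess_diff_sum n m) (drift nu m1 n).
rewrite -NE -/N; move=> H; apply: le_trans (H _ _ _) _.
- by rewrite divr_ge0 ?(ltW N0) // mulr_ge0 ?abs_total_ge0.
- by rewrite divr_ge0 ?(ltW N0) ?h_ge0.
- by rewrite tilt_cost_sum.
rewrite -/(Psi n m excess) -/(Psi n m tilt) [X in _ <= X + _]mulrDl -[leRHS]addrA lerD2l.
set W := walk _ _ _ _ _.
(* The error in [walk_cov_le] has one step less than [Psi n m tilt]; [Phi_pred] makes up for it at a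
   cost [O(1/N)]. *)
have W_le : W <= Psi n m tilt + 2 * E * total nu n / N.
  have tE x : `|tilt x| <= E by rewrite ger0_norm ?tilt_ge0 // tilt_le.
  have := Phi_pred nu m1 n m tE; rewrite ler_norml => /andP[+ _].
  by rewrite -/W -/N; lra.
have WE : W <= E.
  rewrite -[leRHS](walk_cst (v := @jump R d n) p1 (steps n m).-1 E (drift nu m1 n)).
  by apply: le_walk => // x; exact: tilt_le.
have W0 : 0 <= W by apply: walk_ge0 => // x; exact: tilt_ge0.
have cost0 : 0 <= cost_total n.
  by apply: sumr_ge0 => k _; apply: sumr_ge0 => i _; rewrite mulr_ge0 ?weight_ge0 ?expB1_ge0.
rewrite (_ : N * _ * W = h * W + a * abs_total n * cost_total n / N * W); last first.
  by field; rewrite gt_eqF.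
apply: (@le_trans _ _ (h * (Psi n m tilt + 2 * E * total nu n / N) +
   a * abs_total n * cost_total n / N * E)).
  apply: lerD; first by rewrite ler_wpM2l ?h_ge0.
  rewrite ler_wpM2l // mulr_ge0 ?invr_ge0 ?(ltW N0) // mulr_ge0 //.
  by rewrite mulr_ge0 ?abs_total_ge0.
rewrite mulrDr -addrA lerD2l; apply: le_trans hm.
by rewrite le_eqVlt; apply/orP; left; apply/eqP; rewrite /B; field; rewrite gt_eqF.
Qed.

Lemma tilted_mean_le :
  Ex (fun x => excess x * tilt x) <= (Ex excess + h) * Ex tilt.
Proof.
have bG x : `|excess x| <= Kg by rewrite ger0_norm ?excess_ge0 // excess_le.
have bF x : `|tilt x| <= expR (t * K) by rewrite ger0_norm ?tilt_ge0 // tilt_le.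
have bGF x : `|excess x * tilt x| <= Kg * expR (t * K).
  by rewrite normrM; apply: ler_pM.
have wc := weak_convergence mX X_indep X2 nu2 X_char.
have wG := wc _ _ a_ge0 (ex_intro _ _ bG) excess_lip.
have wF := wc _ _ tilt_lip_cst_ge0 (ex_intro _ _ bF) tilt_lip.
have cGF : 0 <= Kg * (expR (t * K) * (t * a)) + a * expR (t * K).
  by rewrite addr_ge0 // mulr_ge0 ?expR_ge0 ?tilt_lip_cst_ge0.
have wGF := wc _ _ cGF (ex_intro _ _ bGF) excess_tilt_lip.
have ExG0 : 0 <= Ex excess by apply: Rintegral_ge0 => w _; exact: excess_ge0.
have ExF0 : 0 <= Ex tilt by apply: Rintegral_ge0 => w _; exact: tilt_ge0.
pose D := 3 + Ex excess + h + Ex tilt.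
have D0 : 0 < D by rewrite /D; have := h_ge0; lra.
suff H (e : R) : 0 < e -> e <= 1 ->
    Ex (fun x => excess x * tilt x) <= (Ex excess + h) * Ex tilt + e * D.
  apply/ler_addgt0Pr => e e0; pose e' := Num.min 1 (e / D).
  have e'0 : 0 < e' by rewrite lt_min ltr01 divr_gt0.
  apply: le_trans (H e' e'0 _) _; first by rewrite ge_min lexx.
  by rewrite lerD2l -ler_pdivlMr // ge_min lexx orbT.
move=> e0 e1.
have [n [hG [hF hGF]]] := filter_ex (filterI (wG _ e0) (filterI (wF _ e0) (wGF _ e0))).
have [m [gG [gF [gGF cov]]]] := filter_ex (filterI hG (filterI hF (filterI hGF (Phi_cov_le n e0)))).
have PG0 : 0 <= Psi n m excess.
  by apply: walk_ge0 => [j|x]; [exact: jump_prob_ge0|exact: excess_ge0].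
have PF0 : 0 <= Psi n m tilt.
  by apply: walk_ge0 => [j|x]; [exact: jump_prob_ge0|exact: tilt_ge0].
move: gG gF gGF; rewrite !ler_norml => /andP[_ gG] /andP[_ gF] /andP[gGF _].
apply: (perturbed_product_le PG0 PF0 h_ge0 ExG0 ExF0 e0 e1 gG gF _ cov).
by rewrite lerNl opprB in gGF.
Qed.

End tilted_mean.

(** * The inverse of h *)

Section inverse_on_facts.
Context {R : realType}.
Implicit Types (h : R -> R) (M : \bar R) (s t x : R).

Definition below M : set R := [set t | 0 <= t /\ (t%:E < M)%E].

Lemma inverse_on_out h M s : ~ (h @` below M) s -> inverse_on h M s = 0.
Proof.
move=> no; rewrite /inverse_on /pinv_ splitV.
have -> : 'oinv_([fun h in below M]) s = None; last by [].
transitivity ('oinv_(((fun _ => id) : set_surj (below M) (h @` below M) h)) s) => //.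
by rewrite oinv_surj; case: pselect.
Qed.

Lemma inverse_on_in h M s : (h @` below M) s ->
  below M (inverse_on h M s) /\ h (inverse_on h M s) = s.
Proof.
move=> hs; split; last by rewrite /inverse_on pinvK // inE.
have hsurj : set_surj (below M) (h @` below M) h by [].
by apply: (@surjpinv_image_sub _ _ (fun=> 0) _ _ _ hsurj); exists s.
Qed.

(* No measurability is needed: the integral of a nonnegative function is a
   supremum over the simple functions below it. *)
Lemma ge0_le_integral_sup (D : set R) (f g : R -> \bar R) :
    (forall x, D x -> (0 <= f x)%E) -> (forall x, D x -> (f x <= g x)%E) ->
  (\int[lebesgue_measure]_(x in D) f x <= \int[lebesgue_measure]_(x in D) g x)%E.
Proof.
move=> f0 fg; have g0 x : D x -> (0 <= g x)%E.
  by move=> Dx; apply: le_trans (fg x Dx); exact: f0.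
rewrite !ge0_integralE //; apply: le_ereal_sup => _ [q /= qf <-]; exists q => //= x.
apply: le_trans (qf x) _; rewrite /patch; case: ifPn => //; rewrite inE.
exact: fg.
Qed.

(** For [s] in [0, x] the inverse is at most [dl] times one plus the number of [i] in 1..N with
    [h(i dl) <= s]. Integrated over [s], each grid point contributes [x - h(i dl)], and the extra
    one gives the rounding error [dl x]. *)
Lemma inverse_integral_le h M x t1 (dl : R) :
    0 < x -> 0 < dl -> h 0 = 0 ->
    (forall s t, 0 <= s -> s <= t -> (t%:E < M)%E -> h s <= h t) ->
    0 <= t1 -> (t1%:E < M)%E -> x < h t1 ->
  exists N : nat,
    [/\ ((N%:R * dl)%:E < M)%E, forall i, (i <= N)%N -> 0 <= h (i%:R * dl) <= x &
     \int[lebesgue_measure]_(s in `[0, x]) inverse_on h M s <=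
       dl * (x + \sum_(i < N) (x - h (i.+1%:R * dl)))].
Proof.
move=> x0 dl0 h0 hm t10 t1M xh.
(* [N] will be the last grid index up to [t1] with [h <= x]; the bound by [t1] makes a maximum exist
   and keeps the grid below [M]. *)
pose Q (n : nat) := (n%:R * dl <= t1) && (h (n%:R * dl) <= x).
have Q0 : exists n, Q n by exists 0%N; rewrite /Q mul0r t10 h0 ltW.
have Qb n : Q n -> (n <= Num.truncn (t1 / dl))%N.
  case/andP=> h1 _; rewrite truncn_ge_nat ?divr_ge0 ?(ltW dl0) //.
  by rewrite ler_pdivlMr.
pose N := ex_maxn Q0 Qb.
have [QN maxN] : Q N /\ forall n, Q n -> (n <= N)%N.
  by rewrite /N; case: ex_maxnP.
have ltM n : n%:R * dl <= t1 -> ((n%:R * dl)%:E < M)%E.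
  by move=> le; apply: le_lt_trans t1M; rewrite lee_fin.
have nd0 n : 0 <= n%:R * dl by rewrite mulr_ge0 ?(ltW dl0).
have [Nt1 Nx] := andP QN.
have hN i : (i <= N)%N -> 0 <= h (i%:R * dl) <= x.
  move=> iN; have iNd : i%:R * dl <= N%:R * dl by rewrite ler_pM2r // ler_nat.
  rewrite -[X in X <= h _]h0 hm ?ltM // ?(le_trans iNd) //=.
  by apply: le_trans Nx; apply: hm => //; exact: ltM.
exists N; split=> //; first exact: ltM.
pose k (s : R) : R := dl * (1 + \sum_(i < N) (h (i.+1%:R * dl) <= s)%R%:R).
have k_ge0 s : 0 <= k s by rewrite mulr_ge0 ?(ltW dl0) // addr_ge0 // sumr_ge0.
have inv_ge0 s : 0 <= inverse_on h M s.
  have [hs|hs] := pselect ((h @` below M) s); last by rewrite inverse_on_out.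
  by case: (inverse_on_in hs) => -[].
have inv_le s : s \in `[0, x] -> inverse_on h M s <= k s.
  rewrite in_itv /= => /andP[s0 sx].
  have [hs|hs] := pselect ((h @` below M) s); last by rewrite inverse_on_out.
  case: (inverse_on_in hs); move: (inverse_on h M s) => r [r0 rM] hr.
  (* Monotonicity with [h r = s <= x < h t1]. It places the grid index [j] of [r] in the range over
     which [N] is maximal. *)
  have rt1 : r < t1.
    rewrite ltNge; apply/negP => t1r.
    by have := hm _ _ t10 t1r rM; rewrite hr; have := le_lt_trans sx xh; lra.
  have rd0 : 0 <= r / dl by rewrite divr_ge0 // ltW.
  pose j := Num.truncn (r / dl).
  have /andP[jr rj] : j%:R <= r / dl < j.+1%:R by exact: truncn_itv.
  rewrite ler_pdivlMr // in jr; rewrite ltr_pdivrMr // in rj.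
  have hi i : (i <= j)%N -> h (i%:R * dl) <= s.
    move=> ij; rewrite -hr; apply: hm => //; apply: le_trans jr.
    by rewrite ler_pM2r // ler_nat.
  have jN : (j <= N)%N.
    apply: maxN; rewrite /Q (le_trans jr (ltW rt1)) /=.
    by apply: le_trans sx; exact: hi.
  apply: le_trans (ltW rj) _; rewrite /k mulrC ler_wpM2l ?(ltW dl0) //.
  rewrite -natr1 addrC lerD2l.
  rewrite -(big_mkord xpredT (fun i => (h (i.+1%:R * dl) <= s)%R%:R)) (big_cat_nat (n := j)) //=.
  rewrite -[leLHS]addr0; apply: lerD; last exact: sumr_ge0.
  have -> : j%:R = \sum_(0 <= i < j) 1 :> R by rewrite sumr_const_nat subn0.
  by apply: ler_sum_nat => i /andP[_ ij]; rewrite hi.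
have le1 : (\int[lebesgue_measure]_(s in `[0%R, x]) (inverse_on h M s)%:E <=
    \int[lebesgue_measure]_(s in `[0%R, x]) (k s)%:E)%E.
  apply: ge0_le_integral_sup => s xs; first by rewrite lee_fin.
  by rewrite lee_fin; exact: inv_le.
have kE : (\int[lebesgue_measure]_(s in `[0%R, x]) (k s)%:E =
    (dl * (x + \sum_(i < N) (x - h (i.+1%:R * dl))))%:E)%E.
  pose D : set R := `[0, x]%classic; pose A i : set R := `[h (i.+1%:R * dl), +oo[%classic.
  have mD : measurable D by exact: measurable_itv.
  transitivity (\int[lebesgue_measure]_(s in D)
      (dl%:E * (1 + \sum_(i < N) (\1_(A i) s)%:E)))%E.
    apply: eq_integral => s _; rewrite /k sumEFin -EFinD -EFinM; congr (_ * (_ + _))%:E.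
    by apply: eq_bigr => i _; rewrite indicE /A mem_setE in_itv /= andbT.
  have mA i : measurable (A i) by exact: measurable_itv.
  have mI i : measurable_fun D (fun s => (\1_(A i) s : R)%:E).
    by apply/measurable_EFinP; exact: measurable_funTS.
  have muD : lebesgue_measure D = x%:E.
    by rewrite lebesgue_measure_itv /= lte_fin x0 sube0.
  rewrite ge0_integralZl_EFin ?(ltW dl0) //; last 2 first.
  - by move=> s _; rewrite adde_ge0 // sume_ge0 // => i _; rewrite lee_fin.
  - apply: emeasurable_funD => //; apply: emeasurable_sum => i; exact: mI.
  rewrite ge0_integralD //; last 2 first.
  - by move=> s _; rewrite sume_ge0 // => i _; rewrite lee_fin.
  - apply: emeasurable_sum => i; exact: mI.
  rewrite integral_cst // mul1e ge0_integral_sum //; last by move=> i; exact: mI.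
  rewrite [X in X + _]muD.
  rewrite (eq_bigr (fun i : 'I_N => (x - h (i.+1%:R * dl))%:E)) ?sumEFin //.
  move=> i _; rewrite integral_indic //; last exact: mA.
  have /andP[hi0 hix] := hN _ (ltn_ord i).
  rewrite (_ : A i `&` D = `[h (i.+1%:R * dl), x]%classic); last first.
    apply/seteqP; split=> s; rewrite /A /D /= !in_itv /= andbT.
      by case=> -> /andP[].
    by case/andP=> his ->; rewrite his (le_trans hi0).
  transitivity (lebesgue_measure (`[h (i.+1%:R * dl), x]%classic : set R)) => //.
  rewrite lebesgue_measure_itv /= lte_fin; case: ltP => // xh'.
  by rewrite (le_anti (introT andP (conj xh' hix))) subrr.
rewrite /Rintegral -lee_fin fineK.
  by rewrite -kE.
rewrite ge0_fin_numE; last by apply: integral_ge0 => s _; rewrite lee_fin.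
by apply: le_lt_trans le1 _; rewrite kE ltry.
Qed.

End inverse_on_facts.

(** * Exponential moments *)

(** Up to [rho], [exp(be v) - 1 <= be v exp(be v)] supplies a second power of [v]. Beyond, the ramp
    is 1 and the gap between [be] and [th] absorbs the power:
    [v^q <= q! exp((th - be) v) / (th - be)^q] with [q = p.+1]. *)
Lemma jump_weight_le {R : realType} (be th r : R) (p : nat) : 0 <= be -> be < th ->
  exists C : R, forall u : R,
    `|u| ^+ p.+1 * (expR (be * `|u|) - 1) <=
    C * (u ^+ 2 + ramp r u * expR (th * `|u|)).
Proof.
move=> be0 beth; have th0 : 0 < th - be by rewrite subr_gt0.
pose rho := `|r| + 1; have rho0 : 0 <= rho by rewrite addr_ge0.
pose C1 := rho ^+ p * (be * expR (be * rho)).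
pose C2 := (p.+1)`!%:R / (th - be) ^+ p.+1.
have C10 : 0 <= C1 by rewrite !mulr_ge0 ?exprn_ge0 ?expR_ge0.
have C20 : 0 <= C2 by rewrite divr_ge0 ?exprn_ge0 ?ltW.
exists (C1 + C2) => u.
have e0 := expR_ge0 (th * `|u|); have r0 := ramp_ge0 r u.
rewrite -(real_normK (num_real u)); move: (normr_ge0 u) (@ramp_eq1 _ r u) r0 e0.
move: `|u| (ramp r u) => v g v0 g1 g0 e0.
have [small|large] := leP v rho.
  apply: (@le_trans _ _ (C1 * v ^+ 2)); last first.
    apply: ler_pM; rewrite ?exprn_ge0 //; first by rewrite lerDl.
    by rewrite lerDl mulr_ge0.
  have := expRB_le (be * v) 0; rewrite expR0 subr0 => h1.
  have h2 : v ^+ p <= rho ^+ p by rewrite lerXn2r ?nnegrE.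
  have h3 : expR (be * v) * (be * v) <= be * expR (be * rho) * v.
    rewrite mulrA [_ * be]mulrC ler_wpM2r // ler_wpM2l // ler_expR.
    exact: ler_wpM2l.
  rewrite (_ : C1 * _ = (rho ^+ p * v) * (be * expR (be * rho) * v)); last first.
    by rewrite /C1 expr2; ring.
  apply: le_trans (_ : (v ^+ p * v) * (expR (be * v) * (be * v)) <= _).
    by rewrite exprSr ler_wpM2l // mulr_ge0 ?exprn_ge0.
  apply: ler_pM => //; rewrite ?mulr_ge0 ?exprn_ge0 ?expR_ge0 //.
  exact: ler_wpM2r.
rewrite g1; last by have := ler_norm r; rewrite /rho in large; lra.
apply: (@le_trans _ _ (C2 * expR (th * v))); last first.
  rewrite mul1r; apply: ler_pM; rewrite ?expR_ge0 ?lerDr //.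
  exact: exprn_ge0.
apply: (@le_trans _ _ (v ^+ p.+1 * expR (be * v))).
  by rewrite ler_wpM2l ?exprn_ge0 // gerDl lerN10.
have -> : th * v = (th - be) * v + be * v by ring.
rewrite expRD mulrA ler_wpM2r ?expR_ge0 //.
have := expR_ge1Dxn p (mulr_ge0 (ltW th0) v0); rewrite exprMn => h.
have fp : 0 < (p.+1)`!%:R :> R by rewrite ltr0n fact_gt0.
have dp : 0 < (th - be) ^+ p.+1 by rewrite exprn_gt0.
have : (th - be) ^+ p.+1 * v ^+ p.+1 / (p.+1)`!%:R <= expR ((th - be) * v) by lra.
by rewrite /C2 ler_pdivrMr // mulrAC ler_pdivlMr // [v ^+ _ * _]mulrC [_`!%:R * _]mulrC.
Qed.

Lemma measurable_jump_weight {R : realType} (be : R) (p : nat) :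
  measurable_fun setT (fun u : R => `|u| ^+ p * (expR (be * `|u|) - 1)).
Proof.
have mn : measurable_fun setT (fun u : R => `|u|) by exact: normr_measurable.
apply: measurable_funM; first exact: measurable_funX.
apply: measurable_funB => //; apply: measurableT_comp => //.
exact: measurable_funM.
Qed.

Lemma jump_weight_integrable {R : realType} (nu : {measure set R -> \bar R})
    (be th r : R) (p : nat) : 0 <= be -> be < th ->
    nu.-integrable setT (EFin \o (fun u : R => u ^+ 2)) ->
    nu.-integrable setT (EFin \o (fun u : R => ramp r u * expR (th * `|u|))) ->
  nu.-integrable setT
    (EFin \o (fun u : R => `|u| ^+ p.+1 * (expR (be * `|u|) - 1))).
Proof.
move=> be0 beth i2 ie; have [C Cu] := @jump_weight_le R be th r p be0 beth.
pose g (u : R) : R := C * (u ^+ 2 + ramp r u * expR (th * `|u|)).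
apply: (@integrable_dominated _ _ _ nu _ g (measurable_jump_weight _ _)).
  move=> u; rewrite ger0_norm //.
  by rewrite mulr_ge0 ?exprn_ge0 // subr_ge0 -expR0 ler_expR mulr_ge0.
rewrite (_ : _ \o _ = (fun u => C%:E * ((u ^+ 2)%:E + (ramp r u * expR (th * `|u|))%:E))%E) //.
by apply: integrableZl => //; exact: integrableD.
Qed.

Lemma hfun0 {R : realType} d (a eps : R) (b : 'I_d -> R) nu : hfun a eps b nu 0 = 0.
Proof.
rewrite /hfun !big1 ?sqrtr0 ?mulr0 ?addr0 // => k _.
  under eq_Rintegral do rewrite !mul0r expR0 subrr mulr0.
  by rewrite /Rintegral integral0.
under eq_Rintegral do rewrite !mul0r expR0 subrr mulr0.
by rewrite /Rintegral integral0 expr0n.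
Qed.

Lemma sqrt_sum_le {R : realType} d (a c : R) (F F' G G' : 'I_d -> R) :
    0 <= a -> 0 <= c -> (forall k, 0 <= F k <= F' k) -> (forall k, G k <= G' k) ->
  2 * a * Num.sqrt (\sum_(k < d) F k ^+ 2) + c * \sum_(k < d) G k <=
  2 * a * Num.sqrt (\sum_(k < d) F' k ^+ 2) + c * \sum_(k < d) G' k.
Proof.
move=> a0 c0 FF GG; apply: lerD.
  rewrite ler_wpM2l ?mulr_ge0 // ler_wsqrtr // ler_sum // => k _.
  by have /andP[F0 FF'] := FF k; rewrite lerXn2r ?nnegrE ?(le_trans F0).
by rewrite ler_wpM2l // ler_sum.
Qed.

Lemma hfun_le {R : realType} d (a eps : R) (b : 'I_d -> R)
    (nu : 'I_d -> {measure set R -> \bar R}) (s t : R) :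
    0 <= a -> 0 < eps -> (forall k, 0 <= b k) -> 0 <= s -> s <= t ->
    (forall k r p, r \in [:: s; t] -> (nu k).-integrable setT
       (EFin \o (fun u : R => `|u| ^+ p.+1 * (expR (r * b k * `|u|) - 1)))) ->
  hfun a eps b nu s <= hfun a eps b nu t.
Proof.
move=> a0 e0 b0 s0 st int.
have key k p : \int[nu k]_u (`|u| ^+ p.+1 * (expR (s * b k * `|u|) - 1)) <=
               \int[nu k]_u (`|u| ^+ p.+1 * (expR (t * b k * `|u|) - 1)).
  apply: le_Rintegral => //; rewrite ?int ?inE ?eqxx ?orbT // => u _ /=.
  rewrite ler_wpM2l ?exprn_ge0 // lerD2r ler_expR ler_wpM2r //.
  exact: ler_wpM2r.
apply: sqrt_sum_le => //; first by rewrite divr_ge0 // ltW.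
  move=> k; rewrite (key k 0%N) andbT; apply: Rintegral_ge0 => u _.
  by rewrite mulr_ge0 // subr_ge0 -expR0 ler_expR !mulr_ge0.
Qed.
(** Makes the filter defining [h(M^-)] proper, for finite and infinite [M] alike, so that an upper
    bound on [h] passes to the limit. *)
Lemma closure_below_ereal {R : realType} (M : \bar R) : (0 < M)%E ->
  closure [set t : \bar R | (t < M)%E] M.
Proof.
case: M => [r r0| _ |] // B /=.
- move=> Br; have {}Br : \forall y \near r, B y%:E by rewrite -nbhs_EFin.
  have /filter_ex[y [yr By]] : \forall y \near r^'-, y < r /\ B y%:E.
    apply: filterI; first exact: nbhs_left_lt.
    by rewrite /at_left; apply: cvg_within; exact: Br.
  by exists y%:E; split; rewrite /= ?lte_fin.
- case=> A [_ AB]; exists (A + 1)%:E; split; first by rewrite /= ltry.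
  by apply: AB; rewrite lte_fin ltrDl.
Qed.

Lemma left_limit_gt {R : realType} (h : R -> R) (M : \bar R) (x : R) :
    0 <= x -> (0 < M)%E -> (x%:E < left_limit h M)%E ->
  exists t, [/\ 0 <= t, (t%:E < M)%E & x < h t].
Proof.
move=> x0 M0 xl; apply: contrapT => no; move: xl; apply/negP; rewrite -leNgt.
rewrite /left_limit; set F := within _ _; set u := (fun t : \bar R => _).
have PF : ProperFilter F by apply: within_nbhs_proper; exact: closure_below_ereal.
(* A divergent [lim] is the default point 0, and [0 <= x]. *)
have [cv|ncv] := pselect (cvg (u @ F)); last first.
  by rewrite (dvgP ncv) lee_fin.
apply: lime_le => //; rewrite /F near_withinE.
have Mpos : \forall t \near M, (0 < t)%E by exact: open_ereal_gt'.
(* [fine] sends infinite points to 0; positivity and [t < M] make [t] finite. *)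
near=> t => /= tM; rewrite lee_fin leNgt; apply/negP => xh; apply: no.
have t0 : (0 < t)%E by near: t.
have tf : t \is a fin_num by rewrite ge0_fin_numE ?(ltW t0) // (lt_le_trans tM) // leey.
exists (fine t); split=> //; first by rewrite fine_ge0 // ltW.
by rewrite fineK.
Unshelve. all: by end_near.
Qed.

Section exponential_moments.
Context {dT : measure_display} {T : measurableType dT} {R : realType} {d : nat}.
Local Notation V := 'rV[R]_d.
Variables (P : probability T R) (X : T -> V).
Hypothesis mX : measurable_fun setT X.

Lemma exp_moment_le (Y Z : T -> R) :
    measurable_fun setT Y -> measurable_fun setT Z -> (forall w, Y w <= Z w) ->
    (\int[P]_w (expR (Z w))%:E < +oo)%E ->
  (\int[P]_w (expR (Y w))%:E < +oo)%E.
Proof.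
move=> mY mZ YZ; apply: le_lt_trans; apply: ge0_le_integral => //.
- by apply/measurable_EFinP; exact: measurableT_comp.
- by apply/measurable_EFinP; exact: measurableT_comp.
- by move=> w _; rewrite lee_fin ler_expR.
Qed.

Lemma measurable_enormX : measurable_fun setT (fun w => enorm (X w)).
Proof.
apply: (measurable_compX mX (psi := enorm)); apply: (@measurable_lipschitz _ _ 1).
move=> x y; rewrite mul1r; apply: le_trans (enorm_dist _ _) _.
exact: enorm_le_l1norm.
Qed.

Variable t0 : R.
Hypothesis t0_gt0 : 0 < t0.
Hypothesis X_exp : (\int[P]_w (expR (t0 * enorm (X w)))%:E < +oo)%E.

Lemma exp_enorm_integrable :
  P.-integrable setT (EFin \o (fun w => expR (t0 * enorm (X w)))).
Proof.
apply: (@integrable_ge0 _ _ _ P (fun w => expR (t0 * enorm (X w)))) => //.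
by apply: measurableT_comp => //; apply: measurable_funM => //; exact: measurable_enormX.
Qed.

(** [v^q <= q! exp(t0 v) / t0^q] with [q = n.+1], from the exponential series. *)
Lemma enormX_pow_integrable (n : nat) (g : T -> R) : measurable_fun setT g ->
  (forall w, `|g w| <= enorm (X w) ^+ n.+1) -> P.-integrable setT (EFin \o g).
Proof.
move=> mg gn; pose C : R := (n.+1)`!%:R / t0 ^+ n.+1.
apply: (@integrable_dominated _ _ _ P g (fun w => C * expR (t0 * enorm (X w)))) => //.
  move=> w; apply: le_trans (gn w) _; rewrite /C.
  have := expR_ge1Dxn n (mulr_ge0 (ltW t0_gt0) (enorm_ge0 (X w))); rewrite exprMn.
  have fp : 0 < (n.+1)`!%:R :> R by rewrite ltr0n fact_gt0.
  have dp : 0 < t0 ^+ n.+1 by rewrite exprn_gt0.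
  move=> h; have : t0 ^+ n.+1 * enorm (X w) ^+ n.+1 / (n.+1)`!%:R <=
      expR (t0 * enorm (X w)) by lra.
  by rewrite ler_pdivrMr // mulrAC ler_pdivlMr // [enorm _ ^+ _ * _]mulrC
    [_`!%:R * _]mulrC.
rewrite (_ : _ \o _ = (fun w => C%:E * (expR (t0 * enorm (X w)))%:E)%E) //.
by apply: integrableZl => //; exact: exp_enorm_integrable.
Qed.

Lemma coord_exp_moment k (c : R) : c <= t0 ->
  (\int[P]_w (expR (c * `|X w 0 k|))%:E < +oo)%E.
Proof.
move=> ct; apply: exp_moment_le X_exp => [||w].
- apply: measurable_funM => //; apply: measurableT_comp => //.
  exact: measurable_coordX.
- by apply: measurable_funM => //; exact: measurable_enormX.
- apply: le_trans (_ : t0 * `|X w 0 k| <= _); first exact: ler_wpM2r.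
  by rewrite ler_wpM2l ?(ltW t0_gt0) // normr_coord_le.
Qed.

Variable b : 'I_d -> R.
Hypothesis b_ge0 : forall k, 0 <= b k.
Local Notation M := (exp_moment_sup P X b).

Lemma exp_moment_sup_gt0 : (0 < M)%E.
Proof.
(* The witness [t = t0 / (1 + sum b)] satisfies [t b_k <= t0] for every [k], even when all [b_k]
   vanish. *)
have S0 : 0 < 1 + \sum_k b k by rewrite ltr_pwDl // sumr_ge0.
apply: lt_le_trans (_ : (t0 / (1 + \sum_k b k))%:E <= _)%E.
  by rewrite lte_fin divr_gt0.
apply: ereal_sup_ubound; exists (t0 / (1 + \sum_k b k)) => //; split.
  by rewrite divr_gt0.
move=> k; rewrite unlock; apply: coord_exp_moment.
rewrite -mulrA ger_pMr // ler_pdivrMl // mulr1 (bigD1 k) //=.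
have : 0 <= \sum_(i < d | i != k) b i by exact: sumr_ge0.
lra.
Qed.

Lemma below_exp_moment_sup (t : R) k : 0 <= t -> (t%:E < M)%E ->
  exists2 th : R, 0 <= t * b k < th &
    (\int[P]_w (expR (th * `|X w 0 k|))%:E < +oo)%E.
Proof.
move=> tge0 /ereal_sup_gt[_ [t' [t'0 t'exp] <-]]; rewrite lte_fin => tt'.
have := t'exp k; rewrite unlock => ek.
(* If [b_k = 0], a larger [t'] gives no strictly larger exponent, and [t0] is taken instead. *)
have := b_ge0 k; rewrite le0r => /orP[/eqP bk0|bk].
  by exists t0; [rewrite bk0 mulr0 lexx|exact: coord_exp_moment].
by exists (t' * b k) => //; rewrite mulr_ge0 ?(ltW bk) // ltr_pM2r.
Qed.

Variables (nu : 'I_d -> {measure set R -> \bar R}) (m1 : V).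
Hypothesis X_indep : mutually_independent P (fun k w => X w 0 k).
Hypothesis nu2 : forall k, (nu k).-integrable setT (EFin \o (fun u : R => u ^+ 2)).
Hypothesis X_char : forall k (s : R),
  \int[P]_w cos (s * X w 0 k) =
    expR (cos_part (nu k) s) * cos (s * m1 0 k + sin_part (nu k) s) /\
  \int[P]_w sin (s * X w 0 k) =
    expR (cos_part (nu k) s) * sin (s * m1 0 k + sin_part (nu k) s).

Lemma coord_sqr_integrable k :
  P.-integrable setT (EFin \o (fun w => X w 0 k ^+ 2)).
Proof.
apply: (@enormX_pow_integrable 1).
  by apply: measurable_funX; exact: measurable_coordX.
by move=> w; rewrite normrX lerXn2r ?nnegrE ?enorm_ge0 // normr_coord_le.
Qed.

Lemma below_jump_weight_integrable (t : R) k (p : nat) : 0 <= t -> (t%:E < M)%E ->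
  (nu k).-integrable setT
    (EFin \o (fun u : R => `|u| ^+ p.+1 * (expR (t * b k * `|u|) - 1))).
Proof.
move=> tge0 tM; have [th /andP[tb0 tbth] eth] := below_exp_moment_sup k tge0 tM.
have [r ir] := levy_exp_moment mX X_indep coord_sqr_integrable nu2 X_char
  (le_trans tb0 (ltW tbth)) eth.
exact: jump_weight_integrable ir.
Qed.

Lemma hfun_below_le (a eps s t : R) : 0 <= a -> 0 < eps ->
  0 <= s -> s <= t -> (t%:E < M)%E -> hfun a eps b nu s <= hfun a eps b nu t.
Proof.
move=> a0 e0 s0 st tM; apply: hfun_le => // k r p.
have sM : (s%:E < M)%E by apply: le_lt_trans tM; rewrite lee_fin.
by rewrite !inE => /orP[] /eqP ->; apply: below_jump_weight_integrable => //;
  exact: le_trans st.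
Qed.

End exponential_moments.

(** * The tail estimate *)

Lemma measurable_superlevel {dT : measure_display} {T : measurableType dT}
    {R : realType} (Y : T -> R) (y : R) :
  measurable_fun setT Y -> measurable [set w | y <= Y w].
Proof.
move=> mY; rewrite -[X in measurable X]setTI.
have := mY measurableT _ (measurable_itv `[y, +oo[).
by congr (measurable (_ `&` _)); apply/seteqP; split=> w /=; rewrite in_itv /= andbT.
Qed.

Section exponential_tilting.
Context {dT : measure_display} {T : measurableType dT} {R : realType}.
Variables (P : probability T R) (Y : T -> R) (K : R).
Hypothesis mY : measurable_fun setT Y.
Hypothesis Y_bound : forall w, `|Y w| <= K.

Local Notation L t := (\int[P]_w expR (t * Y w)).

Lemma exp_bounded_integrable (t : R) :
  P.-integrable setT (EFin \o (fun w => expR (t * Y w))).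
Proof.
apply: (bounded_integrable P (K := expR (`|t| * K))).
  by apply: measurableT_comp => //; exact: measurable_funM.
move=> w; rewrite ger0_norm ?expR_ge0 // ler_expR; apply: le_trans (ler_norm _) _.
by rewrite normrM ler_wpM2l.
Qed.

Lemma mul_exp_bounded_integrable (t : R) :
  P.-integrable setT (EFin \o (fun w => Y w * expR (t * Y w))).
Proof.
apply: (bounded_integrable P (K := K * expR (`|t| * K))).
  by apply: measurable_funM => //; apply: measurableT_comp => //; exact: measurable_funM.
move=> w; rewrite normrM ler_pM // ger0_norm ?expR_ge0 // ler_expR.
by apply: le_trans (ler_norm _) _; rewrite normrM ler_wpM2l.
Qed.

(** [exp(dl (c - Y)) >= 1 + dl (c - Y)], integrated against [exp(tY)]: a backward step that replaces
    integrating the derivative of [log L]. The hypothesis bears on the right end [t] of the step. *)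
Lemma tilt_step_le (t dl c : R) : 0 <= dl ->
    \int[P]_w (Y w * expR (t * Y w)) <= c * L t ->
  L t <= expR (dl * c) * L (t - dl).
Proof.
move=> dl0 hc.
have iE := exp_bounded_integrable; have iY := mul_exp_bounded_integrable t.
have iZ (r s : R) : P.-integrable setT (EFin \o (fun w => r * expR (s * Y w))).
  rewrite (_ : _ \o _ = (fun w => r%:E * (expR (s * Y w))%:E)%E) //.
  by apply: integrableZl => //; exact: iE.
have iZY : P.-integrable setT (EFin \o (fun w => dl * (Y w * expR (t * Y w)))).
  rewrite (_ : _ \o _ = (fun w => dl%:E * (Y w * expR (t * Y w))%:E)%E) //.
  exact: integrableZl.
have : \int[P]_w ((1 + dl * c) * expR (t * Y w) - dl * (Y w * expR (t * Y w))) <=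
       \int[P]_w (expR (dl * c) * expR ((t - dl) * Y w)).
  apply: le_Rintegral => //; first by apply: (integrableB _ (iZ _ _) iZY).
  move=> w _; rewrite (_ : expR (dl * c) * _ = expR (dl * c - dl * Y w) * expR (t * Y w)).
    rewrite mulrA -mulrBl ler_wpM2r ?expR_ge0 //.
    by rewrite -addrA; exact: expR_ge1Dx.
  by rewrite -!expRD; congr expR; ring.
rewrite (RintegralB measurableT (iZ _ _) iZY) (RintegralZl _ measurableT (iE _)).
rewrite (RintegralZl _ measurableT iY) (RintegralZl _ measurableT (iE _)).
move: (ler_wpM2l dl0 hc); move: (\int[P]_w (Y w * _)) (L t) (L (t - dl)) => A B C.
nra.
Qed.

Lemma tilt_sum_le (dl : R) (c : nat -> R) (N : nat) : 0 <= dl ->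
    (forall i, (i < N)%N ->
       \int[P]_w (Y w * expR (i.+1%:R * dl * Y w)) <= c i * L (i.+1%:R * dl)) ->
  L (N%:R * dl) <= expR (\sum_(i < N) dl * c i).
Proof.
move=> dl0; elim: N => [_|N IH hc].
  rewrite big_ord0 expR0; under eq_Rintegral do rewrite !mul0r expR0.
  by rewrite Rintegral_cst_prob.
rewrite big_ord_recr /= expRD [leRHS]mulrC.
apply: le_trans (tilt_step_le dl0 (hc N (ltnSn N))) _.
rewrite ler_wpM2l ?expR_ge0 // -{1}[N.+1%:R]natr1 mulrDl mul1r addrK.
by apply: IH => i iN; apply: hc; exact: ltnW.
Qed.

Lemma exp_tail_le (s y : R) : 0 <= s ->
  (P [set w | (y <= Y w)%R] <= (expR (- (s * y)) * L s)%:E)%E.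
Proof.
move=> s0; have mA : measurable [set w | y <= Y w] by exact: measurable_superlevel.
rewrite -RintegralZl //; last exact: exp_bounded_integrable.
have iZ : P.-integrable setT (EFin \o (fun w => expR (- (s * y)) * expR (s * Y w))).
  rewrite (_ : _ \o _ = (fun w => (expR (- (s * y)))%:E * (expR (s * Y w))%:E)%E) //.
  by apply: integrableZl => //; exact: exp_bounded_integrable.
rewrite /Rintegral fineK ?integrable_fin_num // -[X in P X]setIT.
rewrite -(integral_indic P measurableT mA); apply: ge0_le_integral => //.
- by apply/measurable_EFinP; exact: measurable_indic.
- by case/integrableP: iZ.
move=> w _; rewrite lee_fin indicE; case: (boolP (w \in _)) => [|_]; last by rewrite mulr_ge0 ?expR_ge0.
rewrite inE /= -expRD => yY; rewrite -[leLHS]expR0 ler_expR addrC subr_ge0.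
exact: ler_wpM2l.
Qed.

(** Chernoff's bound at [N dl] after [N] backward steps, in which [m] cancels. The values of [h] are
    taken at the right endpoints [i.+1 dl], as in [inverse_integral_le]. *)
Lemma discrete_tail_le (dl m x : R) (h : R -> R) (N : nat) : 0 <= dl ->
    (forall i, (i < N)%N -> \int[P]_w (Y w * expR (i.+1%:R * dl * Y w)) <=
       (m + h (i.+1%:R * dl)) * L (i.+1%:R * dl)) ->
  (P [set w | (m + x <= Y w)%R] <=
     (expR (- (dl * \sum_(i < N) (x - h (i.+1%:R * dl)))))%:E)%E.
Proof.
move=> dl0 hc; have s0 : 0 <= N%:R * dl by rewrite mulr_ge0.
apply: le_trans (exp_tail_le _ s0) _; rewrite lee_fin.
apply: le_trans (ler_wpM2l (expR_ge0 _) (tilt_sum_le dl0 hc)) _.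
rewrite -expRD ler_expR -mulr_sumr le_eqVlt; apply/orP; left; apply/eqP.
rewrite sumrB big_split /= !sumr_const !card_ord -[m *+ _]mulr_natr -[x *+ _]mulr_natr; ring.
Qed.

End exponential_tilting.

Section clamping.
Context {R : realType}.
Implicit Types (K r s : R).

Definition clamp K r : R := Num.max (Num.min r K) (- K).

Lemma clamp_lip K r s : `|clamp K r - clamp K s| <= `|r - s|.
Proof. exact: le_trans (max_lip _ _ _) (min_lip _ _ _). Qed.

Lemma normr_clamp_le K r : 0 <= K -> `|clamp K r| <= K.
Proof.
move=> K0; rewrite ler_norml /clamp le_max lexx orbT ge_max ge_min lexx orbT /=.
lra.
Qed.

Lemma clamp_ge K r s : s <= r -> s <= K -> s <= clamp K r.
Proof. by move=> sr sK; rewrite /clamp le_max le_min sr sK. Qed.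

Lemma clamp_le K r s : r <= s -> - K <= s -> clamp K r <= s.
Proof. by move=> rs Ks; rewrite /clamp ge_max ge_min rs Ks. Qed.

End clamping.

Section clamped_mean.
Context {dT : measure_display} {T : measurableType dT} {R : realType} {d : nat}.
Local Notation V := 'rV[R]_d.
Variables (P : probability T R) (X : T -> V).
Hypothesis mX : measurable_fun setT X.
Variable t0 : R.
Hypothesis t0_gt0 : 0 < t0.
Hypothesis X_exp : (\int[P]_w (expR (t0 * enorm (X w)))%:E < +oo)%E.
Variables (nu : 'I_d -> {measure set R -> \bar R}) (m1 : V).
Hypothesis X_indep : mutually_independent P (fun k w => X w 0 k).
Hypothesis nu2 : forall k, (nu k).-integrable setT (EFin \o (fun u : R => u ^+ 2)).
Hypothesis X_char : forall k (s : R),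
  \int[P]_w cos (s * X w 0 k) =
    expR (cos_part (nu k) s) * cos (s * m1 0 k + sin_part (nu k) s) /\
  \int[P]_w sin (s * X w 0 k) =
    expR (cos_part (nu k) s) * sin (s * m1 0 k + sin_part (nu k) s).
Variables (f : V -> R) (a : R) (b : 'I_d -> R) (eps : R).
Hypothesis f_lip : forall x y, `|f x - f y| <= a * enorm (x - y).
Hypothesis f_coord : forall k (u : R) (x : V),
  `|f (x + u *: delta_mx 0 k) - f x| <= b k * `|u|.
Hypothesis a_ge0 : 0 <= a.
Hypothesis b_ge0 : forall k, 0 <= b k.
Hypothesis eps_gt0 : 0 < eps.

Lemma mean_excess_le Kg : 0 <= Kg ->
  Ex P X (excess a Kg eps) <= a * \int[P]_w Num.max (enorm (X w) - eps) 0.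
Proof.
move=> Kg0.
have mmax : measurable_fun setT (fun w => Num.max (enorm (X w) - eps) 0).
  apply: measurable_maxr => //; apply: measurable_funB => //.
  exact: measurable_enormX.
have imax : P.-integrable setT (EFin \o (fun w => Num.max (enorm (X w) - eps) 0)).
  apply: (enormX_pow_integrable mX t0_gt0 X_exp (n := 0)) => // w.
  rewrite ger0_norm ?le_max ?lexx ?orbT // expr1 ge_max enorm_ge0 andbT.
  by rewrite lerBlDr lerDl ltW.
rewrite -(RintegralZl _ measurableT imax); apply: le_Rintegral => //.
- apply: (bounded_mfun_integrable P mX); split.
    by apply: measurable_lipschitz; exact: excess_lip.
  exists Kg => x; rewrite ger0_norm ?excess_ge0 //; exact: excess_le.
- rewrite (_ : _ \o _ = (fun w => a%:E * (Num.max (enorm (X w) - eps) 0)%:E)%E) //.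
  exact: integrableZl.
- by move=> w _; rewrite /excess ge_min lexx.
Qed.

Variable K : R.
Hypothesis K_ge : `|f 0| <= K.

Local Notation fK := (fun x => clamp K (f x)).
Local Notation mu :=
  (f 0 + a * \int[P]_w Num.max (enorm (X w) - eps) 0 + a * eps).

(** The cap [K + |f 0| + a eps] is such that, where it is reached, the right side is at least [K];
    elsewhere [f x <= f 0 + a |x|] suffices. *)
Lemma clamp_excess_le x :
  clamp K (f x) <= f 0 + a * eps + excess a (K + `|f 0| + a * eps) eps x.
Proof.
have ae : 0 <= a * eps by rewrite mulr_ge0 // ltW.
have K0 : 0 <= K by apply: le_trans K_ge.
have f0 : - `|f 0| <= f 0 by rewrite lerNl -normrN ler_norm.
rewrite /excess; case: (leP (a * _) (K + _ + _)) => [_|_]; last first.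
  apply: le_trans (ler_norm _) _; apply: le_trans (normr_clamp_le _ K0) _.
  lra.
have max0 : 0 <= a * Num.max (enorm x - eps) 0 by rewrite mulr_ge0 // le_max lexx orbT.
apply: clamp_le; last first.
  by move: K_ge max0 f0 ae; move: (a * Num.max _ _) (a * eps) (f 0) `|f 0| => A B C D h1 h2 h3 h4; lra.
have := f_lip x 0; rewrite subr0 => /(le_trans (ler_norm _)) h.
have : a * (enorm x - eps) <= a * Num.max (enorm x - eps) 0.
  by rewrite ler_wpM2l // le_max lexx.
lra.
Qed.

Lemma clamped_tilted_mean_le t :
    0 <= t -> (t%:E < exp_moment_sup P X b)%E ->
  \int[P]_w (fK (X w) * expR (t * fK (X w))) <=
  (mu + hfun a eps b nu t) * \int[P]_w expR (t * fK (X w)).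
Proof.
move=> tge0 tM.
have K0 : 0 <= K by apply: le_trans K_ge.
have ae : 0 <= a * eps by rewrite mulr_ge0 // ltW.
pose Kg := K + `|f 0| + a * eps; have Kg0 : 0 <= Kg by rewrite !addr_ge0.
have fK_lip x y : `|fK x - fK y| <= a * enorm (x - y).
  exact: le_trans (clamp_lip _ _ _) (f_lip _ _).
have fK_coord k (u : R) x : `|fK (x + u *: delta_mx 0 k) - fK x| <= b k * `|u|.
  exact: le_trans (clamp_lip _ _ _) (f_coord _ _ _).
have fK_bound x : `|fK x| <= K by exact: normr_clamp_le.
have X2 := coord_sqr_integrable mX t0_gt0 X_exp.
have int k p := below_jump_weight_integrable mX t0_gt0 X_exp b_ge0 X_indep nu2
  X_char k p tge0 tM.
have key := tilted_mean_le mX X_indep X2 nu2 X_char fK_lip fK_coord fK_bound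
  a_ge0 b_ge0 Kg0 eps_gt0 tge0 (int^~ 0%N) (int^~ 1%N).
have me := mean_excess_le Kg0.
have bE : bounded_mfun (excess a Kg eps : V -> R).
  split; first by apply: measurable_lipschitz; exact: excess_lip.
  by exists Kg => x; rewrite ger0_norm ?excess_ge0 //; exact: excess_le.
have bF : bounded_mfun (tilt fK t).
  split; first by apply: measurable_lipschitz; exact: (tilt_lip fK_lip fK_bound).
  by exists (expR (t * K)) => x; rewrite ger0_norm ?tilt_ge0 //; exact: tilt_le.
have mfK : measurable_fun setT fK.
  apply: (@measurable_lipschitz _ _ a) => x y; apply: le_trans (fK_lip _ _) _.
  by rewrite ler_wpM2l // enorm_le_l1norm.
have bfK : bounded_mfun fK by split=> //; exists K.
have iF := bounded_mfun_integrable P mX bF.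
have iEF := bounded_mfun_integrable P mX (bounded_mfunM bE bF).
have ifF := bounded_mfun_integrable P mX (bounded_mfunM bfK bF).
have F0 : 0 <= Ex P X (tilt fK t).
  by apply: Rintegral_ge0 => w _; exact: expR_ge0.
have iZF : P.-integrable setT (EFin \o (fun w => (f 0 + a * eps) * tilt fK t (X w))).
  rewrite (_ : _ \o _ = (fun w => (f 0 + a * eps)%:E * (tilt fK t (X w))%:E)%E) //.
  exact: integrableZl.
apply: (@le_trans _ _ ((f 0 + a * eps) * Ex P X (tilt fK t) +
    Ex P X (fun x => excess a Kg eps x * tilt fK t x))).
  rewrite /Ex -(RintegralZl _ measurableT iF) -(RintegralD measurableT iZF iEF).
  apply: (le_Rintegral measurableT ifF (integrableD measurableT iZF iEF)) => w _.
  by rewrite -mulrDl ler_wpM2r ?expR_ge0 //; exact: clamp_excess_le.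
apply: le_trans (lerD (lexx _) key) _; rewrite -mulrDl ler_wpM2r //.
move: me; move: (Ex P X _) (hfun _ _ _ _ _) => A B me; lra.
Qed.

End clamped_mean.

(** * The deviation inequality for f(X) *)

Theorem theorem3 (R : realType) (dT : measure_display) (T : measurableType dT)
    (P : probability T R) (d : nat) (X : {RV P >-> 'rV[R]_d})
    (gamma : 'rV[R]_d) (nu : {measure set 'rV[R]_d -> \bar R})
    (tnu : 'I_d -> {measure set R -> \bar R})
    (nu_neq0 : nu [set: 'rV[R]_d] <> 0%E)
    (X_ID : ID_vector P X gamma nu)
    (X_indep : mutually_independent P (fun k w => X w 0 k))
    (X_levy : forall k, levy_measure_of P (fun w => X w 0 k) (tnu k))
    (X_exp : exists2 t : R, 0 < t &
       ('E_P[fun w => expR (t * enorm (X w))] < +oo)%E)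
    (f : 'rV[R]_d -> R) (a : R)
    (f_lip : forall x y, `|f x - f y| <= a * enorm (x - y))
    (b : 'I_d -> R)
    (f_coord : forall k (u : R) (x : 'rV[R]_d),
       `|f (x + u *: delta_mx 0 k) - f x| <= b k * `|u|)
    (eps : R) (eps_gt0 : 0 < eps) :
  let M := exp_moment_sup P X b in
  let h := hfun a eps b tnu in
  let hinv := inverse_on h M in
  forall x : R, 0 < x -> (x%:E < left_limit h M)%E ->
  (P [set w | (f 0 + a * fine 'E_P[fun w => Num.max (enorm (X w) - eps) 0]
                 + a * eps + x <= f (X w))%R]
   <= (expR (- \int[lebesgue_measure]_(s in `[0, x]) hinv s)%R)%:E)%E.
Proof.
move=> M h hinv x x_gt0 xM.
have mX : measurable_fun setT (X : T -> 'rV[R]_d) by exact: measurable_funPT.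
case: X_exp => t0 t0_gt0; rewrite unlock => X_exp0.
have b_ge0 k : 0 <= b k.
  by have := le_trans (normr_ge0 _) (f_coord k 1 0); rewrite normr1 mulr1.
have M_gt0 : (0 < M)%E by exact: (exp_moment_sup_gt0 mX t0_gt0 X_exp0).
have [t1 [t1_ge0 t1M xt1]] := left_limit_gt (ltW x_gt0) M_gt0 xM.
(* For [d = 0], [h] vanishes, against [x < h t1]; for [d > 0] a unit vector shows that the Lipschitz
   constant is nonnegative. *)
have a_ge0 : 0 <= a.
  have [[k _]|no_k] := pselect (exists k : 'I_d, True); last first.
    suff : h t1 = 0 by move=> h1; rewrite h1 ltNge (ltW x_gt0) in xt1.
    rewrite /h /hfun !big1 ?sqrtr0 ?mulr0 ?addr0 // => k _;
      by case: no_k; exists k.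
  have ek : 0 < enorm (delta_mx 0 k - 0 : 'rV[R]_d).
    apply: lt_le_trans (normr_coord_le _ k).
    by rewrite !mxE !eqxx subr0 normr1.
  by rewrite -(pmulr_lge0 _ ek); apply: le_trans (f_lip _ _).
have mXk k := measurable_coordX mX k.
have X2 := coord_sqr_integrable mX t0_gt0 X_exp0.
have nu2 k := levy_sq_integrable (mXk k) (X2 k) (X_levy k).
have /choice[m mP] k := levy_khintchine_mean (mXk k) (X2 k) (X_levy k).
pose m1 : 'rV[R]_d := \row_k m k.
have X_char k (s : R) : \int[P]_w cos (s * X w 0 k) =
    expR (cos_part (tnu k) s) * cos (s * m1 0 k + sin_part (tnu k) s) /\
  \int[P]_w sin (s * X w 0 k) =
    expR (cos_part (tnu k) s) * sin (s * m1 0 k + sin_part (tnu k) s).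
  by rewrite /m1 mxE; exact: mP.
have h0 : h 0 = 0 by exact: hfun0.
have h_le s t : 0 <= s -> s <= t -> (t%:E < M)%E -> h s <= h t.
  exact: (hfun_below_le mX t0_gt0 X_exp0).
rewrite -/(Rintegral P setT (fun w => Num.max (enorm (X w) - eps) 0)).
set E := \int[P]_w _; pose mu := f 0 + a * E + a * eps.
(* Large enough that [mu + x <= f] survives clamping, and at least [|f 0|] as [clamp_excess_le]
   requires. *)
pose K := `|f 0| + `|mu + x|.
have f0K : `|f 0| <= K by rewrite lerDl.
have K_ge0 : 0 <= K by rewrite addr_ge0.
have mY : measurable_fun setT (fun w => clamp K (f (X w))).
  apply: (measurable_compX mX (psi := fun x => clamp K (f x))).
  apply: (@measurable_lipschitz _ _ a) => y z.
  apply: le_trans (clamp_lip _ _ _) (le_trans (f_lip _ _) _).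
  by rewrite ler_wpM2l // enorm_le_l1norm.
have Y_bound w : `|clamp K (f (X w))| <= K by exact: normr_clamp_le.
have mA : measurable [set w | mu + x <= clamp K (f (X w))].
  exact: measurable_superlevel.
have fm : measurable_fun setT (fun w => f (X w)).
  apply: (measurable_compX mX (psi := f)); apply: (@measurable_lipschitz _ _ a) => y z.
  by apply: le_trans (f_lip _ _) _; rewrite ler_wpM2l // enorm_le_l1norm.
have mB : measurable [set w | mu + x <= f (X w)].
  exact: measurable_superlevel.
apply: (@le_trans _ _ (P [set w | (mu + x <= clamp K (f (X w)))%R])).
  apply: le_measure; rewrite ?inE // => w /= muf.
  by apply: clamp_ge => //; rewrite (le_trans (ler_norm _)) // lerDr.
set I := \int[_]_(s in _) _; set A := [set w | _].
have PA := fin_num_measure P A mA.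
(* The grid costs the error [dl x], made arbitrarily small at the end by [dl = e / x]. *)
have step dl : 0 < dl -> fine (P A) <= expR (- I + dl * x).
  move=> dl_gt0; rewrite -lee_fin (fineK PA).
  have [N [NM hN I_le]] := inverse_integral_le x_gt0 dl_gt0 h0 h_le t1_ge0 t1M xt1.
  apply: le_trans (discrete_tail_le (h := h) (N := N) mY Y_bound x (ltW dl_gt0) _) _.
    move=> i iN; apply: (clamped_tilted_mean_le mX t0_gt0 X_exp0 X_indep nu2 X_char) => //.
      by rewrite mulr_ge0 // ltW.
    by apply: le_lt_trans NM; rewrite lee_fin ler_pM2r // ler_nat.
  by rewrite lee_fin ler_expR; move: I_le; rewrite -/I mulrDr; lra.
rewrite -(fineK PA) lee_fin; have := fine_ge0 (measure_ge0 P A).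
(* A null probability is set apart because logarithms are taken next. *)
rewrite le0r => /orP[/eqP ->|p_gt0]; first exact: expR_ge0.
rewrite -ler_ln ?posrE ?expR_gt0 // expRK; apply/ler_addgt0Pr => e e_gt0.
have := step (e / x) (divr_gt0 e_gt0 x_gt0).
by rewrite -ler_ln ?posrE ?expR_gt0 // expRK divfK // gt_eqF.
Qed.
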